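(* Let $f(x)$ be any function on $[-\pi,0)\cup(0,\pi]$ satisfying the following conditions: (i) $f$, $f'$ and $f''$ exist and are continuous on both intervals $[-\pi,0)$ and $(0,\pi]$; (ii) the finite one-sided limits $f(0\pm)$, $f'(0\pm)$ and $f''(0\pm)$ exist; (iii) $f$ satisfies the boundary conditions $\cos\alpha\, f(-\pi)+\sin\alpha\, f'(-\pi)=0$, $\cos\beta\, f(\pi)+\sin\beta\, f'(\pi)=0$ and the transmission conditions $\beta^{-}_{i1}f'(0-)+\beta^{-}_{i0}f(0-)+\beta^{+}_{i1}f'(0+)+\beta^{+}_{i0}f(0+)=0$ for $i=1,2$. Then $f(x)$ can be expanded into an absolutely and uniformly convergent series of the normalized eigenfunctions $(\varphi_n)$ of the problem described in the context, namely $$f(x)=\sum_{n=0}^{\infty}\Big\{\frac{\Delta_{34}}{p_1}\int_{-\pi}^{0}f(\xi)\varphi_n(\xi)\,d\xi+\frac{\Delta_{12}}{p_2}\int_{0}^{\pi}f(\xi)\varphi_n(\xi)\,d\xi\Big\}\varphi_n(x).$$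
   Context: Problem. Let $p(x)=p_1>0$ for $x\in[-\pi,0)$ and $p(x)=p_2>0$ for $x\in(0,\pi]$ ($p_1,p_2$ constants). Let $q$ be a given real-valued function, continuous on each of $[-\pi,0)$ and $(0,\pi]$, with finite one-sided limits $q(0-)$, $q(0+)$. Let $\beta^{\pm}_{ij}$ ($i=1,2$, $j=0,1$) be real numbers, and let $\alpha,\beta$ be the parameters in the boundary conditions below. For a complex parameter $\lambda$ consider the equation $$-p(x)y''(x)+q(x)y(x)=\lambda y(x)$$ on the disjoint intervals $(-\pi,0)$ and $(0,\pi)$, with boundary conditions $\cos\alpha\, y(-\pi)+\sin\alpha\, y'(-\pi)=0$ and $\cos\beta\, y(\pi)+\sin\beta\, y'(\pi)=0$, and transmission conditions $$\beta^{-}_{i1}y'(0-)+\beta^{-}_{i0}y(0-)+\beta^{+}_{i1}y'(0+)+\beta^{+}_{i0}y(0+)=0,\qquad i=1,2.$$ Here $0\pm$ denote one-sided limits at $0$. An eigenvalue is a $\lambda$ for which this problem has a nontrivial solution (an eigenfunction). It is assumed that $\lambda=0$ is not an eigenvalue. Let $T=\begin{pmatrix}\beta^{+}_{10}&\beta^{+}_{11}&\beta^{-}_{10}&\beta^{-}_{11}\\ \beta^{+}_{20}&\beta^{+}_{21}&\beta^{-}_{20}&\beta^{-}_{21}\end{pmatrix}$ and, for $1\le i<j\le4$, let $\Delta_{ij}$ be the determinant of the $i$-th and $j$-th columns of $T$. Eigenfunctions. $\phi_1(\cdot,\lambda)$ is the solution of the equation on $[-\pi,0)$ with $u(-\pi)=\sin\alpha$,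 $u'(-\pi)=-\cos\alpha$; $\phi_2(\cdot,\lambda)$ is the solution on $(0,\pi]$ with $u(0+)=\frac{1}{\Delta_{12}}\big(\Delta_{23}\phi_1(0,\lambda)+\Delta_{24}\phi_1'(0,\lambda)\big)$, $u'(0+)=\frac{-1}{\Delta_{12}}\big(\Delta_{13}\phi_1(0,\lambda)+\Delta_{14}\phi_1'(0,\lambda)\big)$, where primes denote $x$-derivatives and the values of $\phi_1,\phi_1'$ at $0$ are left limits. The problem has precisely denumerably many eigenvalues $\lambda_0,\lambda_1,\lambda_2,\dots$. The function $\phi_n(x)=\phi(x,\lambda_n)$, equal to $\phi_1(x,\lambda_n)$ on $[-\pi,0)$ and to $\phi_2(x,\lambda_n)$ on $(0,\pi]$, is an eigenfunction for $\lambda_n$, and the normalized eigenfunctions are $$\varphi_n(x)=\Big(\tfrac{\Delta_{34}}{p_1}\int_{-\pi}^{0}\phi_n^2(\xi)\,d\xi+\tfrac{\Delta_{12}}{p_2}\int_{0}^{\pi}\phi_n^2(\xi)\,d\xi\Big)^{-1/2}\phi_n(x).$$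
   Formalization: The formal theorem adds the assumption Δ12·Δ34 > 0; without a sign condition the normalizing constant can vanish (e.g. Δ34 = 0 with y(0+)=y(0−), y'(0+)=0), so the normalized eigenfunctions are undefined. *)

(* Defs.v *)
From Stdlib Require Import Reals.
From Coquelicot Require Export Coquelicot.

Open Scope R_scope.

Record SL_data := {
  p1 : R; p2 : R;
  q : R -> R;
  alpha : R; beta : R;
  beta_m : nat -> nat -> R;  (* beta^-_{ij}, i = 1, 2, j = 0, 1 *)
  beta_p : nat -> nat -> R   (* beta^+_{ij}, i = 1, 2, j = 0, 1 *)
}.

Definition left_int (x : R) : Prop := - PI <= x < 0.
Definition right_int (x : R) : Prop := 0 < x <= PI.
Definition dom (x : R) : Prop := left_int x \/ right_int x.

Definition p (P : SL_data) (x : R) : R := if Rlt_dec x 0 then p1 P else p2 P.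

(* Entry (i, k) of the matrix T, with i = 1, 2 and k = 1, ..., 4. *)
Definition Tmat (P : SL_data) (i k : nat) : R :=
  match k with
  | 1%nat => beta_p P i 0
  | 2%nat => beta_p P i 1
  | 3%nat => beta_m P i 0
  | _ => beta_m P i 1
  end.

(* The 2 x 2 minor Delta_{kl} of T. *)
Definition minor (P : SL_data) (k l : nat) : R :=
  Tmat P 1 k * Tmat P 2 l - Tmat P 1 l * Tmat P 2 k.

(* Same as Coquelicot's [is_derive], except that the increments stay in [D]:
   the derivative is one-sided at the end points of [D]. *)
Definition is_derive_within (D : R -> Prop) (y : R -> C) (x : R) (l : C) : Prop :=
  @filterdiff R_AbsRing R_NormedModule C_R_NormedModule
    y (within D (locally x)) (fun h => scal h l).

Definition left_lim (y : R -> C) (l : C) : Prop :=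
  filterlim y (at_left 0) (locally l).
Definition right_lim (y : R -> C) (l : C) : Prop :=
  filterlim y (at_right 0) (locally l).

(* In the predicates below, [dy] is the derivative of [y]. *)

Definition solves (P : SL_data) (z : C) (D : R -> Prop) (y dy : R -> C) : Prop :=
  forall x, D x ->
    is_derive_within D y x (dy x) /\
    exists ddy : C, is_derive_within D dy x ddy /\
      (- (p P x * ddy) + q P x * y x = z * y x)%C.

Definition boundary_conditions (P : SL_data) (y dy : R -> C) : Prop :=
  (cos (alpha P) * y (- PI)%R + sin (alpha P) * dy (- PI)%R = 0)%C /\
  (cos (beta P) * y PI + sin (beta P) * dy PI = 0)%C.

Definition transmission_conditions (P : SL_data) (y dy : R -> C) : Prop :=
  exists ym dym yp dyp : C,
    left_lim y ym /\ left_lim dy dym /\ right_lim y yp /\ right_lim dy dyp /\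
    forall i : nat, i = 1%nat \/ i = 2%nat ->
      (beta_m P i 1 * dym + beta_m P i 0 * ym
       + beta_p P i 1 * dyp + beta_p P i 0 * yp = 0)%C.

Definition eigenvalue (P : SL_data) (z : C) : Prop :=
  exists y dy : R -> C,
    solves P z dom y dy /\ boundary_conditions P y dy /\
    transmission_conditions P y dy /\
    exists x, dom x /\ y x <> 0%C.

Definition is_phi1 (P : SL_data) (z : C) (u du : R -> C) : Prop :=
  solves P z left_int u du /\
  u (- PI) = RtoC (sin (alpha P)) /\ du (- PI) = RtoC (- cos (alpha P)).

(* [u1, du1] is the solution on the left interval, [u2, du2] the one on the right. *)
Definition is_phi2 (P : SL_data) (z : C) (u1 du1 u2 du2 : R -> C) : Prop :=
  solves P z right_int u2 du2 /\
  exists v dv : C,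
    left_lim u1 v /\ left_lim du1 dv /\
    right_lim u2 ((1 / minor P 1 2)%R * (minor P 2 3 * v + minor P 2 4 * dv))%C /\
    right_lim du2 ((-1 / minor P 1 2)%R * (minor P 1 3 * v + minor P 1 4 * dv))%C.

(* The value at 0 is irrelevant. *)
Definition glue (u1 u2 : R -> C) (x : R) : C := if Rlt_dec x 0 then u1 x else u2 x.

Definition weighted_int (P : SL_data) (g : R -> C) : C :=
  ((minor P 3 4 / p1 P)%R * RInt (V := C_R_CompleteNormedModule) g (- PI)%R 0%R
   + (minor P 1 2 / p2 P)%R * RInt (V := C_R_CompleteNormedModule) g 0%R PI)%C.

(* Principal square root; on nonnegative reals it is [sqrt]. *)
Definition Csqrt (z : C) : C :=
  (sqrt ((Cmod z + Re z) / 2),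
   (if Rle_dec 0 (Im z) then 1 else -1) * sqrt ((Cmod z - Re z) / 2)).

Definition normalized (P : SL_data) (u : R -> C) (x : R) : C :=
  (/ Csqrt (weighted_int P (fun t => u t ^ 2)) * u x)%C.

Definition abs_convergent_on (D : R -> Prop) (u : nat -> R -> C) : Prop :=
  forall x, D x -> ex_series (fun n => Cmod (u n x)).

Definition unif_convergent_on (D : R -> Prop) (u : nat -> R -> C) (s : R -> C) : Prop :=
  forall eps : R, 0 < eps -> exists N : nat, forall n : nat, (N <= n)%nat ->
    forall x, D x -> Cmod (sum_n (fun k => u k x) n - s x)%C < eps.

(* Main.v *)
Require Import Defs.
From Stdlib Require Import Reals Lra Psatz ClassicalEpsilon Classical.
From Coquelicot Require Import Coquelicot.

(** Weighting the two intervals by multiples of [Delta_34 / p_1] and [Delta_12 / p_2] makes the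
    problem symmetric, by Lagrange's identity and the Pluecker relation for the minors, so
    eigenvalues are real and eigenfunctions orthogonal.  Since 0 is not an eigenvalue the operator
    has an inverse [T], and a Gronwall estimate bounds [sup |T g|] by the weighted [L^2] norm of
    [g]; with Bessel's inequality this gives absolute and uniform convergence of the series.

    Completeness needs no compactness.  On the functions orthogonal to all eigenfunctions,
    [T - mu] is bounded below for every real [mu <> 0]: a solution is determined, up to a multiple
    of the solution satisfying the left boundary condition, by an initial value problem, and that
    multiple is controlled by the right boundary condition or by orthogonality.  Applied to
    [mu = r] and [mu = -r], where [r] is the norm of [T] there, this forces [r = 0].  The
    difference between the function and the sum of its series is such a function, hence zero. *)

(** * Calculus on the line *)

(** The conditions on [f] say that its real and imaginary parts lie in the range of [T]: [f = T g]
    with [g = q f - p f''], which extends continuously up to 0 from either side. The coefficients of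
    [f] are thus those of [g] divided by the eigenvalues, and Bessel's inequality for [g], with the
    sup bound on [T] applied to finite combinations, controls the tail of the series.

    The space of piecewise continuous functions is not complete in the weighted norm, so the norm of
    [T] may fail to be attained. This is why the steps are inequalities with explicit constants, and
    why completeness comes from improving an upper bound for the norm of [T] rather than from
    extracting an eigenfunction.

    Two reductions connect this with the problem as stated. Functions on half-open intervals are
    replaced by functions on the whole line with ordinary derivatives, and complex functions by
    pairs of real ones. The minors may both be negative, so the weights are multiplied by
    [Delta_34], a factor that cancels in each term of the series. *)

Definition clamp (a b x : R) : R := Rmax a (Rmin x b).

Lemma clamp_in (a b x : R) : a <= b -> a <= clamp a b x <= b.
Proof.
  intros H; unfold clamp; split; [apply Rmax_l|].
  apply Rmax_lub; [exact H|apply Rmin_r].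
Qed.

Lemma clamp_id (a b x : R) : a <= x <= b -> clamp a b x = x.
Proof.
  intros H; unfold clamp; rewrite Rmin_left by lra; apply Rmax_right; lra.
Qed.

Lemma clamp_lipschitz (a b x y : R) : Rabs (clamp a b y - clamp a b x) <= Rabs (y - x).
Proof.
  unfold clamp, Rmin.
  destruct (Rle_dec x b), (Rle_dec y b); unfold Rmax;
  repeat match goal with |- context [Rle_dec ?u ?v] => destruct (Rle_dec u v) end;
  apply Rabs_le; unfold Rabs; destruct (Rcase_abs (y - x)); split; lra.
Qed.

Lemma continuous_eps (f : R -> R) (x : R) :
  continuous f x <->
  forall eps, 0 < eps -> exists d, 0 < d /\
    forall y, Rabs (y - x) < d -> Rabs (f y - f x) < eps.
Proof.
  split.
  - intros H eps He.
    destruct (proj1 (filterlim_locally f (f x)) H (mkposreal eps He)) as [d Hd].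
    exists d; split; [apply cond_pos|]; intros y Hy; exact (Hd y Hy).
  - intros H; apply filterlim_locally; intros eps.
    destruct (H eps (cond_pos eps)) as [d [d0 Hd]].
    exists (mkposreal d d0); intros y Hy; exact (Hd y Hy).
Qed.

Lemma continuous_clamp (a b x : R) : continuous (clamp a b) x.
Proof.
  apply continuous_eps; intros eps He; exists eps; split; [exact He|].
  intros y Hy; eapply Rle_lt_trans; [apply clamp_lipschitz|exact Hy].
Qed.

Lemma cont_plus (f g : R -> R) (x : R) :
  continuous f x -> continuous g x -> continuous (fun y => f y + g y) x.
Proof. intros; apply (continuous_plus f g); assumption. Qed.

Lemma cont_mult (f g : R -> R) (x : R) :
  continuous f x -> continuous g x -> continuous (fun y => f y * g y) x.
Proof. intros; apply (continuous_mult f g); assumption. Qed.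

Lemma cont_const (c x : R) : continuous (fun _ : R => c) x.
Proof. apply continuous_const. Qed.

Lemma cont_id (x : R) : continuous (fun y : R => y) x.
Proof. apply continuous_id. Qed.

Lemma cont_minus (f g : R -> R) (x : R) :
  continuous f x -> continuous g x -> continuous (fun y => f y - g y) x.
Proof. intros; apply (continuous_minus f g); assumption. Qed.

Lemma cont_opp (f : R -> R) (x : R) :
  continuous f x -> continuous (fun y => - f y) x.
Proof. intros; apply (continuous_opp f); assumption. Qed.

Lemma cont_div (f : R -> R) (c x : R) :
  continuous f x -> continuous (fun y => f y / c) x.
Proof. intros; apply cont_mult; [assumption|apply cont_const]. Qed.

Lemma cont_pow (f : R -> R) (n : nat) (x : R) :
  continuous f x -> continuous (fun y => f y ^ n) x.
Proof.
  intros H; induction n; simpl; [apply cont_const|apply cont_mult; assumption].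
Qed.

Lemma cont_comp (f g : R -> R) (x : R) :
  continuous f x -> continuous g (f x) -> continuous (fun y => g (f y)) x.
Proof. intros; apply (continuous_comp f g); assumption. Qed.

Ltac cont := intros; repeat match goal with
  | H : forall x, continuous ?f x |- continuous ?f _ => apply H
  | |- continuous _ _ => assumption
  | |- continuous (fun _ => ?c) _ => apply cont_const
  | |- continuous (fun y => y) _ => apply cont_id
  | |- continuous (fun y => _ + _) _ => apply cont_plus
  | |- continuous (fun y => _ - _) _ => apply cont_minus
  | |- continuous (fun y => - _) _ => apply cont_opp
  | |- continuous (fun y => _ * _) _ => apply cont_mult
  | |- continuous (fun y => _ / _) _ => apply cont_div
  | |- continuous (fun y => _ ^ _) _ => apply cont_pow
  | H : forall n x, continuous (?f n) x |- continuous (?f _) _ => apply H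
  end.

Lemma ex_RInt_cont (f : R -> R) (a b : R) :
  (forall x, continuous f x) -> ex_RInt f a b.
Proof. intros H; apply (ex_RInt_continuous (V := R_CompleteNormedModule)); intros; apply H. Qed.

Lemma is_derive_RInt_cont (f : R -> R) (a x : R) :
  (forall x, continuous f x) -> is_derive (fun y => RInt f a y) x (f x).
Proof.
  intros H; apply (is_derive_RInt f _ a); [|apply H].
  apply filter_forall; intros y; apply (RInt_correct f), ex_RInt_cont, H.
Qed.

Lemma is_derive_cont (f : R -> R) (x l : R) : is_derive f x l -> continuous f x.
Proof. intros H; apply (ex_derive_continuous f); exists l; exact H. Qed.

Lemma is_derive_eq (f : R -> R) (x l l' : R) : is_derive f x l -> l = l' -> is_derive f x l'.
Proof. intros H <-; exact H. Qed.

Lemma continuous_pt (f : R -> R) (x : R) : continuous f x -> continuity_pt f x.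
Proof. apply continuity_pt_filterlim. Qed.

Lemma monotone_of_derive (f df : R -> R) (a b : R) : a <= b ->
  (forall x, a < x < b -> is_derive f x (df x)) ->
  (forall x, a <= x <= b -> continuous f x) ->
  (forall x, a <= x <= b -> 0 <= df x) -> f a <= f b.
Proof.
  intros Hab Hd Hc Hp.
  destruct (MVT_gen f a b df) as [c [Hc1 Hc2]].
  - rewrite Rmin_left, Rmax_right by lra; exact Hd.
  - rewrite Rmin_left, Rmax_right by lra; intros x Hx; apply continuous_pt, Hc, Hx.
  - rewrite Rmin_left, Rmax_right in Hc1 by lra.
    specialize (Hp c Hc1); nra.
Qed.

Lemma abs_le_of_derive (f df g dg : R -> R) (a b : R) : a <= b ->
  (forall x, a <= x <= b -> is_derive f x (df x)) ->
  (forall x, a <= x <= b -> is_derive g x (dg x)) ->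
  (forall x, a <= x <= b -> Rabs (df x) <= dg x) ->
  Rabs (f a) <= g a -> Rabs (f b) <= g b.
Proof.
  intros Hab Hf Hg Hle H0.
  assert (H1 : g a - f a <= g b - f b).
  { apply (monotone_of_derive (fun x => g x - f x) (fun x => dg x - df x)); auto.
    - intros x Hx; apply (is_derive_minus g f); [apply Hg|apply Hf]; lra.
    - intros x Hx; apply cont_minus; eapply is_derive_cont; [apply Hg|apply Hf]; lra.
    - intros x Hx; generalize (Hle x Hx) (Rle_abs (df x)); lra. }
  assert (H2 : g a + f a <= g b + f b).
  { apply (monotone_of_derive (fun x => g x + f x) (fun x => dg x + df x)); auto.
    - intros x Hx; apply (is_derive_plus g f); [apply Hg|apply Hf]; lra.
    - intros x Hx; apply cont_plus; eapply is_derive_cont; [apply Hg|apply Hf]; lra.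
    - intros x Hx; generalize (Hle x Hx) (Rle_abs (- df x)); rewrite Rabs_Ropp; lra. }
  generalize (Rle_abs (f a)) (Rle_abs (- f a)); rewrite Rabs_Ropp; intros.
  apply Rabs_le; lra.
Qed.

Lemma bounded_on_segment (f : R -> R) (a b : R) :
  (forall x, continuous f x) -> exists M, 0 < M /\ forall x, a <= x <= b -> Rabs (f x) <= M.
Proof.
  intros H.
  destruct (bounded_continuity (K := R_AbsRing) (V := R_NormedModule) f a b) as [M HM].
  - intros x _; apply H.
  - exists (Rmax M 1); split; [eapply Rlt_le_trans; [apply Rlt_0_1|apply Rmax_r]|].
    intros x Hx; eapply Rle_trans; [apply Rlt_le, HM, Hx|apply Rmax_l].
Qed.

Lemma exp_le_1 (x : R) : x <= 0 -> exp x <= 1.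
Proof. intros [H|H]; [rewrite <- exp_0; left; apply exp_increasing, H|subst; rewrite exp_0; lra]. Qed.

(** Gronwall's argument for the energy [v ^ 2 + dv ^ 2]: once damped by [exp (- c * (x - a))], it
    grows no faster than the integral of [w ^ 2]. The constant depends only on [Q] and the interval,
    which makes the bound uniform over all right-hand sides. *)
Lemma energy_estimate (a b : R) (Q : R -> R) : a <= b -> (forall x, continuous Q x) ->
  exists K, 1 <= K /\ forall v dv w : R -> R, (forall x, continuous w x) ->
    (forall x, a <= x <= b -> is_derive v x (dv x)) ->
    (forall x, a <= x <= b -> is_derive dv x (Q x * v x + w x)) ->
    forall x, a <= x <= b ->
      v x ^ 2 + dv x ^ 2 <= K * (v a ^ 2 + dv a ^ 2 + RInt (fun t => w t ^ 2) a b).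
Proof.
  intros Hab HQ.
  destruct (bounded_on_segment Q a b HQ) as [M [M0 HM]].
  (* The derivative of the energy is estimated by [2 v v' <= v^2 + v'^2],
     [2 Q v v' <= M (v^2 + v'^2)] and [2 v' w <= v'^2 + w^2]; the energy then appears with a factor
     of at most [2 + M]. *)
  set (c := 2 + M).
  exists (exp (c * (b - a))); split.
  { rewrite <- exp_0; destruct (Req_dec a b) as [->|Hn].
    - replace (c * (b - b)) with 0 by ring; lra.
    - left; apply exp_increasing; unfold c; apply Rmult_lt_0_compat; lra. }
  intros v dv w Hw Hv Hdv x Hx.
  assert (Hw2 : forall t, continuous (fun t => w t ^ 2) t) by cont.
  (* Accumulated forcing minus damped energy; that it is nondecreasing is the estimate before the
     exponential changes sides. *)
  set (F := fun t => RInt (fun t => w t ^ 2) a t - exp (- c * (t - a)) * (v t ^ 2 + dv t ^ 2)).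
  set (dF := fun t => w t ^ 2 - (- c * exp (- c * (t - a)) * (v t ^ 2 + dv t ^ 2)
     + exp (- c * (t - a)) * (2 * v t * dv t + 2 * dv t * (Q t * v t + w t)))).
  assert (HF : forall t, a <= t <= b -> is_derive F t (dF t)).
  { intros t Ht; unfold F, dF.
    apply (is_derive_minus (fun t => RInt (fun t => w t ^ 2) a t)
      (fun t => exp (- c * (t - a)) * (v t ^ 2 + dv t ^ 2))).
    - apply (is_derive_RInt_cont (fun t => w t ^ 2)), Hw2.
    - generalize (Hv t Ht) (Hdv t Ht); intros H1 H2.
      auto_derive.
      + repeat split; eexists; eassumption.
      + rewrite (is_derive_unique v t _ H1 : Derive (fun x => v x) t = _),
          (is_derive_unique dv t _ H2 : Derive (fun x => dv x) t = _); unfold Rminus; ring. }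
  assert (Hm : F a <= F x).
  { apply (monotone_of_derive F dF); [lra| | |].
    - intros t Ht; apply HF; lra.
    - intros t Ht; eapply is_derive_cont, HF; lra.
    - intros t Ht; unfold dF.
      assert (E0 := exp_pos (- c * (t - a))).
      assert (E1 : exp (- c * (t - a)) <= 1) by (apply exp_le_1; unfold c; nra).
      assert (HMt : Rabs (Q t) <= M) by (apply HM; lra).
      apply Rabs_le_between in HMt.
      assert (HE : 2 * v t * dv t + 2 * dv t * (Q t * v t + w t) <= c * (v t ^ 2 + dv t ^ 2) + w t ^ 2).
      { assert (2 * (Q t * (dv t * v t)) <= M * (v t ^ 2 + dv t ^ 2)).
        { assert (0 <= (M + Q t) * (v t - dv t) ^ 2) by (apply Rmult_le_pos; [lra|apply pow2_ge_0]).
          assert (0 <= (M - Q t) * (v t + dv t) ^ 2) by (apply Rmult_le_pos; [lra|apply pow2_ge_0]).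
          nra. }
        unfold c; generalize (pow2_ge_0 (v t - dv t)) (pow2_ge_0 (dv t - w t)) (pow2_ge_0 (v t)); intros.
        nra. }
      generalize (pow2_ge_0 (w t)); intros.
      set (E := exp (- c * (t - a))) in *.
      set (X := 2 * v t * dv t + 2 * dv t * (Q t * v t + w t)) in *.
      set (Y := v t ^ 2 + dv t ^ 2) in *.
      replace (- c * E * Y + E * X) with (E * (X - c * Y)) by ring.
      assert (E * (X - c * Y) <= E * w t ^ 2) by (apply Rmult_le_compat_l; lra).
      nra. }
  unfold F in Hm.
  rewrite RInt_point in Hm.
  replace (- c * (a - a)) with 0 in Hm by ring; rewrite exp_0 in Hm.
  change (zero : R) with 0 in Hm.
  assert (Hi : RInt (fun t => w t ^ 2) a x <= RInt (fun t => w t ^ 2) a b).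
  { rewrite <- (RInt_Chasles (fun t => w t ^ 2) a x b) by (apply ex_RInt_cont; exact Hw2).
    change (RInt (fun t : R => w t ^ 2) a x <= RInt (fun t : R => w t ^ 2) a x + RInt (fun t : R => w t ^ 2) x b).
    assert (0 <= RInt (fun t : R => w t ^ 2) x b).
    { apply RInt_ge_0; [lra|apply ex_RInt_cont, Hw2|intros; apply pow2_ge_0]. }
    lra. }
  set (I := RInt (fun t => w t ^ 2) a b) in *.
  set (Y := v x ^ 2 + dv x ^ 2) in *.
  set (Y0 := v a ^ 2 + dv a ^ 2) in *.
  assert (H1 : exp (- c * (x - a)) * Y <= Y0 + I) by lra.
  assert (0 <= Y) by (unfold Y; generalize (pow2_ge_0 (v x)) (pow2_ge_0 (dv x)); lra).
  assert (H2 : exp (c * (b - a)) * exp (- c * (x - a)) >= 1).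
  { rewrite <- exp_plus. replace (c * (b - a) + - c * (x - a)) with (c * (b - x)) by ring.
    assert (0 <= c * (b - x)) by (unfold c; apply Rmult_le_pos; lra).
    rewrite <- exp_0; apply Rle_ge; destruct (Rle_lt_or_eq_dec _ _ H0) as [h|h];
    [left; apply exp_increasing, h|rewrite <- h; lra]. }
  assert (E0 := exp_pos (c * (b - a))).
  apply Rmult_le_compat_l with (r := exp (c * (b - a))) in H1; [|lra].
  nra.
Qed.

(** * Uniform limits and geometrically dominated series *)

Lemma continuous_uniform_limit (F : nat -> R -> R) (f : R -> R) :
  (forall n x, continuous (F n) x) ->
  (forall eps, 0 < eps -> exists n, forall x, Rabs (F n x - f x) <= eps) ->
  forall x, continuous f x.
Proof.
  intros HF Hu x; apply continuous_eps; intros eps He.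
  destruct (Hu (eps / 4)) as [n Hn]; [lra|].
  destruct (proj1 (continuous_eps (F n) x) (HF n x) (eps / 4)) as [d [d0 Hd]]; [lra|].
  exists d; split; [exact d0|]; intros y Hy.
  specialize (Hd y Hy).
  generalize (Hn x) (Hn y); intros A1 A2.
  apply Rabs_le_between in A1; apply Rabs_le_between in A2; apply Rabs_lt_between in Hd.
  apply Rabs_lt_between; lra.
Qed.

Lemma le_of_geometric (A C : R) : (forall n, A <= C * (/ 2) ^ n) -> A <= 0.
Proof.
  intros H; destruct (Rle_lt_dec A 0) as [h|h]; [exact h|exfalso].
  assert (HC : 0 < C) by (generalize (H 0%nat); simpl; lra).
  destruct (pow_lt_1_zero (/ 2)) with (y := A / C) as [N HN].
  - rewrite Rabs_right; lra.
  - apply Rdiv_lt_0_compat; assumption.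
  - specialize (HN N (Nat.le_refl N)).
    assert (0 < (/ 2) ^ N) by (apply pow_lt; lra).
    rewrite Rabs_right in HN by lra.
    apply (Rmult_lt_compat_l C) in HN; [|exact HC].
    replace (C * (A / C)) with A in HN by (field; lra).
    generalize (H N); lra.
Qed.

Lemma half_pow_small (K eps : R) : 0 < eps -> exists n, K * (/ 2) ^ n <= eps.
Proof.
  intros He; apply NNPP; intros H.
  assert (eps <= 0); [|lra].
  apply (le_of_geometric eps K); intros n.
  destruct (Rle_lt_dec (K * (/ 2) ^ n) eps); [exfalso; apply H; exists n; assumption|lra].
Qed.

Lemma ex_series_half (u : nat -> R) (K : R) :
  (forall n, Rabs (u n) <= K * (/ 2) ^ n) -> ex_series u.
Proof.
  intros H; apply (ex_series_le (K := R_AbsRing) (V := R_CompleteNormedModule) u (fun n => K * (/ 2) ^ n) H).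
  apply (ex_series_scal (V := R_NormedModule) K (fun n => (/ 2) ^ n)).
  apply ex_series_geom; rewrite Rabs_right; lra.
Qed.

(** The geometric tail beyond [n] sums to exactly [K * (/ 2) ^ n]; the induction carries the
    difference of two such tails. *)
Lemma series_half_remainder (u : nat -> R) (K : R) (n : nat) :
  (forall n, Rabs (u n) <= K * (/ 2) ^ n) ->
  Rabs (sum_n u n - Series u) <= K * (/ 2) ^ n.
Proof.
  intros H.
  assert (Hm : forall k, Rabs (sum_n u (n + k) - sum_n u n) <= K * (/ 2) ^ n - K * (/ 2) ^ (n + k)).
  { induction k.
    - rewrite Nat.add_0_r, Rminus_diag, Rabs_R0; lra.
    - rewrite Nat.add_succ_r, sum_Sn; change plus with Rplus.
      generalize (H (S (n + k))); simpl pow; intros A1.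
      replace (sum_n u (n + k) + u (S (n + k)) - sum_n u n)
        with ((sum_n u (n + k) - sum_n u n) + u (S (n + k))) by ring.
      eapply Rle_trans; [apply Rabs_triang|]; lra. }
  assert (K0 : 0 <= K) by (generalize (H 0%nat) (Rabs_pos (u 0%nat)); simpl; lra).
  apply le_epsilon; intros eps He.
  assert (Hs := Series_correct u (ex_series_half u K H)).
  destruct (proj1 (filterlim_locally (sum_n u) (Series u)) Hs (mkposreal eps He)) as [N HN].
  specialize (HN (n + N)%nat (Nat.le_add_l _ _)).
  change (Rabs (sum_n u (n + N) - Series u) < eps) in HN.
  specialize (Hm N).
  assert (0 <= K * (/ 2) ^ (n + N)) by (apply Rmult_le_pos; [exact K0|left; apply pow_lt; lra]).
  replace (sum_n u n - Series u) with ((sum_n u (n + N) - Series u) - (sum_n u (n + N) - sum_n u n)) by ring.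
  unfold Rminus at 1; eapply Rle_trans; [apply Rabs_triang|]; rewrite Rabs_Ropp; lra.
Qed.

(** * Linear second-order equations *)

(** The solution of [y'' = h] with zero Cauchy data at [a]: the integral operator behind Picard
    iteration for second-order equations. *)
Definition dint (a : R) (h : R -> R) (x : R) : R := RInt (fun s => RInt h a s) a x.

Lemma is_derive_dint (a : R) (h : R -> R) (x : R) :
  (forall t, continuous h t) -> is_derive (dint a h) x (RInt h a x).
Proof.
  intros H; apply (is_derive_RInt_cont (fun s => RInt h a s)).
  intros t; eapply is_derive_cont, is_derive_RInt_cont, H.
Qed.

Lemma continuous_dint (a : R) (h : R -> R) (x : R) :
  (forall t, continuous h t) -> continuous (dint a h) x.
Proof. intros H; eapply is_derive_cont, is_derive_dint, H. Qed.

Lemma dint_start (a : R) (h : R -> R) : dint a h a = 0.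
Proof. exact (RInt_point a (fun s => RInt h a s)). Qed.

Lemma dint_ext (a : R) (h k : R -> R) (x : R) :
  (forall t, h t = k t) -> dint a h x = dint a k x.
Proof. intros H; apply RInt_ext; intros s _; apply RInt_ext; intros t _; apply H. Qed.

Lemma dint_plus (a : R) (h k : R -> R) (x : R) :
  (forall t, continuous h t) -> (forall t, continuous k t) ->
  dint a (fun t => h t + k t) x = dint a h x + dint a k x.
Proof.
  intros Hh Hk; unfold dint.
  rewrite (RInt_ext _ (fun s => RInt h a s + RInt k a s)).
  - apply (RInt_plus (fun s => RInt h a s) (fun s => RInt k a s));
    apply ex_RInt_cont; intros t; eapply is_derive_cont, is_derive_RInt_cont; assumption.
  - intros s _; apply (RInt_plus h k); apply ex_RInt_cont; assumption.
Qed.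

(** Each of the two integrations divides the exponentially weighted bound by [L], so a large rate
    gives a contraction on an interval of any length. *)
Lemma dint_bound (a b L A : R) (h : R -> R) : 0 < L ->
  (forall t, continuous h t) ->
  (forall t, a <= t <= b -> Rabs (h t) <= A * exp (L * (t - a))) ->
  forall x, a <= x <= b -> Rabs (dint a h x) <= A / L ^ 2 * exp (L * (x - a)).
Proof.
  intros HL Hh HA.
  assert (He : forall c t, is_derive (fun t => c / L * exp (L * (t - a))) t (c * exp (L * (t - a)))).
  { intros c t; auto_derive; [exact I|unfold Rminus; field; lra]. }
  assert (E0 : exp (L * (a - a)) = 1) by (rewrite Rminus_diag, Rmult_0_r; apply exp_0).
  assert (A0 : forall x, a <= x <= b -> 0 <= A).
  { intros x Hx; generalize (HA a) (Rabs_pos (h a)); rewrite E0; lra. }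
  assert (H1 : forall x, a <= x <= b -> Rabs (RInt h a x) <= A / L * exp (L * (x - a))).
  { intros x Hx; assert (A1 := A0 x Hx).
    apply (abs_le_of_derive (fun x => RInt h a x) h (fun t => A / L * exp (L * (t - a))) (fun t => A * exp (L * (t - a))) a); [lra| | | |].
    - intros t _; apply is_derive_RInt_cont, Hh.
    - intros t _; apply He.
    - intros t Ht; apply HA; lra.
    - rewrite RInt_point, E0; change (zero : R) with 0; rewrite Rabs_R0, Rmult_1_r.
      apply Rmult_le_pos; [exact A1|left; apply Rinv_0_lt_compat, HL]. }
  intros x Hx; assert (A1 := A0 x Hx).
  replace (A / L ^ 2) with (A / L / L) by (field; lra).
  apply (abs_le_of_derive (dint a h) (fun x => RInt h a x)
    (fun t => A / L / L * exp (L * (t - a))) (fun t => A / L * exp (L * (t - a))) a); [lra| | | |].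
  - intros t _; apply is_derive_dint, Hh.
  - intros t _; apply He.
  - intros t Ht; apply H1; lra.
  - rewrite dint_start, E0, Rabs_R0, Rmult_1_r.
    repeat apply Rmult_le_pos; try exact A1; left; apply Rinv_0_lt_compat, HL.
Qed.

(** Picard iteration, arranged as the series of the increments [d n] so that geometric bounds yield
    convergence and continuity of the sum. *)
Lemma linear_ode_existence (a b : R) (Q g : R -> R) (y0 y1 : R) : a <= b ->
  (forall x, continuous Q x) -> (forall x, continuous g x) ->
  exists u du : R -> R, (forall x, continuous u x) /\
    (forall x, a <= x <= b -> is_derive u x (du x)) /\
    (forall x, a <= x <= b -> is_derive du x (Q x * u x + g x)) /\
    u a = y0 /\ du a = y1.
Proof.
  intros Hab HQ Hg.
  destruct (bounded_on_segment Q a b HQ) as [M [M0 HM]].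
  (* With this rate each Picard step contracts the exponentially weighted norm by 1/2. *)
  set (L := 1 + 2 * M).
  assert (L0 : 0 < L) by (unfold L; lra).
  set (d0 := fun x => y0 + y1 * (x - a) + dint a g x).
  assert (Hd0 : forall x, continuous d0 x).
  { intros x; unfold d0; cont; apply continuous_dint, Hg. }
  set (d := fix d n := match n with 0%nat => d0 | S n => dint a (fun t => Q t * d n t) end).
  assert (Hd : forall n x, continuous (d n) x).
  { induction n; [exact Hd0|]; intros x; apply continuous_dint; cont. }
  destruct (bounded_on_segment d0 a b Hd0) as [K [K0 HK]].
  assert (Hb : forall n x, a <= x <= b -> Rabs (d n x) <= K * (/ 2) ^ n * exp (L * (x - a))).
  { induction n; intros x Hx.
    - simpl; rewrite Rmult_1_r; eapply Rle_trans; [apply HK, Hx|].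
      assert (1 <= exp (L * (x - a))).
      { eapply Rle_trans; [|apply exp_ineq1_le]; assert (0 <= L * (x - a)) by (apply Rmult_le_pos; lra); lra. }
      nra.
    - eapply Rle_trans.
      + apply (dint_bound a b L (M * (K * (/ 2) ^ n))); [exact L0|cont| |exact Hx].
        intros t Ht; rewrite Rabs_mult, (Rmult_assoc M).
        apply Rmult_le_compat; auto using Rabs_pos.
      + apply Rmult_le_compat_r; [left; apply exp_pos|].
        simpl pow; assert (0 < (/ 2) ^ n) by (apply pow_lt; lra).
        apply Rle_div_l; [apply Rmult_lt_0_compat; nra|].
        assert (2 * M <= L * (L * 1)) by (unfold L; nra).
        assert (0 < K * (/ 2) ^ n) by (apply Rmult_lt_0_compat; lra).
        nra. }
  set (K' := K * exp (L * (b - a))).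
  assert (Hb' : forall x n, Rabs (d n (clamp a b x)) <= K' * (/ 2) ^ n).
  { intros x n; assert (Hc := clamp_in a b x Hab).
    eapply Rle_trans; [apply Hb, Hc|]; unfold K'.
    rewrite Rmult_assoc, (Rmult_comm _ (exp _)), Rmult_assoc.
    apply Rmult_le_compat_l; [lra|].
    apply Rmult_le_compat_r; [left; apply pow_lt; lra|].
    assert (L * (clamp a b x - a) <= L * (b - a)) by (apply Rmult_le_compat_l; lra).
    destruct (Rle_lt_or_eq_dec _ _ H) as [h|h]; [left; apply exp_increasing, h|rewrite h; lra]. }
  (* The bounds on the increments hold on the segment only; clamping the argument makes the sum a
     continuous function on the whole line. *)
  set (y := fun x => Series (fun n => d n (clamp a b x))).
  set (S' := fun n x => sum_n (fun k => d k x) n).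
  assert (HS : forall n x, continuous (S' n) x).
  { unfold S'; induction n; intros x.
    - apply (continuous_ext (d 0%nat)); [intros; rewrite sum_O; reflexivity|apply Hd].
    - apply (continuous_ext (fun x => sum_n (fun k => d k x) n + d (S n) x)).
      + intros; rewrite sum_Sn; reflexivity.
      + apply cont_plus; [apply IHn|apply Hd]. }
  assert (Hr : forall n x, Rabs (S' n (clamp a b x) - y x) <= K' * (/ 2) ^ n).
  { intros n x; apply (series_half_remainder (fun n => d n (clamp a b x))), Hb'. }
  assert (Hy : forall x, continuous y x).
  { apply (continuous_uniform_limit (fun n x => S' n (clamp a b x))).
    - intros n x; apply (cont_comp (clamp a b) (S' n)); [apply continuous_clamp|apply HS].
    - intros eps He; destruct (half_pow_small K' eps He) as [n Hn].
      exists n; intros x; eapply Rle_trans; [apply Hr|exact Hn]. }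
  (* The limit [y] is only known to be continuous. The right-hand side of its integral equation is
     differentiable everywhere, and it equals [y] on the segment because the partial sums satisfy
     the same equation with the index shifted by one. *)
  set (u := fun x => d0 x + dint a (fun t => Q t * y t) x).
  assert (HSr : forall n x, S' (S n) x = d0 x + dint a (fun t => Q t * S' n t) x).
  { induction n; intros x.
    - unfold S'; rewrite sum_Sn, sum_O; change plus with Rplus; simpl.
      f_equal; apply dint_ext; intros t; rewrite sum_O; reflexivity.
    - change (S' (S (S n)) x) with (sum_n (fun k => d k x) (S (S n))).
      rewrite sum_Sn; change (sum_n (fun k => d k x) (S n)) with (S' (S n) x); change plus with Rplus.
      rewrite IHn; simpl (d (S (S n)) x); rewrite Rplus_assoc; f_equal.
      change (dint a (fun t => Q t * dint a (fun t0 => Q t0 * d n t0) t) x)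
        with (dint a (fun t => Q t * d (S n) t) x).
      rewrite <- dint_plus by cont.
      apply dint_ext; intros t.
      replace (S' (S n) t) with (S' n t + d (S n) t); [ring|].
      unfold S'; rewrite sum_Sn; reflexivity. }
  assert (Huy : forall x, a <= x <= b -> u x = y x).
  { intros x Hx; apply Rminus_diag_uniq, Rabs_eq_0, Rle_antisym; [|apply Rabs_pos].
    apply (le_of_geometric _ (M * K' * exp (1 * (b - a)) + K')); intros n.
    assert (P0 : 0 < (/ 2) ^ n) by (apply pow_lt; lra).
    assert (K1 : 0 <= K') by (unfold K'; apply Rmult_le_pos; [lra|left; apply exp_pos]).
    generalize (Hr (S n) x); rewrite (clamp_id a b x Hx); intros A1.
    assert (A2 : Rabs (dint a (fun t => Q t * (y t - S' n t)) x) <= M * (K' * (/ 2) ^ n) * exp (1 * (b - a))).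
    { eapply Rle_trans.
      - apply (dint_bound a b 1 (M * (K' * (/ 2) ^ n))); [lra|cont| |exact Hx].
        intros t Ht; rewrite Rabs_mult.
        generalize (Hr n t); rewrite (clamp_id a b t Ht); intros A3.
        rewrite Rabs_minus_sym in A3.
        rewrite <- (Rmult_1_r (Rabs (Q t) * _)).
        apply Rmult_le_compat; [apply Rmult_le_pos; apply Rabs_pos|lra| |].
        + apply Rmult_le_compat; auto using Rabs_pos.
        + eapply Rle_trans; [|apply exp_ineq1_le]; lra.
      - rewrite pow1, Rdiv_1_r.
        apply Rmult_le_compat_l; [apply Rmult_le_pos; [lra|apply Rmult_le_pos; lra]|].
        destruct Hx as [_ [h| ->]]; [left; apply exp_increasing; lra|lra]. }
    replace (u x - y x) with (dint a (fun t => Q t * (y t - S' n t)) x + (S' (S n) x - y x)).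
    - eapply Rle_trans; [apply Rabs_triang|]; simpl pow in A1; nra.
    - rewrite HSr; unfold u.
      enough (dint a (fun t => Q t * y t) x = dint a (fun t => Q t * (y t - S' n t)) x + dint a (fun t => Q t * S' n t) x) by lra.
      rewrite <- dint_plus by cont.
      apply dint_ext; intros t; ring. }
  assert (HQy : forall x, continuous (fun t => Q t * y t) x) by cont.
  exists u, (fun x => y1 + RInt g a x + RInt (fun t => Q t * y t) a x).
  assert (Hdu : forall x, is_derive u x (y1 + RInt g a x + RInt (fun t => Q t * y t) a x)).
  { intros x; unfold u, d0.
    apply (is_derive_plus (fun x => y0 + y1 * (x - a) + dint a g x) (dint a (fun t => Q t * y t)));
    [|apply is_derive_dint, HQy].
    apply (is_derive_plus (fun x => y0 + y1 * (x - a)) (dint a g)); [|apply is_derive_dint, Hg].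
    auto_derive; [exact I|ring]. }
  split; [|split; [|split; [|split]]].
  - intros x; eapply is_derive_cont, Hdu.
  - intros x _; apply Hdu.
  - intros x Hx; rewrite (Huy x Hx), Rplus_comm.
    apply (is_derive_plus (fun x => y1 + RInt g a x) (fun x => RInt (fun t => Q t * y t) a x));
    [|apply (is_derive_RInt_cont (fun t => Q t * y t)), HQy].
    apply is_derive_eq with (0 + g x); [|ring].
    apply (is_derive_plus (fun _ => y1) (fun x => RInt g a x)); [apply (is_derive_const y1)|].
    apply is_derive_RInt_cont, Hg.
  - unfold u, d0; rewrite !dint_start; ring.
  - rewrite (RInt_point a g), (RInt_point a (fun t => Q t * y t)).
    change (y1 + 0 + 0 = y1); ring.
Qed.

(** * The two-interval problem *)

(* The two components are the functions on the left ([true]) and right ([false]) interval; they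
   are defined on all of [R], but only their values on [lo b, hi b] matter. *)
Definition pw := bool -> R -> R.

(* The matrix [m] maps Cauchy data at the end of the left interval to those at the start of the
   right one; [kap_det] says that [kap] times the Wronskian is continuous across. *)
Record sl_problem := {
  lo : bool -> R; hi : bool -> R;
  pc : bool -> R; qf : pw; kap : bool -> R;
  ca : R; sa : R; cb : R; sb : R;
  m11 : R; m12 : R; m21 : R; m22 : R;
  lo_lt_hi : forall b, lo b < hi b;
  pc_pos : forall b, 0 < pc b;
  qf_cont : forall b x, continuous (qf b) x;
  kap_pos : forall b, 0 < kap b;
  csa : ca ^ 2 + sa ^ 2 = 1;
  csb : cb ^ 2 + sb ^ 2 = 1;
  kap_det : kap false * (m11 * m22 - m12 * m21) = kap true
}.

Definition inS (P : sl_problem) (b : bool) (x : R) : Prop := lo P b <= x <= hi P b.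
Definition contp (u : pw) : Prop := forall b x, continuous (u b) x.
(** The only linear operation: sums, differences and multiples are all instances, a multiple being
    written [lin c u 0 u]. Closure properties thus need a single proof. *)
Definition lin (c : R) (u : pw) (d : R) (v : pw) : pw := fun b x => c * u b x + d * v b x.
Definition zero_pw : pw := fun _ _ => 0.

Definition wt (P : sl_problem) (b : bool) : R := kap P b / pc P b.
Definition ip (P : sl_problem) (u v : pw) : R :=
  wt P true * RInt (fun x => u true x * v true x) (lo P true) (hi P true) +
  wt P false * RInt (fun x => u false x * v false x) (lo P false) (hi P false).

Definition linked (P : sl_problem) (u du : pw) : Prop :=
  u false (lo P false) = m11 P * u true (hi P true) + m12 P * du true (hi P true) /\
  du false (lo P false) = m21 P * u true (hi P true) + m22 P * du true (hi P true).

(* The equation is [- pc u'' + qf u = g]. *)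
Definition cauchy_sol (P : sl_problem) (u du g : pw) : Prop :=
  contp u /\
  (forall b x, inS P b x -> is_derive (u b) x (du b x) /\
     is_derive (du b) x ((qf P b x * u b x - g b x) / pc P b)) /\
  linked P u du.

(** The boundary forms are numbers and not propositions: their values on functions violating the
    condition serve to determine coefficients. *)
Definition left_bc (P : sl_problem) (u du : pw) : R :=
  ca P * u true (lo P true) + sa P * du true (lo P true).
Definition right_bc (P : sl_problem) (u du : pw) : R :=
  cb P * u false (hi P false) + sb P * du false (hi P false).

Definition sol (P : sl_problem) (u du g : pw) : Prop :=
  cauchy_sol P u du g /\ left_bc P u du = 0 /\ right_bc P u du = 0.

Lemma wt_pos (P : sl_problem) (b : bool) : 0 < wt P b.
Proof. apply Rdiv_lt_0_compat; [apply kap_pos|apply pc_pos]. Qed.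

Lemma contp_lin (c d : R) (u v : pw) : contp u -> contp v -> contp (lin c u d v).
Proof. intros Hu Hv b x; unfold lin; cont; [apply Hu|apply Hv]. Qed.

Lemma contp_zero : contp zero_pw.
Proof. intros b x; apply cont_const. Qed.

Lemma contp_mult (u v : pw) (b : bool) :
  contp u -> contp v -> forall x, continuous (fun x => u b x * v b x) x.
Proof. intros Hu Hv x; apply cont_mult; [apply Hu|apply Hv]. Qed.

Lemma RInt_lin (f g : R -> R) (c d a b : R) :
  (forall x, continuous f x) -> (forall x, continuous g x) ->
  RInt (fun x => c * f x + d * g x) a b = c * RInt f a b + d * RInt g a b.
Proof.
  intros Hf Hg.
  change (c * RInt f a b + d * RInt g a b) with (scal c (RInt f a b) + scal d (RInt g a b)).
  rewrite <- (RInt_scal f a b c), <- (RInt_scal g a b d) by (apply ex_RInt_cont; cont).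
  apply (RInt_plus (fun x => c * f x) (fun x => d * g x)); apply ex_RInt_cont; cont.
Qed.

Lemma RInt_ext_R (f g : R -> R) (a b : R) : (forall x, f x = g x) -> RInt f a b = RInt g a b.
Proof. intros H; apply RInt_ext; intros; apply H. Qed.

(** * The weighted inner product *)

Lemma ip_comm (P : sl_problem) (u v : pw) : ip P u v = ip P v u.
Proof.
  unfold ip; f_equal; f_equal; apply RInt_ext_R; intros; apply Rmult_comm.
Qed.

Lemma ip_ext (P : sl_problem) (u u' v v' : pw) :
  (forall b x, inS P b x -> u b x = u' b x) ->
  (forall b x, inS P b x -> v b x = v' b x) -> ip P u v = ip P u' v'.
Proof.
  intros Hu Hv; unfold ip; f_equal; f_equal; apply RInt_ext.
  - generalize (lo_lt_hi P true); intros; rewrite Rmin_left, Rmax_right in H0 by lra.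
    f_equal; [apply Hu|apply Hv]; split; lra.
  - generalize (lo_lt_hi P false); intros; rewrite Rmin_left, Rmax_right in H0 by lra.
    f_equal; [apply Hu|apply Hv]; split; lra.
Qed.

Lemma ip_lin_l (P : sl_problem) (c d : R) (u v w : pw) : contp u -> contp v -> contp w ->
  ip P (lin c u d v) w = c * ip P u w + d * ip P v w.
Proof.
  intros Hu Hv Hw; unfold ip, lin.
  assert (H : forall b s t, RInt (fun x => (c * u b x + d * v b x) * w b x) s t =
    c * RInt (fun x => u b x * w b x) s t + d * RInt (fun x => v b x * w b x) s t).
  { intros b s t; rewrite <- RInt_lin by (apply contp_mult; assumption).
    apply RInt_ext_R; intros x; ring. }
  rewrite !H; ring.
Qed.

Lemma ip_lin_r (P : sl_problem) (c d : R) (u v w : pw) : contp u -> contp v -> contp w ->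
  ip P w (lin c u d v) = c * ip P w u + d * ip P w v.
Proof.
  intros Hu Hv Hw; rewrite ip_comm, ip_lin_l, (ip_comm P u), (ip_comm P v) by assumption; reflexivity.
Qed.

Lemma ip_zero_l (P : sl_problem) (u : pw) : contp u -> ip P zero_pw u = 0.
Proof.
  intros Hu; rewrite (ip_ext P zero_pw (lin 0 zero_pw 0 zero_pw) u u).
  - rewrite ip_lin_l by (assumption || apply contp_zero); ring.
  - intros; unfold lin, zero_pw; ring.
  - reflexivity.
Qed.

Lemma sheet_sq_ge0 (P : sl_problem) (u : pw) (b : bool) : contp u ->
  0 <= RInt (fun x => u b x * u b x) (lo P b) (hi P b).
Proof.
  intros Hu; apply RInt_ge_0; [left; apply lo_lt_hi| |intros; apply Rle_0_sqr].
  apply ex_RInt_cont, contp_mult; exact Hu.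
Qed.

Lemma sheet_sq_le (P : sl_problem) (u : pw) (b : bool) : contp u ->
  wt P b * RInt (fun x => u b x * u b x) (lo P b) (hi P b) <= ip P u u.
Proof.
  intros Hu; unfold ip.
  assert (H1 := Rmult_le_pos _ _ (Rlt_le _ _ (wt_pos P true)) (sheet_sq_ge0 P u true Hu)).
  assert (H2 := Rmult_le_pos _ _ (Rlt_le _ _ (wt_pos P false)) (sheet_sq_ge0 P u false Hu)).
  destruct b; lra.
Qed.

Lemma ip_ge0 (P : sl_problem) (u : pw) : contp u -> 0 <= ip P u u.
Proof.
  intros Hu; eapply Rle_trans; [|apply (sheet_sq_le P u true Hu)].
  apply Rmult_le_pos; [left; apply wt_pos|apply sheet_sq_ge0, Hu].
Qed.

(** The squared norm of the constant function 1, the factor that converts sup bounds into norm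
    bounds. *)
Definition mass (P : sl_problem) : R :=
  wt P true * (hi P true - lo P true) + wt P false * (hi P false - lo P false).

Lemma mass_pos (P : sl_problem) : 0 < mass P.
Proof.
  unfold mass; generalize (lo_lt_hi P true) (lo_lt_hi P false) (wt_pos P true) (wt_pos P false); intros.
  apply Rplus_lt_0_compat; apply Rmult_lt_0_compat; lra.
Qed.

Lemma ip_le_sup (P : sl_problem) (u : pw) (A : R) : contp u ->
  (forall b x, inS P b x -> u b x ^ 2 <= A) -> ip P u u <= mass P * A.
Proof.
  intros Hu HA.
  assert (H : forall b, RInt (fun x => u b x * u b x) (lo P b) (hi P b) <= (hi P b - lo P b) * A).
  { intros b; replace ((hi P b - lo P b) * A) with (RInt (fun _ : R => A) (lo P b) (hi P b)).
    - apply RInt_le; [left; apply lo_lt_hi|apply ex_RInt_cont, contp_mult; exact Hu|apply ex_RInt_cont; cont|].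
      intros x Hx; replace (u b x * u b x) with (u b x ^ 2) by ring; apply HA; split; lra.
    - rewrite RInt_const; reflexivity. }
  unfold ip, mass.
  generalize (Rmult_le_compat_l _ _ _ (Rlt_le _ _ (wt_pos P true)) (H true))
    (Rmult_le_compat_l _ _ _ (Rlt_le _ _ (wt_pos P false)) (H false)); lra.
Qed.

Lemma ip_eq0 (P : sl_problem) (u : pw) : contp u -> ip P u u = 0 ->
  forall b x, inS P b x -> u b x = 0.
Proof.
  intros Hu H0 b.
  assert (Hi : RInt (fun x => u b x * u b x) (lo P b) (hi P b) = 0).
  { generalize (sheet_sq_le P u b Hu) (sheet_sq_ge0 P u b Hu) (wt_pos P b); rewrite H0; intros.
    apply Rle_antisym; [|assumption].
    apply Rmult_le_reg_l with (wt P b); lra. }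
  assert (Hc : forall x, continuous (fun x => u b x * u b x) x) by (apply contp_mult; exact Hu).
  assert (Hint : forall x, inS P b x -> RInt (fun x => u b x * u b x) (lo P b) x = 0).
  { intros x [Hx1 Hx2].
    assert (A1 : 0 <= RInt (fun x => u b x * u b x) (lo P b) x).
    { apply RInt_ge_0; [lra|apply ex_RInt_cont, Hc|intros; apply Rle_0_sqr]. }
    assert (A2 : 0 <= RInt (fun x => u b x * u b x) x (hi P b)).
    { apply RInt_ge_0; [lra|apply ex_RInt_cont, Hc|intros; apply Rle_0_sqr]. }
    assert (A3 : RInt (fun x => u b x * u b x) (lo P b) x + RInt (fun x => u b x * u b x) x (hi P b) = 0).
    { rewrite <- Hi; apply (RInt_Chasles (fun x => u b x * u b x)); apply ex_RInt_cont, Hc. }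
    lra. }
  intros x Hx; apply NNPP; intros Hn.
  assert (Hpos : 0 < u b x ^ 2) by (apply pow2_gt_0, Hn).
  destruct (proj1 (continuous_eps (fun x => u b x * u b x) x) (Hc x) (u b x ^ 2) Hpos) as [d [d0 Hd]].
  assert (L := lo_lt_hi P b).
  (* A subinterval near [x] on which the square stays positive; it extends to the left of [x] only
     when [x] is the right end point. *)
  assert (Hs : exists s t, s < t /\ inS P b s /\ inS P b t /\ forall y, s < y < t -> Rabs (y - x) < d).
  { destruct Hx as [Hx1 Hx2]; destruct (Rle_lt_dec (hi P b) x).
    - exists (Rmax (lo P b) (x - d / 2)), x; assert (x = hi P b) by lra.
      assert (Rmax (lo P b) (x - d / 2) < x) by (apply Rmax_lub_lt; lra).
      generalize (Rmax_l (lo P b) (x - d / 2)) (Rmax_r (lo P b) (x - d / 2)); intros.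
      repeat split; try lra; intros; apply Rabs_lt_between; lra.
    - exists x, (Rmin (hi P b) (x + d / 2)).
      assert (x < Rmin (hi P b) (x + d / 2)) by (apply Rmin_glb_lt; lra).
      generalize (Rmin_l (hi P b) (x + d / 2)) (Rmin_r (hi P b) (x + d / 2)); intros.
      repeat split; try lra; intros; apply Rabs_lt_between; lra. }
  destruct Hs as [s [t [Hst [Hs [Ht Hy]]]]].
  assert (0 < RInt (fun x => u b x * u b x) s t).
  { apply RInt_gt_0; [exact Hst| |intros; apply Hc].
    intros y Hy'; specialize (Hd y (Hy y Hy')); apply Rabs_lt_between in Hd; nra. }
  assert (RInt (fun x => u b x * u b x) (lo P b) s + RInt (fun x => u b x * u b x) s t =
    RInt (fun x => u b x * u b x) (lo P b) t).
  { apply (RInt_Chasles (fun x => u b x * u b x)); apply ex_RInt_cont, Hc. }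
  rewrite !Hint in H1 by assumption; lra.
Qed.

Lemma cauchy_schwarz (P : sl_problem) (u v : pw) : contp u -> contp v ->
  ip P u v ^ 2 <= ip P u u * ip P v v.
Proof.
  intros Hu Hv.
  assert (H : forall s t, 0 <= s ^ 2 * ip P u u + 2 * s * t * ip P u v + t ^ 2 * ip P v v).
  { intros s t; assert (Hl := contp_lin s t u v Hu Hv).
    generalize (ip_ge0 P _ Hl).
    rewrite ip_lin_l, !ip_lin_r, (ip_comm P v u) by assumption; intros; lra. }
  assert (Hvv := ip_ge0 P v Hv); assert (Huu := ip_ge0 P u Hu).
  set (A := ip P u u) in *; set (B := ip P u v) in *; set (C := ip P v v) in *.
  clearbody A B C.
  destruct (Rle_lt_or_eq_dec _ _ Hvv) as [h|h].
  - generalize (H C (- B)); intros.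
    assert (0 <= C * (A * C - B ^ 2)) by nra.
    assert (0 <= A * C - B ^ 2); [|lra].
    apply Rmult_le_reg_l with C; lra.
  - subst C; destruct (Req_dec B 0) as [->|Hn]; [lra|].
    (* If [C = 0] the quadratic form is affine in its second argument, and this choice gives it the
       value [A - (A + 1) < 0] when [B] is nonzero. *)
    generalize (H 1 (- (A + 1) / (2 * B))); intros.
    replace (2 * 1 * (- (A + 1) / (2 * B)) * B) with (- (A + 1)) in H0 by (field; lra).
    lra.
Qed.

(** * The Cauchy problem across the interface *)

Lemma cauchy_sol_lin (P : sl_problem) (c d : R) (u du g v dv h : pw) :
  cauchy_sol P u du g -> cauchy_sol P v dv h ->
  cauchy_sol P (lin c u d v) (lin c du d dv) (lin c g d h).
Proof.
  intros [Cu [Du [Lu1 Lu2]]] [Cv [Dv [Lv1 Lv2]]]; split; [|split].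
  - apply contp_lin; assumption.
  - intros b x Hx; destruct (Du b x Hx) as [U1 U2], (Dv b x Hx) as [V1 V2]; unfold lin; split.
    + apply (is_derive_plus (fun x => c * u b x) (fun x => d * v b x)).
      * apply (is_derive_scal (u b) x c), U1.
      * apply (is_derive_scal (v b) x d), V1.
    + eapply is_derive_eq.
      * apply (is_derive_plus (fun x => c * du b x) (fun x => d * dv b x)).
        -- apply (is_derive_scal (du b) x c), U2.
        -- apply (is_derive_scal (dv b) x d), V2.
      * change plus with Rplus; simpl; field; apply Rgt_not_eq, pc_pos.
  - unfold linked, lin; rewrite Lu1, Lu2, Lv1, Lv2; split; ring.
Qed.

Lemma cauchy_sol_ext (P : sl_problem) (u du g h : pw) :
  (forall b x, inS P b x -> g b x = h b x) -> cauchy_sol P u du g -> cauchy_sol P u du h.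
Proof.
  intros H [Cu [Du Lu]]; split; [exact Cu|split; [|exact Lu]].
  intros b x Hx; rewrite <- (H b x Hx); apply Du, Hx.
Qed.

Lemma sol_lin (P : sl_problem) (c d : R) (u du g v dv h : pw) :
  sol P u du g -> sol P v dv h -> sol P (lin c u d v) (lin c du d dv) (lin c g d h).
Proof.
  intros [Hu [Lu Ru]] [Hv [Lv Rv]]; split; [apply cauchy_sol_lin; assumption|].
  unfold left_bc, right_bc, lin in *; split.
  - transitivity (c * (ca P * u true (lo P true) + sa P * du true (lo P true)) +
      d * (ca P * v true (lo P true) + sa P * dv true (lo P true))); [ring|rewrite Lu, Lv; ring].
  - transitivity (c * (cb P * u false (hi P false) + sb P * du false (hi P false)) +
      d * (cb P * v false (hi P false) + sb P * dv false (hi P false))); [ring|rewrite Ru, Rv; ring].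
Qed.

Lemma sol_ext (P : sl_problem) (u du g h : pw) :
  (forall b x, inS P b x -> g b x = h b x) -> sol P u du g -> sol P u du h.
Proof. intros H [Hu Hb]; split; [apply (cauchy_sol_ext P u du g h H Hu)|exact Hb]. Qed.

Lemma qz_cont (P : sl_problem) (z : R) (b : bool) (x : R) :
  continuous (fun x => (qf P b x - z) / pc P b) x.
Proof. cont; apply qf_cont. Qed.

(** Writing [A] for the differential operator, the right-hand side [lin z u 1 w] encodes
    [(A - z) u = w], that is, [u'' = (q - z) u / p - w / p]. The energy estimates of the two
    intervals are chained through the transfer matrix. *)
Lemma cauchy_estimate (P : sl_problem) (z : R) : exists K, 0 < K /\
  forall u du w, contp w -> cauchy_sol P u du (lin z u 1 w) ->
  forall b x, inS P b x -> u b x ^ 2 + du b x ^ 2 <=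
    K * (u true (lo P true) ^ 2 + du true (lo P true) ^ 2 + ip P w w).
Proof.
  assert (HS : forall b, exists K, 1 <= K /\ forall u du w, contp w -> cauchy_sol P u du (lin z u 1 w) ->
    forall x, inS P b x -> u b x ^ 2 + du b x ^ 2 <=
      K * (u b (lo P b) ^ 2 + du b (lo P b) ^ 2 + ip P w w)).
  { intros b.
    destruct (energy_estimate (lo P b) (hi P b) (fun x => (qf P b x - z) / pc P b)
      (Rlt_le _ _ (lo_lt_hi P b)) (qz_cont P z b)) as [K [K1 HK]].
    assert (p0 := pc_pos P b); assert (w0 := wt_pos P b).
    (* The forcing is [- w / p]; one factor [p ^ 2] comes from its square, and the weight converts
       the plain integral into the inner product. *)
    set (c := / (wt P b * pc P b ^ 2)).
    assert (c0 : 0 < c) by (apply Rinv_0_lt_compat, Rmult_lt_0_compat; [exact w0|apply pow_lt, p0]).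
    exists (K * (1 + c)); split; [nra|].
    intros u du w Hw [Cu [Du Lu]] x Hx.
    eapply Rle_trans.
    - apply (HK (u b) (du b) (fun x => - w b x / pc P b)); [cont; apply Hw| | |exact Hx].
      + intros y Hy; apply Du, Hy.
      + intros y Hy; eapply is_derive_eq; [apply Du, Hy|unfold lin; field; lra].
    - assert (E : RInt (fun t => (- w b t / pc P b) ^ 2) (lo P b) (hi P b) =
        / pc P b ^ 2 * RInt (fun t => w b t * w b t) (lo P b) (hi P b)).
      { change (/ pc P b ^ 2 * RInt (fun t => w b t * w b t) (lo P b) (hi P b))
          with (scal (/ pc P b ^ 2) (RInt (fun t => w b t * w b t) (lo P b) (hi P b))).
        rewrite <- (RInt_scal (fun t => w b t * w b t)) by (apply ex_RInt_cont, contp_mult; exact Hw).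
        apply RInt_ext_R; intros t; change scal with Rmult; simpl; field; lra. }
      rewrite E.
      assert (E2 : / pc P b ^ 2 * RInt (fun t => w b t * w b t) (lo P b) (hi P b) <= c * ip P w w).
      { unfold c; eapply Rle_trans; [|apply Rmult_le_compat_l; [left; exact c0|apply (sheet_sq_le P w b Hw)]].
        right; unfold c; field; lra. }
      generalize (pow2_ge_0 (u b (lo P b))) (pow2_ge_0 (du b (lo P b))) (ip_ge0 P w Hw); intros.
      rewrite (Rmult_assoc K); apply Rmult_le_compat_l; [lra|nra]. }
  destruct (HS true) as [K1 [K1p H1]], (HS false) as [K2 [K2p H2]].
  (* Twice the squared Frobenius norm of the transfer matrix, a bound for the growth of squared
     Cauchy data across the interface. *)
  set (m := 2 * (m11 P ^ 2 + m12 P ^ 2 + m21 P ^ 2 + m22 P ^ 2)).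
  assert (m0 : 0 <= m) by (unfold m; generalize (pow2_ge_0 (m11 P)) (pow2_ge_0 (m12 P)) (pow2_ge_0 (m21 P)) (pow2_ge_0 (m22 P)); lra).
  exists (K1 + K2 * (m * K1 + 1)); split; [assert (0 <= m * K1) by nra; nra|].
  intros u du w Hw Hs b x Hx.
  assert (Hs' := Hs); destruct Hs' as [Cu [Du [L1 L2]]].
  set (E0 := u true (lo P true) ^ 2 + du true (lo P true) ^ 2 + ip P w w).
  assert (W0 := ip_ge0 P w Hw).
  assert (E0p : 0 <= E0 - ip P w w) by (unfold E0; generalize (pow2_ge_0 (u true (lo P true))) (pow2_ge_0 (du true (lo P true))); lra).
  assert (0 <= m * K1) by nra.
  destruct b.
  - eapply Rle_trans; [apply (H1 u du w Hw Hs x Hx)|]; fold E0.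
    apply Rmult_le_compat_r; [lra|nra].
  - eapply Rle_trans; [apply (H2 u du w Hw Hs x Hx)|].
    assert (Ht : inS P true (hi P true)) by (split; [left; apply lo_lt_hi|lra]).
    generalize (H1 u du w Hw Hs _ Ht); fold E0; intros HE.
    assert (Hm : u false (lo P false) ^ 2 + du false (lo P false) ^ 2 <=
      m * (u true (hi P true) ^ 2 + du true (hi P true) ^ 2)).
    { rewrite L1, L2; unfold m.
      set (X := u true (hi P true)); set (Y := du true (hi P true)).
      generalize (pow2_ge_0 (m11 P * Y - m12 P * X)) (pow2_ge_0 (m21 P * Y - m22 P * X))
        (pow2_ge_0 (m11 P * X)) (pow2_ge_0 (m12 P * Y)) (pow2_ge_0 (m21 P * X)) (pow2_ge_0 (m22 P * Y))
        (pow2_ge_0 (m11 P * Y)) (pow2_ge_0 (m12 P * X)) (pow2_ge_0 (m21 P * Y)) (pow2_ge_0 (m22 P * X))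
        (pow2_ge_0 (m11 P * X - m12 P * Y)) (pow2_ge_0 (m21 P * X - m22 P * Y)); intros; nra. }
    assert (m * (u true (hi P true) ^ 2 + du true (hi P true) ^ 2) <= m * (K1 * E0)) by (apply Rmult_le_compat_l; assumption).
    assert (u false (lo P false) ^ 2 + du false (lo P false) ^ 2 + ip P w w <= (m * K1 + 1) * E0) by nra.
    assert (K2 * (u false (lo P false) ^ 2 + du false (lo P false) ^ 2 + ip P w w) <= K2 * ((m * K1 + 1) * E0))
      by (apply Rmult_le_compat_l; lra).
    assert (0 <= K1 * E0) by (apply Rmult_le_pos; lra).
    lra.
Qed.

Lemma cauchy_existence (P : sl_problem) (z s t : R) (w : pw) : contp w ->
  exists u du, cauchy_sol P u du (lin z u 1 w) /\
    u true (lo P true) = s /\ du true (lo P true) = t.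
Proof.
  intros Hw.
  assert (HE : forall b s t, exists u du : R -> R, (forall x, continuous u x) /\
    (forall x, inS P b x -> is_derive u x (du x)) /\
    (forall x, inS P b x -> is_derive du x ((qf P b x * u x - (z * u x + 1 * w b x)) / pc P b)) /\
    u (lo P b) = s /\ du (lo P b) = t).
  { intros b s0 t0.
    destruct (linear_ode_existence (lo P b) (hi P b) (fun x => (qf P b x - z) / pc P b)
      (fun x => - w b x / pc P b) s0 t0) as [u [du [Cu [D1 [D2 D3]]]]].
    - left; apply lo_lt_hi.
    - apply qz_cont.
    - cont; apply Hw.
    - exists u, du; split; [exact Cu|split; [exact D1|split; [|exact D3]]].
      intros x Hx; eapply is_derive_eq; [apply D2, Hx|].
      field; apply Rgt_not_eq, pc_pos. }
  destruct (HE true s t) as [u1 [du1 [C1 [D1 [D1' [I1 I1']]]]]].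
  destruct (HE false (m11 P * u1 (hi P true) + m12 P * du1 (hi P true))
    (m21 P * u1 (hi P true) + m22 P * du1 (hi P true))) as [u2 [du2 [C2 [D2 [D2' [I2 I2']]]]]].
  exists (fun b : bool => if b then u1 else u2), (fun b : bool => if b then du1 else du2).
  split; [split; [|split]|split; assumption].
  - intros [|]; assumption.
  - intros [|] x Hx; split; auto.
  - split; assumption.
Qed.

(** The Wronskian [W] satisfies [p W' = g v - u h]. It vanishes at the two outer ends by the
    boundary conditions, and [kap * W] takes the same value on both sides of the interface, so the
    weighted boundary terms cancel. *)
Lemma lagrange (P : sl_problem) (u du g v dv h : pw) : contp g -> contp h ->
  sol P u du g -> sol P v dv h -> ip P g v = ip P u h.
Proof.
  intros Cg Ch [[Cu [Du [Lu1 Lu2]]] [LBu RBu]] [[Cv [Dv [Lv1 Lv2]]] [LBv RBv]].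
  set (W := fun b x => u b x * dv b x - du b x * v b x).
  assert (HW : forall b, W b (hi P b) - W b (lo P b) =
    / pc P b * (RInt (fun x => g b x * v b x) (lo P b) (hi P b) - RInt (fun x => u b x * h b x) (lo P b) (hi P b))).
  { intros b.
    assert (Hc : forall x, continuous (fun x => / pc P b * (g b x * v b x) + (- / pc P b) * (u b x * h b x)) x).
    { cont; first [apply Cg|apply Ch|apply Cu|apply Cv]. }
    assert (HI : is_RInt (fun x => / pc P b * (g b x * v b x) + (- / pc P b) * (u b x * h b x))
      (lo P b) (hi P b) (W b (hi P b) - W b (lo P b))).
    { apply (is_RInt_derive (W b) (fun x => / pc P b * (g b x * v b x) + (- / pc P b) * (u b x * h b x))).
      - generalize (lo_lt_hi P b); intros L x; rewrite Rmin_left, Rmax_right by lra; intros Hx.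
        destruct (Du b x Hx) as [U1 U2], (Dv b x Hx) as [V1 V2]; unfold W.
        eapply is_derive_eq.
        + apply (is_derive_minus (fun x => u b x * dv b x) (fun x => du b x * v b x));
          [apply (is_derive_mult (u b) (dv b))|apply (is_derive_mult (du b) (v b))];
          try eassumption; intros; apply Rmult_comm.
        + change (du b x * dv b x + u b x * ((qf P b x * v b x - h b x) / pc P b) -
            ((qf P b x * u b x - g b x) / pc P b * v b x + du b x * dv b x) =
            / pc P b * (g b x * v b x) + - / pc P b * (u b x * h b x)).
          field; apply Rgt_not_eq, pc_pos.
      - intros x _; apply Hc. }
    rewrite <- (is_RInt_unique _ _ _ _ HI).
    rewrite (RInt_lin (fun x => g b x * v b x) (fun x => u b x * h b x)) by (apply contp_mult; assumption).
    ring. }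
  (* Two vectors in the plane orthogonal to the same unit vector are parallel. *)
  assert (H0 : forall c s x y x' y', c ^ 2 + s ^ 2 = 1 -> c * x + s * y = 0 -> c * x' + s * y' = 0 ->
    x * y' - y * x' = 0).
  { intros c s x y x' y' H1 H2 H3.
    transitivity ((c ^ 2 + s ^ 2) * (x * y' - y * x')); [rewrite H1; ring|].
    transitivity ((c * x + s * y) * (c * y' - s * x') + (c * x' + s * y') * (s * x - c * y)); [ring|rewrite H2, H3; ring]. }
  assert (E1 : W true (lo P true) = 0) by (unfold W; apply (H0 (ca P) (sa P)); [apply csa|exact LBu|exact LBv]).
  assert (E2 : W false (hi P false) = 0) by (unfold W; apply (H0 (cb P) (sb P)); [apply csb|exact RBu|exact RBv]).
  assert (E3 : kap P false * W false (lo P false) = kap P true * W true (hi P true)).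
  { unfold W; rewrite Lu1, Lu2, Lv1, Lv2, <- (kap_det P); ring. }
  apply Rminus_diag_uniq; unfold ip, wt.
  transitivity (kap P true * (W true (hi P true) - W true (lo P true)) +
    kap P false * (W false (hi P false) - W false (lo P false))).
  - rewrite !HW; field; split; apply Rgt_not_eq, pc_pos.
  - rewrite E1, E2; lra.
Qed.

(** * Inverse operator and completeness *)

(** Nothing is known about [f] outside the segment, so at an end point the difference quotient is
    taken with increments pointing inwards. *)
Lemma derive_zero_on_segment (f : R -> R) (a b x l : R) : a < b -> a <= x <= b ->
  (forall y, a <= y <= b -> f y = 0) -> is_derive f x l -> l = 0.
Proof.
  intros Hab Hx Hf Hd.
  apply Rabs_eq_0, Rle_antisym; [|apply Rabs_pos].
  apply le_epsilon; intros eps He; rewrite Rplus_0_l.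
  apply is_derive_Reals in Hd.
  destruct (Hd eps He) as [[d d0] H]; simpl in H.
  assert (Hh : exists h, h <> 0 /\ Rabs h < d /\ a <= x + h <= b).
  { destruct (Rle_lt_dec b x).
    - exists (- Rmin (d / 2) (b - a)).
      assert (0 < Rmin (d / 2) (b - a)) by (apply Rmin_glb_lt; lra).
      generalize (Rmin_l (d / 2) (b - a)) (Rmin_r (d / 2) (b - a)); intros.
      split; [lra|split; [apply Rabs_lt_between; lra|lra]].
    - exists (Rmin (d / 2) (b - x)).
      assert (0 < Rmin (d / 2) (b - x)) by (apply Rmin_glb_lt; lra).
      generalize (Rmin_l (d / 2) (b - x)) (Rmin_r (d / 2) (b - x)); intros.
      split; [lra|split; [apply Rabs_lt_between; lra|lra]]. }
  destruct Hh as [h [h0 [h1 h2]]].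
  specialize (H h h0 h1); rewrite (Hf x Hx), (Hf _ h2) in H.
  left; replace ((0 - 0) / h - l) with (- l) in H by (field; exact h0).
  rewrite Rabs_Ropp in H; exact H.
Qed.

Lemma cauchy_sol_zero (P : sl_problem) (u du g : pw) : cauchy_sol P u du g ->
  (forall b x, inS P b x -> u b x = 0) ->
  (forall b x, inS P b x -> du b x = 0) /\ (forall b x, inS P b x -> g b x = 0).
Proof.
  intros [Cu [Du _]] Hu.
  assert (Hdu : forall b x, inS P b x -> du b x = 0).
  { intros b x Hx; apply (derive_zero_on_segment (u b) (lo P b) (hi P b) x);
    [apply lo_lt_hi|exact Hx|intros; apply Hu; assumption|apply Du, Hx]. }
  split; [exact Hdu|].
  intros b x Hx.
  assert (H : (qf P b x * u b x - g b x) / pc P b = 0).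
  { apply (derive_zero_on_segment (du b) (lo P b) (hi P b) x);
    [apply lo_lt_hi|exact Hx|intros; apply Hdu; assumption|apply Du, Hx]. }
  rewrite (Hu b x Hx) in H.
  assert (p0 := pc_pos P b).
  apply (Rmult_eq_compat_l (- pc P b)) in H.
  replace (g b x) with (- pc P b * ((qf P b x * 0 - g b x) / pc P b)) by (field; lra).
  rewrite H; ring.
Qed.

Lemma lo_in (P : sl_problem) (b : bool) : inS P b (lo P b).
Proof. split; [lra|left; apply lo_lt_hi]. Qed.

Lemma hi_in (P : sl_problem) (b : bool) : inS P b (hi P b).
Proof. split; [left; apply lo_lt_hi|lra]. Qed.

Lemma cauchy_unique (P : sl_problem) (z : R) (u du v dv w : pw) : contp w ->
  cauchy_sol P u du (lin z u 1 w) -> cauchy_sol P v dv (lin z v 1 w) ->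
  u true (lo P true) = v true (lo P true) -> du true (lo P true) = dv true (lo P true) ->
  forall b x, inS P b x -> u b x = v b x /\ du b x = dv b x.
Proof.
  intros Hw Hu Hv H1 H2 b x Hx.
  destruct (cauchy_estimate P z) as [K [K0 HK]].
  assert (H := HK (lin 1 u (-1) v) (lin 1 du (-1) dv) zero_pw contp_zero).
  assert (Hs : cauchy_sol P (lin 1 u (-1) v) (lin 1 du (-1) dv) (lin z (lin 1 u (-1) v) 1 zero_pw)).
  { eapply cauchy_sol_ext; [|apply cauchy_sol_lin; [exact Hu|exact Hv]].
    intros; unfold lin, zero_pw; ring. }
  specialize (H Hs b x Hx).
  rewrite (ip_zero_l P zero_pw contp_zero) in H; unfold lin in H; rewrite H1, H2 in H.
  match type of H with _ <= K * ?e => replace e with 0 in H by ring end.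
  rewrite Rmult_0_r in H.
  assert (A1 := pow2_ge_0 (1 * u b x + -1 * v b x)).
  assert (A2 := pow2_ge_0 (1 * du b x + -1 * dv b x)).
  split.
  - destruct (Req_dec (1 * u b x + -1 * v b x) 0) as [e|e]; [lra|apply pow2_gt_0 in e; lra].
  - destruct (Req_dec (1 * du b x + -1 * dv b x) 0) as [e|e]; [lra|apply pow2_gt_0 in e; lra].
Qed.

(** The zero function is included, which makes this a linear condition; nontriviality is demanded
    separately where an eigenvalue is meant. *)
Definition eigenfun (P : sl_problem) (z : R) (e de : pw) : Prop := sol P e de (lin z e 1 zero_pw).

Definition perp (P : sl_problem) (g : pw) : Prop :=
  forall z e de, eigenfun P z e de -> ip P g e = 0.

(** The initial vector [(sa, - ca)] spans the solutions of the left boundary condition. It has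
    length 1, which excludes the zero solution. *)
Lemma fundamental_exists (P : sl_problem) (z : R) :
  exists f df, cauchy_sol P f df (lin z f 1 zero_pw) /\
    f true (lo P true) = sa P /\ df true (lo P true) = - ca P /\ left_bc P f df = 0 /\
    0 < ip P f f.
Proof.
  destruct (cauchy_existence P z (sa P) (- ca P) zero_pw contp_zero) as [f [df [Hf [H1 H2]]]].
  exists f, df; split; [exact Hf|split; [exact H1|split; [exact H2|split]]].
  - unfold left_bc; rewrite H1, H2; ring.
  - destruct (Rle_lt_or_eq_dec _ _ (ip_ge0 P f (proj1 Hf))) as [h|h]; [exact h|exfalso].
    assert (F0 := ip_eq0 P f (proj1 Hf) (eq_sym h)).
    destruct (cauchy_sol_zero P f df _ Hf F0) as [D0 _].
    generalize (F0 true _ (lo_in P true)) (D0 true _ (lo_in P true)) (csa P).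
    rewrite H1, H2; intros E1 E2; rewrite E1; replace (ca P) with 0 by lra; lra.
Qed.

(** Cauchy data orthogonal to the unit vector [(ca, sa)] are a multiple of [(sa, - ca)], and [c] is
    their inner product with the latter. *)
Lemma subtract_fundamental (P : sl_problem) (u du : pw) : left_bc P u du = 0 ->
  let c := sa P * u true (lo P true) - ca P * du true (lo P true) in
  u true (lo P true) = c * sa P /\ du true (lo P true) = c * - ca P.
Proof.
  unfold left_bc; set (s := u true _); set (t := du true _); intros H; cbv zeta.
  generalize (csa P); intros H1; split.
  - transitivity ((ca P ^ 2 + sa P ^ 2) * s - ca P * (ca P * s + sa P * t)); [rewrite H1, H; ring|ring].
  - transitivity ((ca P ^ 2 + sa P ^ 2) * t - sa P * (ca P * s + sa P * t)); [rewrite H1, H; ring|ring].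
Qed.

(** Serves twice: at [z = 0] it is the sup bound on the inverse operator, at [z = / mu] it gives the
    lower bound on its shift by [mu]. The value [z] may itself be an eigenvalue, which is why
    orthogonality is assumed. *)
Lemma resolvent_estimate (P : sl_problem) (z : R) : exists K, 0 < K /\
  forall u du w, contp w -> sol P u du (lin z u 1 w) ->
    (forall e de, eigenfun P z e de -> ip P u e = 0) ->
    forall b x, inS P b x -> u b x ^ 2 <= K * ip P w w.
Proof.
  destruct (fundamental_exists P z) as [f [df [Hf [F1 [F2 [F3 F4]]]]]].
  destruct (cauchy_estimate P z) as [K [K0 HK]].
  assert (Hfb : forall b x, inS P b x -> f b x ^ 2 <= K).
  { intros b x Hx; generalize (HK f df zero_pw contp_zero Hf b x Hx) (pow2_ge_0 (df b x)).
    rewrite (ip_zero_l P zero_pw contp_zero), F1, F2; generalize (csa P); intros A1 A2.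
    replace (sa P ^ 2 + (- ca P) ^ 2 + 0) with (ca P ^ 2 + sa P ^ 2) in A2 by ring.
    rewrite A1 in A2; lra. }
  assert (Cf := proj1 Hf).
  assert (Hred : forall u du w, contp w -> sol P u du (lin z u 1 w) ->
    exists c v dv, cauchy_sol P v dv (lin z v 1 w) /\ v = lin 1 u (- c) f /\ dv = lin 1 du (- c) df /\
      forall b x, inS P b x -> v b x ^ 2 + dv b x ^ 2 <= K * ip P w w).
  { intros u du w Hw [Hu [Lu _]].
    set (c := sa P * u true (lo P true) - ca P * du true (lo P true)).
    exists c, (lin 1 u (- c) f), (lin 1 du (- c) df).
    assert (Hv : cauchy_sol P (lin 1 u (- c) f) (lin 1 du (- c) df) (lin z (lin 1 u (- c) f) 1 w)).
    { eapply cauchy_sol_ext; [|apply cauchy_sol_lin; [exact Hu|exact Hf]].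
      intros; unfold lin, zero_pw; ring. }
    split; [exact Hv|split; [reflexivity|split; [reflexivity|]]].
    intros b x Hx; generalize (HK _ _ w Hw Hv b x Hx).
    destruct (subtract_fundamental P u du Lu) as [E1 E2]; fold c in E1, E2.
    unfold lin at 3 4; rewrite E1, E2, F1, F2.
    replace (1 * (c * sa P) + - c * sa P) with 0 by ring.
    replace (1 * (c * - ca P) + - c * - ca P) with 0 by ring.
    replace (0 ^ 2 + 0 ^ 2 + ip P w w) with (ip P w w) by ring; trivial. }
  (* It remains to bound the coefficient c of f in u = v + c f: through the right boundary
     condition if f violates it, and through orthogonality to f otherwise. *)
  assert (Hc : exists B, 0 < B /\ forall u du w, contp w -> sol P u du (lin z u 1 w) ->
    (forall e de, eigenfun P z e de -> ip P u e = 0) ->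
    forall c v dv, cauchy_sol P v dv (lin z v 1 w) -> v = lin 1 u (- c) f -> dv = lin 1 du (- c) df ->
    (forall b x, inS P b x -> v b x ^ 2 + dv b x ^ 2 <= K * ip P w w) ->
    c ^ 2 <= B * ip P w w).
  { destruct (Req_dec (right_bc P f df) 0) as [Hr|Hr].
    (* Here [f] is an eigenfunction and [u] is orthogonal to it, so [<v, f> = - c |f|^2].
       Cauchy-Schwarz and [|v|^2 <= mass * K * |w|^2] give this constant. *)
    - exists (mass P * K / ip P f f); split.
      { apply Rdiv_lt_0_compat; [apply Rmult_lt_0_compat; [apply mass_pos|exact K0]|exact F4]. }
      intros u du w Hw Hu Ho c v dv Hv Ev Edv Hb.
      assert (Hvf : ip P v f = - c * ip P f f).
      { rewrite Ev, ip_lin_l by (apply Hu || exact Cf).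
        rewrite (Ho f df) by (split; [exact Hf|split; assumption]); ring. }
      assert (Hcs := cauchy_schwarz P v f (proj1 Hv) Cf); rewrite Hvf in Hcs.
      assert (Hvv : ip P v v <= mass P * (K * ip P w w)).
      { apply ip_le_sup; [apply Hv|]; intros b x Hx.
        generalize (Hb b x Hx) (pow2_ge_0 (dv b x)); lra. }
      apply Rmult_le_reg_l with (ip P f f); [exact F4|].
      apply Rmult_le_reg_l with (ip P f f); [exact F4|].
      replace (ip P f f * (ip P f f * (mass P * K / ip P f f * ip P w w)))
        with (ip P f f * (mass P * (K * ip P w w))) by (field; lra).
      assert (ip P f f * ip P v v <= ip P f f * (mass P * (K * ip P w w))) by (apply Rmult_le_compat_l; lra).
      lra.
    - assert (R2 : 0 < right_bc P f df ^ 2) by (apply pow2_gt_0, Hr).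
      exists (K / right_bc P f df ^ 2); split.
      { apply Rdiv_lt_0_compat; assumption. }
      intros u du w Hw Hu Ho c v dv Hv Ev Edv Hb.
      (* Since [u] satisfies the right boundary condition, the value of the form on [v] reads off
         [c]; its coefficients form a unit vector, so that value is bounded by the Cauchy data of
         [v]. *)
      assert (Hrv : right_bc P v dv = - c * right_bc P f df).
      { destruct Hu as [_ [_ Ru]]; rewrite Ev, Edv; unfold right_bc, lin in *.
        transitivity ((cb P * u false (hi P false) + sb P * du false (hi P false)) -
          c * (cb P * f false (hi P false) + sb P * df false (hi P false))); [ring|rewrite Ru; ring]. }
      assert (Hle : right_bc P v dv ^ 2 <= K * ip P w w).
      { generalize (Hb false _ (hi_in P false)); unfold right_bc.
        set (X := v false _); set (Y := dv false _).
        assert (E : (cb P * X + sb P * Y) ^ 2 + (cb P * Y - sb P * X) ^ 2 = (cb P ^ 2 + sb P ^ 2) * (X ^ 2 + Y ^ 2)) by ring.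
        rewrite csb in E; generalize (pow2_ge_0 (cb P * Y - sb P * X)); lra. }
      rewrite Hrv in Hle.
      apply Rmult_le_reg_l with (right_bc P f df ^ 2); [exact R2|].
      replace (right_bc P f df ^ 2 * (K / right_bc P f df ^ 2 * ip P w w)) with (K * ip P w w) by (field; exact Hr).
      lra. }
  destruct Hc as [B [B0 HB]].
  exists (2 * K + 2 * (B * K)); split.
  { assert (0 < B * K) by (apply Rmult_lt_0_compat; assumption); lra. }
  intros u du w Hw Hu Ho b x Hx.
  destruct (Hred u du w Hw Hu) as [c [v [dv [Hv [Ev [Edv Hb]]]]]].
  assert (Hc := HB u du w Hw Hu Ho c v dv Hv Ev Edv Hb).
  assert (Hux : u b x = v b x + c * f b x) by (rewrite Ev; unfold lin; ring).
  rewrite Hux; generalize (Hb b x Hx) (Hfb b x Hx) (pow2_ge_0 (dv b x)) (pow2_ge_0 (v b x - c * f b x)); intros A1 A2 A3 A4.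
  assert (c ^ 2 * f b x ^ 2 <= B * ip P w w * K).
  { apply Rmult_le_compat; try apply pow2_ge_0; assumption. }
  nra.
Qed.

(** * The inverse operator on the orthogonal complement of the eigenfunctions *)

Definition trivial_kernel (P : sl_problem) : Prop :=
  forall e de, eigenfun P 0 e de -> forall b x, inS P b x -> e b x = 0.

Lemma ip_null_r (P : sl_problem) (u e : pw) : contp u ->
  (forall b x, inS P b x -> e b x = 0) -> ip P u e = 0.
Proof.
  intros Hu He; rewrite ip_comm, (ip_ext P e zero_pw u u He) by reflexivity.
  apply ip_zero_l, Hu.
Qed.

(** Shooting: a solution with zero Cauchy data on the left is corrected by a multiple of the
    fundamental solution. Its right boundary form is nonzero, as it would otherwise be an
    eigenfunction for 0. *)
Lemma inverse_exists (P : sl_problem) (w : pw) : trivial_kernel P -> contp w ->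
  exists u du, sol P u du w.
Proof.
  intros Hk Hw.
  destruct (fundamental_exists P 0) as [f [df [Hf [F1 [F2 [F3 F4]]]]]].
  destruct (cauchy_existence P 0 0 0 w Hw) as [v [dv [Hv [V1 V2]]]].
  assert (Hr : right_bc P f df <> 0).
  { intros Hr.
    rewrite (ip_null_r P f f (proj1 Hf)) in F4; [lra|].
    apply (Hk f df); split; [exact Hf|split; assumption]. }
  set (c := - right_bc P v dv / right_bc P f df).
  exists (lin 1 v c f), (lin 1 dv c df); split; [|split].
  - eapply cauchy_sol_ext; [|apply cauchy_sol_lin; [exact Hv|exact Hf]].
    intros; unfold lin, zero_pw; ring.
  - unfold left_bc, lin; rewrite V1, V2, F1, F2; ring.
  - transitivity (right_bc P v dv + c * right_bc P f df); [unfold right_bc, lin; ring|].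
    unfold c; field; exact Hr.
Qed.

(** By symmetry [z <u, e> = <g, e> = 0]; for [z = 0] the kernel hypothesis takes over. *)
Lemma perp_inverse (P : sl_problem) (u du g : pw) : trivial_kernel P -> contp g ->
  sol P u du g -> perp P g -> perp P u.
Proof.
  intros Hk Hg Hu Hp z e de He.
  assert (Cu : contp u) by apply Hu; assert (Ce : contp e) by apply He.
  destruct (Req_dec z 0) as [->|Hz].
  - apply ip_null_r; [exact Cu|exact (Hk e de He)].
  - assert (H := lagrange P u du g e de _ Hg (contp_lin z 1 e zero_pw Ce contp_zero) Hu He).
    rewrite (Hp z e de He), ip_lin_r, (ip_comm P u zero_pw), ip_zero_l in H by (assumption || apply contp_zero).
    apply Rmult_eq_reg_l with z; [lra|exact Hz].
Qed.

Lemma perp_lin (P : sl_problem) (c d : R) (u v : pw) : contp u -> contp v ->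
  perp P u -> perp P v -> perp P (lin c u d v).
Proof.
  intros Cu Cv Hu Hv z e de He.
  rewrite ip_lin_l by (assumption || apply He).
  rewrite (Hu z e de He), (Hv z e de He); ring.
Qed.

Lemma ip_sq_lin (P : sl_problem) (c d : R) (u v : pw) : contp u -> contp v ->
  ip P (lin c u d v) (lin c u d v) = c ^ 2 * ip P u u + 2 * c * d * ip P u v + d ^ 2 * ip P v v.
Proof.
  intros Cu Cv; assert (Cl := contp_lin c d u v Cu Cv).
  rewrite ip_lin_l, !ip_lin_r, (ip_comm P v u) by assumption; ring.
Qed.

Lemma ip_sq_lin_le (P : sl_problem) (c d : R) (u v : pw) : contp u -> contp v ->
  ip P (lin c u d v) (lin c u d v) <= 2 * c ^ 2 * ip P u u + 2 * d ^ 2 * ip P v v.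
Proof.
  intros Cu Cv; generalize (ip_ge0 P _ (contp_lin c (- d) u v Cu Cv)).
  rewrite !ip_sq_lin by assumption; lra.
Qed.

(** With [u = T k] and [w = u - mu k], the equation for [u] becomes [(A - / mu) u = - w / mu]. The
    resolvent estimate bounds [u] by [w], and [k = (u - w) / mu] is then bounded as well. *)
Lemma inverse_shift_bounded_below (P : sl_problem) (mu : R) : trivial_kernel P -> mu <> 0 ->
  exists K, 0 < K /\ forall k u du, contp k -> perp P k -> sol P u du k ->
    ip P k k <= K * ip P (lin 1 u (- mu) k) (lin 1 u (- mu) k).
Proof.
  intros Hk Hmu.
  destruct (resolvent_estimate P (/ mu)) as [K [K0 HK]].
  assert (Hm : 0 < / mu ^ 2) by (apply Rinv_0_lt_compat, pow2_gt_0, Hmu).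
  assert (M0 := mass_pos P).
  assert (HM : 0 < mass P * K * / mu ^ 2) by (repeat apply Rmult_lt_0_compat; assumption).
  exists (2 * / mu ^ 2 * (mass P * K * / mu ^ 2 + 1)); split.
  { apply Rmult_lt_0_compat; lra. }
  intros k u du Ck Pk Hu.
  assert (Cu : contp u) by apply Hu.
  set (w := lin 1 u (- mu) k).
  assert (Cw : contp w) by (apply contp_lin; assumption).
  set (w' := lin (- / mu) w 0 w).
  assert (Cw' : contp w') by (apply contp_lin; assumption).
  assert (Hu' : sol P u du (lin (/ mu) u 1 w')).
  { eapply sol_ext; [|exact Hu]; intros; unfold w', w, lin; field; exact Hmu. }
  assert (Pu := perp_inverse P u du k Hk Ck Hu Pk).
  assert (Huu : ip P u u <= mass P * (K * (/ mu ^ 2 * ip P w w))).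
  { apply ip_le_sup; [exact Cu|]; intros b x Hx.
    eapply Rle_trans; [apply (HK u du w' Cw' Hu' (Pu _) b x Hx)|].
    right; unfold w'; rewrite ip_sq_lin by assumption; field; exact Hmu. }
  rewrite (ip_ext P k (lin (/ mu) u (- / mu) w) k (lin (/ mu) u (- / mu) w)).
  - eapply Rle_trans; [apply ip_sq_lin_le; assumption|].
    replace (2 * (/ mu) ^ 2 * ip P u u + 2 * (- / mu) ^ 2 * ip P w w)
      with (2 * / mu ^ 2 * (ip P u u + ip P w w)) by (field; exact Hmu).
    rewrite (Rmult_assoc (2 * / mu ^ 2)).
    apply Rmult_le_compat_l; [lra|]; lra.
  - intros; unfold w, lin; field; exact Hmu.
  - intros; unfold w, lin; field; exact Hmu.
Qed.

(* If the supremum r^2 of |T g|^2 / |g|^2 over the orthogonal complement of all eigenfunctions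
   (T the inverse operator) were positive, a maximizing sequence would make
   (T^2 - r^2) g = (T - r) (T + r) g arbitrarily small, but both factors are bounded below there. *)
Lemma perp_trivial (P : sl_problem) (g : pw) : trivial_kernel P -> contp g -> perp P g ->
  forall b x, inS P b x -> g b x = 0.
Proof.
  intros Hk Cg0 Pg0.
  destruct (resolvent_estimate P 0) as [K [K0 HK]].
  assert (HT : forall g u du, contp g -> perp P g -> sol P u du g -> ip P u u <= mass P * (K * ip P g g)).
  { intros h u du Ch Ph Hu; apply ip_le_sup; [apply Hu|]; intros b x Hx.
    apply (HK u du h Ch); [|apply (perp_inverse P u du h Hk Ch Hu Ph)|exact Hx].
    eapply sol_ext; [|exact Hu]; intros; unfold lin; ring. }
  (* Squared norms of [T g] over the unit ball of the complement, so the supremum [r2] is the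
     squared norm of [T] there. *)
  set (E := fun s => exists g u du, contp g /\ perp P g /\ sol P u du g /\ ip P g g <= 1 /\ s = ip P u u).
  assert (M0 := mass_pos P).
  assert (HM : 0 < mass P * K) by (apply Rmult_lt_0_compat; assumption).
  destruct (completeness E) as [r2 [Hub Hlub]].
  - exists (mass P * K); intros s [h [u [du [Ch [Ph [Hu [H1 ->]]]]]]].
    generalize (HT h u du Ch Ph Hu); intros.
    assert (mass P * K * ip P h h <= mass P * K * 1) by (apply Rmult_le_compat_l; lra); lra.
  - destruct (inverse_exists P zero_pw Hk contp_zero) as [u [du Hu]].
    exists (ip P u u), zero_pw, u, du; split; [apply contp_zero|split; [|split; [exact Hu|split; [|reflexivity]]]].
    + intros z e de He; apply ip_zero_l, He.
    + rewrite ip_zero_l by apply contp_zero; lra.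
  - assert (Hscale : forall g u du, contp g -> perp P g -> sol P u du g -> ip P u u <= r2 * ip P g g).
    { intros h u du Ch Ph Hu.
      assert (Cu : contp u) by apply Hu.
      destruct (Rle_lt_or_eq_dec _ _ (ip_ge0 P h Ch)) as [N0|N0].
      - set (t := / sqrt (ip P h h)).
        assert (Ht : t ^ 2 * ip P h h = 1).
        { unfold t; rewrite <- (sqrt_sqrt (ip P h h)) at 2 by lra.
          field; apply Rgt_not_eq, sqrt_lt_R0, N0. }
        assert (Hin : E (ip P (lin t u 0 u) (lin t u 0 u))).
        { exists (lin t h 0 h), (lin t u 0 u), (lin t du 0 du).
          split; [apply contp_lin; assumption|split; [apply perp_lin; assumption|split; [apply sol_lin; assumption|split; [|reflexivity]]]].
          rewrite ip_sq_lin by assumption; lra. }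
        apply Hub in Hin; rewrite ip_sq_lin in Hin by assumption.
        assert (t2 : ip P h h * (t ^ 2 * ip P u u) <= ip P h h * r2) by (apply Rmult_le_compat_l; lra).
        replace (ip P h h * (t ^ 2 * ip P u u)) with (t ^ 2 * ip P h h * ip P u u) in t2 by ring.
        rewrite Ht in t2; lra.
      - generalize (HT h u du Ch Ph Hu); rewrite <- N0; lra. }
    assert (r0 : r2 <= 0).
    { destruct (Rle_lt_dec r2 0) as [h|r0]; [exact h|exfalso].
      set (r := sqrt r2).
      assert (rp : 0 < r) by (apply sqrt_lt_R0, r0).
      assert (rr : r ^ 2 = r2) by (unfold r; simpl; rewrite Rmult_1_r; apply sqrt_sqrt; lra).
      destruct (inverse_shift_bounded_below P r Hk) as [K1 [K1p HK1]]; [lra|].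
      destruct (inverse_shift_bounded_below P (- r) Hk) as [K2 [K2p HK2]]; [lra|].
      assert (KK : 0 < K1 * K2 * r2) by (repeat apply Rmult_lt_0_compat; assumption).
      assert (Hgain : forall g u du, contp g -> perp P g -> sol P u du g ->
        ip P g g <= K1 * K2 * r2 * (r2 * ip P g g - ip P u u)).
      { intros h u du Ch Ph Hu.
        assert (Cu : contp u) by apply Hu.
        assert (Pu := perp_inverse P u du h Hk Ch Hu Ph).
        destruct (inverse_exists P u Hk Cu) as [v [dv Hv]].
        assert (Cv : contp v) by apply Hv.
        assert (S1 := HK2 h u du Ch Ph Hu).
        set (k := lin 1 u (- - r) h) in *.
        assert (Ck : contp k) by (apply contp_lin; assumption).
        assert (Pk : perp P k) by (apply perp_lin; assumption).
        assert (S2 := HK1 k _ _ Ck Pk (sol_lin P 1 (- - r) v dv u u du h Hv Hu)).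
        set (w := lin 1 (lin 1 v (- - r) u) (- r) k) in *.
        (* The terms linear in [r] cancel and [w = T (T h) - r2 h]. Symmetry turns the mixed product
           [<T u, h>] into [<u, u>]. *)
        assert (Hw : ip P w w = ip P v v - 2 * r2 * ip P u u + r2 ^ 2 * ip P h h).
        { rewrite (ip_ext P w (lin 1 v (- r2) h) w (lin 1 v (- r2) h)).
          - rewrite ip_sq_lin, (ip_comm P v h), (lagrange P u du h v dv u) by assumption; ring.
          - intros; unfold w, k, lin; rewrite <- rr; ring.
          - intros; unfold w, k, lin; rewrite <- rr; ring. }
        assert (Hvv := Hscale u v dv Cu Pu Hv).
        assert (ip P w w <= r2 * (r2 * ip P h h - ip P u u)) by (rewrite Hw; nra).
        assert (K1 * ip P w w <= K1 * (r2 * (r2 * ip P h h - ip P u u))) by (apply Rmult_le_compat_l; lra).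
        assert (K2 * ip P k k <= K2 * (K1 * (r2 * (r2 * ip P h h - ip P u u)))) by (apply Rmult_le_compat_l; lra).
        lra. }
      (* The gain says [|u|^2 <= (r2 - / (K1 K2 r2)) |h|^2], an upper bound below the least one. If
         the bracket is negative it cannot be multiplied by [|h|^2 <= 1], and 0 serves as the upper
         bound instead. *)
      assert (Hnew : r2 <= r2 - / (K1 * K2 * r2) \/ r2 <= 0).
      { destruct (Rle_lt_dec 0 (r2 - / (K1 * K2 * r2))) as [h|h].
        - left; apply Hlub; intros s [h' [u [du [Ch [Ph [Hu [H1 ->]]]]]]].
          assert (G := Hgain h' u du Ch Ph Hu).
          apply (Rmult_le_compat_l (/ (K1 * K2 * r2))) in G; [|left; apply Rinv_0_lt_compat, KK].
          rewrite <- Rmult_assoc, Rinv_l, Rmult_1_l in G by lra.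
          assert ((r2 - / (K1 * K2 * r2)) * ip P h' h' <= (r2 - / (K1 * K2 * r2)) * 1) by (apply Rmult_le_compat_l; lra).
          lra.
        - right; apply Hlub; intros s [h' [u [du [Ch [Ph [Hu [H1 ->]]]]]]].
          assert (G := Hgain h' u du Ch Ph Hu).
          apply (Rmult_le_compat_l (/ (K1 * K2 * r2))) in G; [|left; apply Rinv_0_lt_compat, KK].
          rewrite <- Rmult_assoc, Rinv_l, Rmult_1_l in G by lra.
          generalize (ip_ge0 P h' Ch); nra. }
      assert (0 < / (K1 * K2 * r2)) by (apply Rinv_0_lt_compat, KK); lra. }
    destruct (inverse_exists P g Hk Cg0) as [u [du Hu]].
    assert (Cu : contp u) by apply Hu.
    assert (Huu := Hscale g u du Cg0 Pg0 Hu).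
    assert (G0 := ip_ge0 P g Cg0).
    assert (U0 : ip P u u = 0) by (apply Rle_antisym; [nra|apply ip_ge0, Cu]).
    apply (proj2 (cauchy_sol_zero P u du g (proj1 Hu) (ip_eq0 P u Cu U0))).
Qed.

(** * Eigenfunction expansion *)

(** A real-valued copy of [sum_n], whose recursion can be stated with the real [+] so that rewriting
    and [ring] apply. *)
Definition rsum (u : nat -> R) (n : nat) : R := sum_n u n.

Lemma rsum_O (u : nat -> R) : rsum u 0 = u 0%nat.
Proof. exact (sum_O u). Qed.

Lemma rsum_S (u : nat -> R) (n : nat) : rsum u (S n) = rsum u n + u (S n).
Proof. exact (sum_Sn u n). Qed.

Lemma rsum_ext (u v : nat -> R) (n : nat) : (forall k, u k = v k) -> rsum u n = rsum v n.
Proof. intros H; apply sum_n_ext, H. Qed.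

Lemma rsum_le (u v : nat -> R) (n : nat) :
  (forall k, u k <= v k) -> rsum u n <= rsum v n.
Proof.
  intros H; induction n; [rewrite !rsum_O; apply H|].
  rewrite !rsum_S; apply Rplus_le_compat; [exact IHn|apply H].
Qed.

Lemma rsum_lin (u v : nat -> R) (c d : R) (n : nat) :
  rsum (fun k => c * u k + d * v k) n = c * rsum u n + d * rsum v n.
Proof.
  induction n; [rewrite !rsum_O; ring|]; rewrite !rsum_S, IHn; ring.
Qed.

Lemma ex_series_bounded (u : nat -> R) (M : R) :
  (forall k, 0 <= u k) -> (forall n, rsum u n <= M) -> ex_series u.
Proof.
  intros H0 HM.
  destruct (ex_finite_lim_seq_incr (rsum u) M) as [l Hl].
  - intros n; rewrite rsum_S; generalize (H0 (S n)); lra.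
  - exact HM.
  - exists l; exact Hl.
Qed.

Lemma rsum_cauchy (u : nat -> R) (M eps : R) : 0 < eps ->
  (forall k, 0 <= u k) -> (forall n, rsum u n <= M) ->
  exists N, forall m n, (N <= m)%nat -> (m <= n)%nat -> rsum u n - rsum u m <= eps.
Proof.
  intros He H0 HM.
  destruct (ex_series_bounded u M H0 HM) as [l Hl].
  assert (e2 : 0 < eps / 2) by lra.
  destruct (proj1 (filterlim_locally (rsum u) l) Hl (mkposreal _ e2)) as [N HN].
  exists N; intros m n Hm Hn.
  generalize (HN m Hm) (HN n (Nat.le_trans _ _ _ Hm Hn)); intros A1 A2.
  change (Rabs (rsum u m - l) < eps / 2) in A1; change (Rabs (rsum u n - l) < eps / 2) in A2.
  apply Rabs_lt_between in A1; apply Rabs_lt_between in A2; lra.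
Qed.

(** Built from [lin] so that continuity, bilinearity and the equation pass to finite combinations by
    induction. *)
Fixpoint comb (c : nat -> R) (v : nat -> pw) (n : nat) : pw :=
  match n with
  | O => lin (c O) (v O) 0 (v O)
  | S n => lin 1 (comb c v n) (c (S n)) (v (S n))
  end.

Lemma comb_sum (c : nat -> R) (v : nat -> pw) (n : nat) (b : bool) (x : R) :
  comb c v n b x = rsum (fun k => c k * v k b x) n.
Proof.
  induction n; [rewrite rsum_O; simpl; unfold lin; ring|].
  rewrite rsum_S, <- IHn; simpl; unfold lin; ring.
Qed.

Lemma contp_comb (c : nat -> R) (v : nat -> pw) (n : nat) :
  (forall k, contp (v k)) -> contp (comb c v n).
Proof. intros H; induction n; apply contp_lin; auto. Qed.

Lemma ip_comb_l (P : sl_problem) (c : nat -> R) (v : nat -> pw) (w : pw) (n : nat) :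
  (forall k, contp (v k)) -> contp w ->
  ip P (comb c v n) w = rsum (fun k => c k * ip P (v k) w) n.
Proof.
  intros H Hw; induction n.
  - simpl; rewrite rsum_O, ip_lin_l by auto; ring.
  - rewrite rsum_S, <- IHn; simpl; rewrite ip_lin_l by (auto; apply contp_comb; exact H); ring.
Qed.

Lemma sol_comb (P : sl_problem) (c l : nat -> R) (v dv : nat -> pw) (n : nat) :
  (forall k, eigenfun P (l k) (v k) (dv k)) ->
  sol P (comb c v n) (comb c dv n) (comb (fun k => c k * l k) v n).
Proof.
  intros H; induction n.
  - eapply sol_ext; [|apply sol_lin; apply H].
    intros; simpl; unfold lin, zero_pw; ring.
  - eapply sol_ext; [|apply sol_lin; [exact IHn|apply (H (S n))]].
    intros; simpl; unfold lin, zero_pw; ring.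
Qed.

Section Orthogonal.

Variables (P : sl_problem) (v dv : nat -> pw) (l : nat -> R).
Hypothesis eig : forall n, eigenfun P (l n) (v n) (dv n).
Hypothesis norm_pos : forall n, 0 < ip P (v n) (v n).
Hypothesis l_inj : forall m n, l m = l n -> m = n.
Hypothesis kernel : trivial_kernel P.

Lemma contp_eig (n : nat) : contp (v n).
Proof. apply eig. Qed.

Hint Resolve contp_eig : core.

Lemma eig_neq0 (n : nat) : l n <> 0.
Proof.
  intros H; assert (E := eig n); rewrite H in E.
  generalize (norm_pos n); rewrite (ip_null_r P (v n) (v n)); auto; [lra|].
  apply (kernel _ _ E).
Qed.

Lemma ip_eigenfun (u du g : pw) (n : nat) : contp g -> sol P u du g ->
  ip P g (v n) = l n * ip P u (v n).
Proof.
  intros Cg Hu.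
  rewrite (lagrange P u du g (v n) (dv n) _ Cg (contp_lin (l n) 1 (v n) zero_pw (contp_eig n) contp_zero) Hu (eig n)).
  rewrite ip_lin_r, (ip_comm P u zero_pw), ip_zero_l by (apply Hu || auto using contp_zero); ring.
Qed.

Lemma orthogonal (m n : nat) : m <> n -> ip P (v m) (v n) = 0.
Proof.
  intros Hmn.
  assert (H := ip_eigenfun (v m) (dv m) _ n (contp_lin (l m) 1 (v m) zero_pw (contp_eig m) contp_zero) (eig m)).
  rewrite ip_lin_l, (ip_zero_l P (v n)) in H by auto using contp_zero.
  assert (l m - l n <> 0) by (intros E; apply Hmn, l_inj; lra).
  apply Rmult_eq_reg_l with (l m - l n); [lra|assumption].
Qed.

Lemma ip_comb_eig (c : nat -> R) (m n : nat) :
  ip P (comb c v n) (v m) = if Nat.leb m n then c m * ip P (v m) (v m) else 0.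
Proof.
  rewrite ip_comb_l by auto.
  assert (Hz : forall n, (n < m)%nat -> rsum (fun k => c k * ip P (v k) (v m)) n = 0).
  { induction n0; intros Hn.
    - rewrite rsum_O, orthogonal by lia; ring.
    - rewrite rsum_S, IHn0, orthogonal by lia; ring. }
  destruct (Nat.leb_spec m n); [|apply Hz; assumption].
  induction H.
  - destruct m; [rewrite rsum_O; reflexivity|].
    rewrite rsum_S, Hz by lia; ring.
  - rewrite rsum_S, IHle, (orthogonal (S m0) m) by lia; ring.
Qed.

Lemma ip_comb_sq (c : nat -> R) (n : nat) :
  ip P (comb c v n) (comb c v n) = rsum (fun k => c k ^ 2 * ip P (v k) (v k)) n.
Proof.
  assert (Cc : forall n, contp (comb c v n)) by (intros; apply contp_comb; auto).
  induction n.
  - simpl; rewrite rsum_O, ip_sq_lin by auto; ring.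
  - rewrite rsum_S, <- IHn; simpl; rewrite ip_sq_lin by auto.
    rewrite ip_comb_eig; destruct (Nat.leb_spec (S n) n); [lia|ring].
Qed.

(** Dividing by the squared norm makes [coef g n * v n] independent of the scaling of [v n] and
    keeps square roots out of the real problem. *)
Definition coef (g : pw) (n : nat) : R := ip P g (v n) / ip P (v n) (v n).

Lemma coef_norm (g : pw) (n : nat) : coef g n * ip P (v n) (v n) = ip P g (v n).
Proof. unfold coef; field; generalize (norm_pos n); lra. Qed.

Lemma bessel (g : pw) (n : nat) : contp g ->
  rsum (fun k => coef g k ^ 2 * ip P (v k) (v k)) n <= ip P g g.
Proof.
  intros Cg.
  assert (Cc : contp (comb (coef g) v n)) by (apply contp_comb; auto).
  generalize (ip_ge0 P _ (contp_lin 1 (-1) g _ Cg Cc)).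
  rewrite ip_sq_lin, ip_comb_sq, (ip_comm P g (comb _ _ _)), ip_comb_l by auto.
  assert (E : rsum (fun k => coef g k * ip P (v k) g) n = rsum (fun k => coef g k ^ 2 * ip P (v k) (v k)) n).
  { apply rsum_ext; intros k; rewrite (ip_comm P (v k) g), <- coef_norm; ring. }
  rewrite E; lra.
Qed.

(** The combination with coefficients [c] is the inverse applied to the one with coefficients
    [c * l], whose squared norm is the sum on the right. At [z = 0] the orthogonality required by
    the resolvent estimate holds because the kernel is trivial. *)
Lemma comb_sup : exists K, 0 < K /\ forall c n b x, inS P b x ->
  comb c v n b x ^ 2 <= K * rsum (fun k => (c k * l k) ^ 2 * ip P (v k) (v k)) n.
Proof.
  destruct (resolvent_estimate P 0) as [K [K0 HK]].
  exists K; split; [exact K0|]; intros c n b x Hx.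
  rewrite <- (ip_comb_sq (fun k => c k * l k)).
  apply (HK _ (comb c dv n)); [apply contp_comb; auto| | |exact Hx].
  - eapply sol_ext; [|apply (sol_comb P c l v dv n eig)]; intros; unfold lin; ring.
  - intros e de He; apply ip_null_r; [apply contp_comb; auto|apply (kernel e de He)].
Qed.

(* For fixed [x] and [b], the coefficients [v k b x / (l k ^ 2 * ip P (v k) (v k))] turn [comb_sup]
   into [E ^ 2 <= K * E] for the sum [E] at [x]. *)
Lemma eigenfun_sq_sum : exists K, 0 < K /\ forall n b x, inS P b x ->
  rsum (fun k => v k b x ^ 2 / (l k ^ 2 * ip P (v k) (v k))) n <= K.
Proof.
  destruct comb_sup as [K [K0 HK]].
  exists K; split; [exact K0|]; intros n b x Hx.
  set (E := rsum (fun k => v k b x ^ 2 / (l k ^ 2 * ip P (v k) (v k))) n).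
  assert (H := HK (fun k => v k b x / (l k ^ 2 * ip P (v k) (v k))) n b x Hx).
  rewrite comb_sum in H.
  assert (E1 : rsum (fun k => v k b x / (l k ^ 2 * ip P (v k) (v k)) * v k b x) n = E).
  { apply rsum_ext; intros k; field; split; [generalize (norm_pos k); lra|apply eig_neq0]. }
  assert (E2 : rsum (fun k => (v k b x / (l k ^ 2 * ip P (v k) (v k)) * l k) ^ 2 * ip P (v k) (v k)) n = E).
  { apply rsum_ext; intros k; field; split; [generalize (norm_pos k); lra|apply eig_neq0]. }
  rewrite E1, E2 in H.
  destruct (Rle_lt_dec E K); [assumption|nra].
Qed.

Variables (f df g : pw).
Hypothesis g_cont : contp g.
Hypothesis f_sol : sol P f df g.

Lemma coef_inverse (k : nat) : coef f k * l k = coef g k.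
Proof. unfold coef; rewrite (ip_eigenfun f df g k g_cont f_sol); unfold Rdiv; ring. Qed.

(** The inequality [2 |x y| <= x^2 + y^2] splits each term into one summed by Bessel's inequality
    for [g] and one summed by [eigenfun_sq_sum]. *)
Lemma expansion_abs (b : bool) (x : R) : inS P b x ->
  ex_series (fun k => Rabs (coef f k * v k b x)).
Proof.
  intros Hx; destruct eigenfun_sq_sum as [K [K0 HK]].
  apply (ex_series_bounded _ (/ 2 * ip P g g + / 2 * K)); [intros; apply Rabs_pos|]; intros n.
  apply Rle_trans with (rsum (fun k => / 2 * (coef g k ^ 2 * ip P (v k) (v k)) +
    / 2 * (v k b x ^ 2 / (l k ^ 2 * ip P (v k) (v k)))) n).
  - apply rsum_le; intros k.
    assert (N0 := norm_pos k); assert (L0 := eig_neq0 k).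
    set (N := ip P (v k) (v k)) in *.
    (* Both signs [s = 1] and [s = -1] are used, to bound the absolute value. *)
    assert (H : forall s, s * s = 1 -> s * (coef f k * v k b x) <=
      / 2 * (coef g k ^ 2 * N) + / 2 * (v k b x ^ 2 / (l k ^ 2 * N))).
    { intros s Hs; rewrite <- coef_inverse.
      assert (0 <= (coef f k * l k * N - s * v k b x / l k) ^ 2 / (2 * N)).
      { apply Rmult_le_pos; [apply pow2_ge_0|left; apply Rinv_0_lt_compat; lra]. }
      replace ((coef f k * l k * N - s * v k b x / l k) ^ 2 / (2 * N)) with
        (/ 2 * ((coef f k * l k) ^ 2 * N) + / 2 * ((s * s) * v k b x ^ 2 / (l k ^ 2 * N)) - s * (coef f k * v k b x)) in H
        by (field; split; [exact L0|lra]).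
      rewrite Hs, Rmult_1_l in H; lra. }
    generalize (H 1) (H (-1)); intros A1 A2; apply Rabs_le; lra.
  - rewrite rsum_lin; generalize (bessel g n g_cont) (HK n b x Hx); lra.
Qed.

(** The sup bound for a block of terms is a block of the Bessel series of [g], which is the same at
    every point. *)
Lemma comb_cauchy (eps : R) : 0 < eps -> exists N, forall m n b x, inS P b x ->
  (N <= m)%nat -> (m <= n)%nat -> Rabs (comb (coef f) v n b x - comb (coef f) v m b x) <= eps.
Proof.
  intros He; destruct comb_sup as [K [K0 HK]].
  set (D := fun k => coef g k ^ 2 * ip P (v k) (v k)).
  assert (D0 : forall k, 0 <= D k) by (intros k; apply Rmult_le_pos; [apply pow2_ge_0|left; apply norm_pos]).
  destruct (rsum_cauchy D (ip P g g) (eps ^ 2 / K)) as [N HN].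
  - apply Rdiv_lt_0_compat; [apply pow_lt, He|exact K0].
  - exact D0.
  - intros n; exact (bessel g n g_cont).
  - exists N; intros m n b x Hx Hm Hn.
    set (c := fun k => if Nat.leb k m then 0 else coef f k).
    (* Stated for any [h] vanishing at 0, because the cut-off coefficients enter both linearly in
       the values and quadratically in the norms. *)
    assert (E1 : forall h : nat -> R -> R, (forall k, h k 0 = 0) -> rsum (fun k => h k (c k)) n =
      rsum (fun k => h k (coef f k)) n - rsum (fun k => h k (coef f k)) m).
    { intros h h0; clear -Hn h0; induction Hn.
      - rewrite Rminus_diag; unfold c.
        assert (forall i, (i <= m)%nat -> rsum (fun k => h k (if Nat.leb k m then 0 else coef f k)) i = 0).
        { induction i; intros Hi; [rewrite rsum_O; simpl; apply h0|].
          rewrite rsum_S, IHi by lia; destruct (Nat.leb_spec (S i) m); [rewrite h0; ring|lia]. }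
        apply H; lia.
      - rewrite !rsum_S, IHHn; unfold c; destruct (Nat.leb_spec (S m0) m); [lia|ring]. }
    assert (E2 : comb c v n b x = comb (coef f) v n b x - comb (coef f) v m b x).
    { rewrite !comb_sum; apply (E1 (fun k t => t * v k b x)); intros; ring. }
    rewrite <- E2.
    assert (E3 : rsum (fun k => (c k * l k) ^ 2 * ip P (v k) (v k)) n = rsum D n - rsum D m).
    { rewrite (E1 (fun k t => (t * l k) ^ 2 * ip P (v k) (v k))) by (intros; ring).
      f_equal; apply rsum_ext; intros k; unfold D; rewrite coef_inverse; reflexivity. }
    generalize (HK c n b x Hx); rewrite E3; intros H1.
    assert (H2 : K * (rsum D n - rsum D m) <= K * (eps ^ 2 / K)) by (apply Rmult_le_compat_l; [lra|apply HN; assumption]).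
    replace (K * (eps ^ 2 / K)) with (eps ^ 2) in H2 by (field; lra).
    rewrite <- (Rabs_right eps) by lra; apply Rsqr_le_abs_0; unfold Rsqr; nra.
Qed.

(** Each eigenfunction is a multiple of a single [v n]; the zero function is covered by [c = 0]. *)
Hypothesis complete : forall z e de, eigenfun P z e de ->
  exists n c, forall b x, inS P b x -> e b x = c * v n b x.

Lemma expansion_unif (eps : R) : 0 < eps -> exists N, forall n b x, (N <= n)%nat -> inS P b x ->
  Rabs (comb (coef f) v n b x - f b x) <= eps.
Proof.
  (* Clamping extends the sum of the series, and hence the remainder [rho], to a continuous function
     on the line as [contp] demands. *)
  set (cl := fun b x => clamp (lo P b) (hi P b) x).
  assert (Hcl : forall b x, inS P b (cl b x)) by (intros b x; apply clamp_in; left; apply lo_lt_hi).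
  assert (Hcl' : forall b x, inS P b x -> cl b x = x) by (intros b x Hx; apply clamp_id, Hx).
  set (s := fun b x => Series (fun k => coef f k * v k b (cl b x))).
  assert (Hs : forall eps, 0 < eps -> exists N, forall n b x, (N <= n)%nat ->
    Rabs (comb (coef f) v n b (cl b x) - s b x) <= eps).
  { intros d d0; destruct (comb_cauchy (d / 2)) as [N HN]; [lra|].
    exists N; intros n b x Hn.
    assert (Hex : ex_series (fun k => coef f k * v k b (cl b x))) by apply ex_series_Rabs, expansion_abs, Hcl.
    apply Series_correct in Hex.
    assert (d2 : 0 < d / 2) by lra.
    destruct (proj1 (filterlim_locally _ _) Hex (mkposreal _ d2)) as [M HM].
    specialize (HM (n + M)%nat (Nat.le_add_l _ _)).
    change (Rabs (rsum (fun k => coef f k * v k b (cl b x)) (n + M) - s b x) < d / 2) in HM.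
    rewrite <- comb_sum in HM.
    specialize (HN n (n + M)%nat b _ (Hcl b x) Hn (Nat.le_add_r _ _)).
    apply Rabs_le_between in HN; apply Rabs_lt_between in HM; apply Rabs_le; lra. }
  set (rho := fun b x => f b (cl b x) - s b x).
  assert (Cf : contp f) by apply f_sol.
  assert (Cc : forall n, contp (comb (coef f) v n)) by (intros; apply contp_comb; auto).
  assert (Hrho : contp rho).
  { intros b; apply (continuous_uniform_limit (fun n x => f b (cl b x) - comb (coef f) v n b (cl b x))).
    - intros n x; apply cont_minus; [apply (cont_comp (cl b) (f b))|apply (cont_comp (cl b) (comb (coef f) v n b))];
      try apply continuous_clamp; [apply Cf|apply Cc].
    - intros d d0; destruct (Hs d d0) as [N HN]; exists N; intros x.
      unfold rho; specialize (HN N b x (Nat.le_refl _)).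
      rewrite Rabs_minus_sym in HN.
      replace (f b (cl b x) - comb (coef f) v N b (cl b x) - (f b (cl b x) - s b x))
        with (s b x - comb (coef f) v N b (cl b x)) by ring; exact HN. }
  assert (Hperp : forall m, ip P rho (v m) = 0).
  { intros m.
    destruct (Req_dec (ip P rho (v m)) 0) as [h|h]; [exact h|exfalso].
    assert (Q0 : 0 < ip P rho (v m) ^ 2) by (apply pow2_gt_0, h).
    assert (M0 := mass_pos P); assert (N0 := norm_pos m).
    set (C := mass P * ip P (v m) (v m)).
    assert (C0 : 0 < C) by (apply Rmult_lt_0_compat; assumption).
    (* Once [n >= m], the remainder [r] of the partial sum is exactly orthogonal to [v m] and
       uniformly [d]-close to [rho], so [<rho, v m>^2 <= C d^2]. The cap at 1 gives [d^2 <= d],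
       which pushes this below half of itself. *)
    set (d := Rmin 1 (ip P rho (v m) ^ 2 / (2 * C))).
    assert (q0 : 0 < ip P rho (v m) ^ 2 / (2 * C)) by (apply Rdiv_lt_0_compat; lra).
    assert (d0 : 0 < d) by (apply Rmin_glb_lt; lra).
    destruct (Hs d d0) as [N HN].
    set (n := (N + m)%nat).
    set (r := lin 1 f (-1) (comb (coef f) v n)).
    assert (Cr : contp r) by (apply contp_lin; auto).
    assert (Hr : ip P r (v m) = 0).
    { unfold r; rewrite ip_lin_l by auto; rewrite ip_comb_eig, coef_norm.
      destruct (Nat.leb_spec m n); [ring|lia]. }
    assert (Hdiff : ip P (lin 1 rho (-1) r) (lin 1 rho (-1) r) <= mass P * d ^ 2).
    { apply ip_le_sup; [apply contp_lin; assumption|]; intros b x Hx.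
      unfold lin at 1, rho, r, lin; rewrite (Hcl' b x Hx).
      assert (B1 := HN n b x (Nat.le_add_r _ _)); rewrite (Hcl' b x Hx) in B1.
      replace (1 * (f b x - s b x) + -1 * (1 * f b x + -1 * comb (coef f) v n b x))
        with (comb (coef f) v n b x - s b x) by ring.
      apply pow_maj_Rabs, B1. }
    assert (Hcs := cauchy_schwarz P (lin 1 rho (-1) r) (v m) (contp_lin _ _ _ _ Hrho Cr) (contp_eig m)).
    rewrite ip_lin_l, Hr in Hcs by auto.
    assert (Hd : d ^ 2 <= ip P rho (v m) ^ 2 / (2 * C)).
    { generalize (Rmin_l 1 (ip P rho (v m) ^ 2 / (2 * C))) (Rmin_r 1 (ip P rho (v m) ^ 2 / (2 * C))); fold d; nra. }
    assert (ip P (lin 1 rho (-1) r) (lin 1 rho (-1) r) * ip P (v m) (v m) <= mass P * d ^ 2 * ip P (v m) (v m)) by (apply Rmult_le_compat_r; lra).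
    assert (C * d ^ 2 <= C * (ip P rho (v m) ^ 2 / (2 * C))) by (apply Rmult_le_compat_l; lra).
    replace (C * (ip P rho (v m) ^ 2 / (2 * C))) with (ip P rho (v m) ^ 2 / 2) in H0 by (field; lra).
    unfold C in H0; nra. }
  assert (Hz : forall b x, inS P b x -> rho b x = 0).
  { apply (perp_trivial P rho kernel Hrho).
    intros z e de He; destruct (complete z e de He) as [n [c Hc]].
    rewrite (ip_ext P rho rho e (lin c (v n) 0 (v n))).
    - rewrite ip_lin_r, Hperp by auto; ring.
    - reflexivity.
    - intros b x Hx; rewrite (Hc b x Hx); unfold lin; ring. }
  intros He; destruct (Hs eps He) as [N HN]; exists N; intros n b x Hn Hx.
  specialize (HN n b x Hn); specialize (Hz b x Hx); unfold rho in Hz.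
  rewrite (Hcl' b x Hx) in *; replace (f b x) with (s b x) by lra; exact HN.
Qed.

End Orthogonal.

(** * One-sided derivatives and extension to the line *)

(** The real case of [is_derive_within] in epsilon-delta form, convenient for restricting the domain
    and for gluing. *)
Definition dwithin (D : R -> Prop) (y : R -> R) (x l : R) : Prop :=
  forall eps, 0 < eps -> exists d, 0 < d /\ forall t, D t -> Rabs (t - x) < d ->
    Rabs (y t - y x - l * (t - x)) <= eps * Rabs (t - x).

Lemma norm_C_R (z : C) : @norm R_AbsRing C_R_NormedModule z = Cmod z.
Proof.
  change (sqrt (Rabs (fst z) ^ 2 + Rabs (snd z) ^ 2) = sqrt (fst z ^ 2 + snd z ^ 2)).
  rewrite !pow2_abs; reflexivity.
Qed.

Lemma Cmod_le_sum (z : C) : Cmod z <= Rabs (fst z) + Rabs (snd z).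
Proof.
  unfold Cmod; rewrite <- (pow2_abs (fst z)), <- (pow2_abs (snd z)).
  generalize (Rabs_pos (fst z)) (Rabs_pos (snd z)); intros.
  rewrite <- (sqrt_pow2 (Rabs (fst z) + Rabs (snd z))) by lra.
  apply sqrt_le_1_alt; nra.
Qed.

Definition cdwithin (D : R -> Prop) (y : R -> C) (x : R) (l : C) : Prop :=
  dwithin D (fun t => fst (y t)) x (fst l) /\ dwithin D (fun t => snd (y t)) x (snd l).

Lemma is_derive_within_comps (D : R -> Prop) (y : R -> C) (x : R) (l : C) :
  is_derive_within D y x l -> cdwithin D y x l.
Proof.
  intros [_ H].
  assert (Hx : is_filter_lim (within D (locally x)) x).
  { intros Q HQ; apply (filter_le_within D (F := locally x)), HQ. }
  specialize (H x Hx).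
  assert (H' : forall eps, 0 < eps -> exists d, 0 < d /\ forall t, D t -> Rabs (t - x) < d ->
    Rmax (Rabs (fst (y t) - fst (y x) - fst l * (t - x)))
      (Rabs (snd (y t) - snd (y x) - snd l * (t - x))) <= eps * Rabs (t - x)).
  { intros eps He; destruct (H (mkposreal eps He)) as [d Hd]; exists d; split; [apply cond_pos|].
    intros t Dt Ht; specialize (Hd t Ht Dt); simpl in Hd; rewrite norm_C_R in Hd.
    eapply Rle_trans; [|exact Hd].
    eapply Rle_trans; [|apply Rmax_Cmod].
    right; f_equal; f_equal.
    - change (fst (y t) - fst (y x) - fst l * (t - x) = fst (y t) - fst (y x) - (t - x) * fst l); ring.
    - change (snd (y t) - snd (y x) - snd l * (t - x) = snd (y t) - snd (y x) - (t - x) * snd l); ring. }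
  split; intros eps He; destruct (H' eps He) as [d [d0 Hd]]; exists d; split; try exact d0;
    intros t Dt Ht; (eapply Rle_trans; [|apply (Hd t Dt Ht)]); [apply Rmax_l|apply Rmax_r].
Qed.

Lemma dwithin_is_derive_within (D : R -> Prop) (y : R -> R) (x l : R) : D x ->
  dwithin D y x l -> is_derive_within D (fun t => RtoC (y t)) x (RtoC l).
Proof.
  intros Dx H; split; [exact (@is_linear_scal_l R_AbsRing C_R_NormedModule (RtoC l))|].
  intros x0 Hx0.
  (* [filterdiff] asks for the estimate at every limit of the filter; since [x] lies in [D], the
     only limit is [x] itself. *)
  assert (E : x = x0).
  { apply eq_close; intros eps.
    assert (Hb := Hx0 _ (locally_ball x0 eps)).
    apply ball_sym, (locally_singleton _ _ Hb), Dx. }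
  rewrite <- E; intros eps.
  destruct (H eps (cond_pos eps)) as [d [d0 Hd]].
  exists (mkposreal d d0); intros t Ht Dt.
  rewrite norm_C_R.
  match goal with |- Cmod ?z <= _ => replace z with (RtoC (y t - y x - l * (t - x))) end.
  - rewrite Cmod_R; exact (Hd t Dt Ht).
  - apply injective_projections.
    + change (y t - y x - l * (t - x) = y t - y x - (t - x) * l); ring.
    + change (0 = 0 - 0 - (t - x) * 0); ring.
Qed.

Lemma is_derive_dwithin (D : R -> Prop) (y : R -> R) (x l : R) :
  is_derive y x l -> dwithin D y x l.
Proof.
  intros [_ H] eps He.
  destruct (H x (fun Q HQ => HQ) (mkposreal eps He)) as [d Hd].
  exists d; split; [apply cond_pos|]; intros t _ Ht; specialize (Hd t Ht).
  change (Rabs (y t - y x - (t - x) * l) <= eps * Rabs (t - x)) in Hd.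
  rewrite (Rmult_comm l); exact Hd.
Qed.

Lemma dwithin_sub (D D' : R -> Prop) (y : R -> R) (x l : R) :
  (forall t, D' t -> D t) -> dwithin D y x l -> dwithin D' y x l.
Proof.
  intros HD H eps He; destruct (H eps He) as [d [d0 Hd]]; exists d; split; [exact d0|].
  intros t Dt; apply Hd, HD, Dt.
Qed.

Lemma dwithin_local (D D' : R -> Prop) (y y' : R -> R) (x l r : R) : 0 < r -> D x ->
  (forall t, D' t -> Rabs (t - x) < r -> D t) -> (forall t, D t -> y t = y' t) ->
  dwithin D y x l -> dwithin D' y' x l.
Proof.
  intros r0 Dx HD Hy H eps He; destruct (H eps He) as [d [d0 Hd]].
  exists (Rmin d r); split; [apply Rmin_glb_lt; assumption|].
  intros t Dt Ht; assert (Dt' : D t) by (apply HD; [exact Dt|eapply Rlt_le_trans; [exact Ht|apply Rmin_r]]).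
  rewrite <- (Hy t Dt'), <- (Hy x Dx); apply Hd; [exact Dt'|].
  eapply Rlt_le_trans; [exact Ht|apply Rmin_l].
Qed.

Lemma dwithin_minus (D : R -> Prop) (y w : R -> R) (x l m : R) :
  dwithin D y x l -> dwithin D w x m -> dwithin D (fun t => y t - w t) x (l - m).
Proof.
  intros Hy Hw eps He.
  destruct (Hy (eps / 2)) as [d [d0 Hd]]; [lra|].
  destruct (Hw (eps / 2)) as [e [e0 Hd']]; [lra|].
  exists (Rmin d e); split; [apply Rmin_glb_lt; assumption|]; intros t Dt Ht.
  specialize (Hd t Dt (Rlt_le_trans _ _ _ Ht (Rmin_l _ _))).
  specialize (Hd' t Dt (Rlt_le_trans _ _ _ Ht (Rmin_r _ _))).
  replace (y t - w t - (y x - w x) - (l - m) * (t - x))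
    with ((y t - y x - l * (t - x)) - (w t - w x - m * (t - x))) by ring.
  unfold Rminus at 1; eapply Rle_trans; [apply Rabs_triang|]; rewrite Rabs_Ropp; lra.
Qed.

Definition contin (D : R -> Prop) (y : R -> R) (x : R) : Prop :=
  forall eps, 0 < eps -> exists d, 0 < d /\ forall t, D t -> Rabs (t - x) < d -> Rabs (y t - y x) < eps.

Lemma dwithin_contin (D : R -> Prop) (y : R -> R) (x l : R) : dwithin D y x l -> contin D y x.
Proof.
  intros H eps He; destruct (H 1 Rlt_0_1) as [d [d0 Hd]].
  assert (L : 0 < Rabs l + 1) by (generalize (Rabs_pos l); lra).
  exists (Rmin d (eps / (Rabs l + 1))); split.
  { apply Rmin_glb_lt; [exact d0|apply Rdiv_lt_0_compat; assumption]. }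
  intros t Dt Ht; specialize (Hd t Dt (Rlt_le_trans _ _ _ Ht (Rmin_l _ _))).
  assert (Ht' := Rlt_le_trans _ _ _ Ht (Rmin_r _ _)).
  apply Rlt_div_r in Ht'; [|exact L].
  replace (y t - y x) with ((y t - y x - l * (t - x)) + l * (t - x)) by ring.
  eapply Rle_lt_trans; [apply Rabs_triang|]; rewrite Rabs_mult; lra.
Qed.

(** Composing with the clamp to [[s, t]] gives a function with ordinary derivative inside and
    continuous at the ends, to which the mean value theorem applies. *)
Lemma dwithin_zero_const (D : R -> Prop) (y : R -> R) (s t : R) : s <= t ->
  (forall x, s <= x <= t -> D x /\ dwithin D y x 0) -> y s = y t.
Proof.
  intros Hst H.
  destruct (MVT_gen (fun x => y (clamp s t x)) s t (fun _ => 0)) as [c [_ Hc]].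
  - rewrite Rmin_left, Rmax_right by lra; intros x Hx.
    apply is_derive_Reals; intros eps He.
    destruct (H x) as [_ H']; [lra|]; destruct (H' (eps / 2)) as [d [d0 Hd]]; [lra|].
    assert (r0 : 0 < Rmin d (Rmin (x - s) (t - x))) by (repeat apply Rmin_glb_lt; lra).
    exists (mkposreal _ r0); simpl; intros h h0 Hh.
    generalize (Rlt_le_trans _ _ _ Hh (Rmin_l _ _)) (Rlt_le_trans _ _ _ Hh (Rmin_r _ _)); intros A1 A2.
    generalize (Rlt_le_trans _ _ _ A2 (Rmin_l _ _)) (Rlt_le_trans _ _ _ A2 (Rmin_r _ _)); intros A3 A4.
    apply Rabs_lt_between in A3; apply Rabs_lt_between in A4.
    rewrite !clamp_id by lra.
    assert (Hd' := Hd (x + h)); replace (x + h - x) with h in Hd' by ring.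
    destruct (H (x + h)) as [Dxh _]; [lra|].
    specialize (Hd' Dxh A1).
    replace ((y (x + h) - y x) / h - 0) with ((y (x + h) - y x - 0 * h) / h) by (field; exact h0).
    unfold Rdiv; rewrite Rabs_mult, Rabs_inv.
    assert (hp : 0 < Rabs h) by (apply Rabs_pos_lt, h0).
    apply Rmult_lt_reg_r with (Rabs h); [exact hp|].
    rewrite Rmult_assoc, Rinv_l by lra; nra.
  - rewrite Rmin_left, Rmax_right by lra; intros x Hx.
    apply continuous_pt, continuous_eps; intros eps He.
    destruct (dwithin_contin D y x 0 (proj2 (H x Hx)) eps He) as [d [d0 Hd]].
    exists d; split; [exact d0|]; intros w Hw.
    rewrite (clamp_id s t x Hx); apply Hd.
    + apply H, clamp_in, Hst.
    + rewrite <- (clamp_id s t x Hx) at 1; eapply Rle_lt_trans; [apply clamp_lipschitz|exact Hw].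
  - rewrite !clamp_id in Hc by lra; lra.
Qed.

(** * The two half-open intervals and their limits at 0 *)

Definition sheet (b : bool) : R -> Prop := if b then left_int else right_int.
Definition slo (b : bool) : R := if b then - PI else 0.
Definition shi (b : bool) : R := if b then 0 else PI.
(** The outer end point, the one that belongs to the half-open interval; integration starts
    there. *)
Definition anchor (b : bool) : R := if b then - PI else PI.

Lemma slo_lt_shi (b : bool) : slo b < shi b.
Proof. generalize PI_RGT_0; destruct b; simpl; lra. Qed.

Lemma sheet_iff (b : bool) (x : R) : sheet b x <-> slo b <= x <= shi b /\ x <> 0.
Proof.
  generalize PI_RGT_0; destruct b; unfold sheet, left_int, right_int; simpl; intros; split;
  intros; lra.
Qed.

Lemma anchor_in (b : bool) : sheet b (anchor b).
Proof. generalize PI_RGT_0; destruct b; unfold sheet, left_int, right_int; simpl; lra. Qed.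

Lemma sheet_anchor (b : bool) (x t : R) : sheet b x ->
  Rmin (anchor b) x <= t <= Rmax (anchor b) x -> sheet b t.
Proof.
  unfold Rmin, Rmax; destruct (Rle_dec (anchor b) x);
  destruct b; unfold sheet, left_int, right_int in *; simpl in *; lra.
Qed.

Lemma sheet_const (b : bool) (y : R -> R) (x : R) :
  (forall x, sheet b x -> dwithin (sheet b) y x 0) -> sheet b x -> y x = y (anchor b).
Proof.
  intros H Hx; destruct (Rle_lt_dec (anchor b) x).
  - symmetry; apply (dwithin_zero_const (sheet b)); [assumption|].
    intros t Ht; assert (sheet b t) by (apply (sheet_anchor b x); [exact Hx|rewrite Rmin_left, Rmax_right by lra; exact Ht]).
    split; [assumption|apply H; assumption].
  - apply (dwithin_zero_const (sheet b)); [lra|].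
    intros t Ht; assert (sheet b t) by (apply (sheet_anchor b x); [exact Hx|rewrite Rmin_right, Rmax_left by lra; exact Ht]).
    split; [assumption|apply H; assumption].
Qed.

(** The extension integrates [h] twice from the anchor with matching Cauchy data. Its difference
    from the given function has zero derivative, at first order and then at zeroth order. *)
Lemma extend_C2 (b : bool) (y dy h : R -> R) : (forall x, continuous h x) ->
  (forall x, sheet b x -> dwithin (sheet b) y x (dy x) /\ dwithin (sheet b) dy x (h x)) ->
  exists Y dY : R -> R, (forall x, is_derive Y x (dY x)) /\ (forall x, is_derive dY x (h x)) /\
    forall x, sheet b x -> y x = Y x /\ dy x = dY x.
Proof.
  intros Hh H; set (c := anchor b).
  set (Y := fun x => y c + dy c * (x - c) + dint c h x).
  set (dY := fun x => dy c + RInt h c x).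
  assert (HY : forall x, is_derive Y x (dY x)).
  { intros x; apply (is_derive_plus (fun x => y c + dy c * (x - c)) (dint c h)); [|apply is_derive_dint, Hh].
    auto_derive; [exact I|ring]. }
  assert (HdY : forall x, is_derive dY x (h x)).
  { intros x; apply is_derive_eq with (0 + h x); [|ring].
    apply (is_derive_plus (fun _ => dy c) (fun x => RInt h c x)); [apply (is_derive_const (dy c))|].
    apply is_derive_RInt_cont, Hh. }
  exists Y, dY; split; [exact HY|split; [exact HdY|]].
  assert (E : forall x, sheet b x -> dy x = dY x).
  { intros x Hx; apply Rminus_diag_uniq.
    rewrite (sheet_const b (fun t => dy t - dY t) x).
    - fold c; unfold dY; rewrite RInt_point; change (dy c - (dy c + 0) = 0); ring.
    - intros t Ht; rewrite <- (Rminus_diag (h t)).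
      apply dwithin_minus; [apply H, Ht|apply is_derive_dwithin, HdY].
    - exact Hx. }
  intros x Hx; split; [|apply E, Hx]; apply Rminus_diag_uniq.
  rewrite (sheet_const b (fun t => y t - Y t) x).
  - fold c; unfold Y; rewrite dint_start; ring.
  - intros t Ht; rewrite <- (Rminus_diag (dy t)) ; rewrite (E t Ht) at 2.
    apply dwithin_minus; [apply H, Ht|apply is_derive_dwithin, HY].
  - exact Hx.
Qed.

Definition side_lim (b : bool) (y : R -> R) (l : R) : Prop :=
  forall eps, 0 < eps -> exists d, 0 < d /\ forall t, sheet b t -> Rabs t < d -> Rabs (y t - l) < eps.

Lemma extend_continuous (b : bool) (y : R -> R) (l : R) :
  (forall x, sheet b x -> contin (sheet b) y x) -> side_lim b y l ->
  exists Y, (forall x, continuous Y x) /\ forall x, sheet b x -> y x = Y x.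
Proof.
  intros H Hl.
  (* The value of [y] at 0 is arbitrary and is replaced by the one-sided limit. *)
  set (y0 := fun t => if Req_dec_T t 0 then l else y t).
  assert (L := slo_lt_shi b).
  exists (fun x => y0 (clamp (slo b) (shi b) x)); split.
  - intros x; apply continuous_eps; intros eps He.
    assert (Hc := fun t => clamp_in (slo b) (shi b) t (Rlt_le _ _ L)).
    assert (Hlip := clamp_lipschitz (slo b) (shi b) x).
    set (cx := clamp (slo b) (shi b) x) in *.
    destruct (Req_dec cx 0) as [h|h].
    + destruct (Hl eps He) as [d [d0 Hd]]; exists d; split; [exact d0|]; intros t Ht.
      specialize (Hlip t); rewrite h, Rminus_0_r in Hlip.
      unfold y0 at 2; rewrite h; destruct (Req_dec_T 0 0); [|lra].
      unfold y0; destruct (Req_dec_T (clamp (slo b) (shi b) t) 0).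
      * rewrite Rminus_diag, Rabs_R0; exact He.
      * apply Hd; [apply sheet_iff; split; [apply Hc|assumption]|lra].
    + assert (Hx : sheet b cx) by (apply sheet_iff; split; [apply Hc|exact h]).
      destruct (H cx Hx eps He) as [d [d0 Hd]].
      exists (Rmin d (Rabs cx)); split; [apply Rmin_glb_lt; [exact d0|apply Rabs_pos_lt, h]|].
      intros t Ht; specialize (Hlip t).
      assert (A1 := Rlt_le_trans _ _ _ Ht (Rmin_l _ _)).
      assert (A2 := Rlt_le_trans _ _ _ Ht (Rmin_r _ _)).
      unfold y0; destruct (Req_dec_T cx 0); [contradiction|].
      destruct (Req_dec_T (clamp (slo b) (shi b) t) 0) as [e|e].
      * rewrite e in Hlip; replace (0 - cx) with (- cx) in Hlip by ring; rewrite Rabs_Ropp in Hlip; lra.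
      * apply Hd; [apply sheet_iff; split; [apply Hc|assumption]|lra].
  - intros x Hx; apply sheet_iff in Hx; rewrite clamp_id by apply Hx.
    unfold y0; destruct (Req_dec_T x 0); [lra|reflexivity].
Qed.

Lemma sheet_near0 (b : bool) (d : R) : 0 < d -> exists t, sheet b t /\ Rabs t < d.
Proof.
  intros d0; assert (P0 := PI_RGT_0).
  assert (m0 : 0 < Rmin PI (d / 2)) by (apply Rmin_glb_lt; lra).
  generalize (Rmin_l PI (d / 2)) (Rmin_r PI (d / 2)); intros.
  exists (if b then - Rmin PI (d / 2) else Rmin PI (d / 2)).
  destruct b; unfold sheet, left_int, right_int; (split; [lra|apply Rabs_lt_between; lra]).
Qed.

Lemma side_lim_unique (b : bool) (y Y : R -> R) (l : R) : side_lim b y l -> continuous Y 0 ->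
  (forall x, sheet b x -> y x = Y x) -> l = Y 0.
Proof.
  intros Hl HY E; apply Rminus_diag_uniq, Rabs_eq_0, Rle_antisym; [|apply Rabs_pos].
  apply le_epsilon; intros eps He; rewrite Rplus_0_l.
  destruct (Hl (eps / 2)) as [d [d0 Hd]]; [lra|].
  destruct (proj1 (continuous_eps Y 0) HY (eps / 2)) as [d' [d0' Hd']]; [lra|].
  destruct (sheet_near0 b (Rmin d d')) as [t [Ht1 Ht2]]; [apply Rmin_glb_lt; assumption|].
  specialize (Hd t Ht1 (Rlt_le_trans _ _ _ Ht2 (Rmin_l _ _))).
  assert (A := Rlt_le_trans _ _ _ Ht2 (Rmin_r _ _)).
  specialize (Hd' t); rewrite Rminus_0_r in Hd'; specialize (Hd' A).
  rewrite (E t Ht1) in Hd.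
  apply Rabs_lt_between in Hd; apply Rabs_lt_between in Hd'; apply Rabs_le; lra.
Qed.

Lemma continuous_side_lim (b : bool) (Y : R -> R) : continuous Y 0 -> side_lim b Y (Y 0).
Proof.
  intros HY eps He; destruct (proj1 (continuous_eps Y 0) HY eps He) as [d [d0 Hd]].
  exists d; split; [exact d0|]; intros t _ Ht; apply Hd; rewrite Rminus_0_r; exact Ht.
Qed.

Lemma agree_closed (b : bool) (y Y : R -> R) : (forall x, continuous y x) -> (forall x, continuous Y x) ->
  (forall x, sheet b x -> y x = Y x) -> forall x, slo b <= x <= shi b -> y x = Y x.
Proof.
  intros Hy HY E x Hx; destruct (Req_dec x 0) as [->|h].
  - apply (side_lim_unique b y Y); [apply continuous_side_lim, Hy|apply HY|exact E].
  - apply E, sheet_iff; split; assumption.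
Qed.

Definition one_sided (b : bool) (y : R -> C) (l : C) : Prop :=
  if b then left_lim y l else right_lim y l.

Lemma sheet_side (b : bool) (t : R) : sheet b t -> if b then t < 0 else 0 < t.
Proof. destruct b; unfold sheet, left_int, right_int; lra. Qed.

Lemma one_sided_comps (b : bool) (y : R -> C) (l : C) : one_sided b y l ->
  side_lim b (fun t => fst (y t)) (fst l) /\ side_lim b (fun t => snd (y t)) (snd l).
Proof.
  intros H.
  assert (H' : forall eps : posreal, exists d, 0 < d /\ forall t, sheet b t -> Rabs t < d -> ball l eps (y t)).
  { intros eps; destruct b; simpl in H;
    destruct (proj1 (filterlim_locally y l) H eps) as [d Hd]; exists d; (split; [apply cond_pos|]);
    intros t Ht1 Ht2; (apply Hd; [change (Rabs (t - 0) < d); rewrite Rminus_0_r; exact Ht2|]);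
    [apply (sheet_side true)|apply (sheet_side false)]; exact Ht1. }
  split; intros eps He; destruct (H' (mkposreal eps He)) as [d [d0 Hd]]; exists d; (split; [exact d0|]);
  intros t Ht1 Ht2; apply (Hd t Ht1 Ht2).
Qed.

Lemma side_lim_real (b : bool) (q : R -> R) (l : R) :
  filterlim q (if b then at_left 0 else at_right 0) (locally l) -> side_lim b q l.
Proof.
  intros H eps He; destruct b;
  destruct (proj1 (filterlim_locally q l) H (mkposreal eps He)) as [d Hd]; exists d; (split; [apply cond_pos|]);
  intros t Ht1 Ht2; (apply Hd; [change (Rabs (t - 0) < d); rewrite Rminus_0_r; exact Ht2|]);
  [apply (sheet_side true)|apply (sheet_side false)]; exact Ht1.
Qed.

Lemma continuous_on_real (D : R -> Prop) (q : R -> R) (x : R) :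
  continuous_on D q -> D x -> contin D q x.
Proof.
  intros H Dx eps He.
  destruct (proj1 (filterlim_locally q (q x)) (H x Dx) (mkposreal eps He)) as [d Hd].
  exists d; split; [apply cond_pos|]; intros t Dt Ht; exact (Hd t Ht Dt).
Qed.

Lemma continuous_on_comps (D : R -> Prop) (y : R -> C) (x : R) :
  continuous_on D y -> D x -> contin D (fun t => fst (y t)) x /\ contin D (fun t => snd (y t)) x.
Proof.
  intros H Dx.
  assert (H' : forall eps : posreal, exists d, 0 < d /\ forall t, D t -> Rabs (t - x) < d -> ball (y x) eps (y t)).
  { intros eps; destruct (proj1 (filterlim_locally y (y x)) (H x Dx) eps) as [d Hd].
    exists d; split; [apply cond_pos|]; intros t Dt Ht; exact (Hd t Ht Dt). }
  split; intros eps He; destruct (H' (mkposreal eps He)) as [d [d0 Hd]]; exists d; (split; [exact d0|]);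
  intros t Ht1 Ht2; apply (Hd t Ht1 Ht2).
Qed.

Lemma contin_sub (D D' : R -> Prop) (y : R -> R) (x : R) :
  (forall t, D' t -> D t) -> contin D y x -> contin D' y x.
Proof.
  intros HD H eps He; destruct (H eps He) as [d [d0 Hd]]; exists d; split; [exact d0|].
  intros t Dt; apply Hd, HD, Dt.
Qed.

Lemma extend_pair (u du ddu : bool -> R -> C) (Hr Hi : pw) : contp Hr -> contp Hi ->
  (forall b x, sheet b x -> cdwithin (sheet b) (u b) x (du b x) /\
     cdwithin (sheet b) (du b) x (ddu b x) /\ ddu b x = (Hr b x, Hi b x)) ->
  exists a da e de : pw,
    (forall b x, is_derive (a b) x (da b x) /\ is_derive (da b) x (Hr b x) /\
       is_derive (e b) x (de b x) /\ is_derive (de b) x (Hi b x)) /\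
    forall b x, sheet b x -> u b x = (a b x, e b x) /\ du b x = (da b x, de b x).
Proof.
  intros CHr CHi H.
  assert (HX : forall b, exists a da e de : R -> R,
    (forall x, is_derive a x (da x) /\ is_derive da x (Hr b x) /\
       is_derive e x (de x) /\ is_derive de x (Hi b x)) /\
    forall x, sheet b x -> u b x = (a x, e x) /\ du b x = (da x, de x)).
  { intros b.
    destruct (extend_C2 b (fun t => fst (u b t)) (fun t => fst (du b t)) (Hr b) (CHr b)) as [a [da [A1 [A2 A3]]]].
    { intros x Hx; destruct (H b x Hx) as [H1 [H2 H3]]; split.
      - apply H1.
      - change (Hr b x) with (fst (Hr b x, Hi b x)); rewrite <- H3; apply H2. }
    destruct (extend_C2 b (fun t => snd (u b t)) (fun t => snd (du b t)) (Hi b) (CHi b)) as [e [de [E1 [E2 E3]]]].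
    { intros x Hx; destruct (H b x Hx) as [H1 [H2 H3]]; split.
      - apply H1.
      - change (Hi b x) with (snd (Hr b x, Hi b x)); rewrite <- H3; apply H2. }
    exists a, da, e, de; split; [auto|].
    intros x Hx; destruct (A3 x Hx) as [B1 B2], (E3 x Hx) as [B3 B4].
    rewrite <- B1, <- B2, <- B3, <- B4; split; apply surjective_pairing. }
  destruct (HX true) as [a1 [da1 [e1 [de1 [A1 B1]]]]].
  destruct (HX false) as [a2 [da2 [e2 [de2 [A2 B2]]]]].
  exists (fun b : bool => if b then a1 else a2), (fun b : bool => if b then da1 else da2),
    (fun b : bool => if b then e1 else e2), (fun b : bool => if b then de1 else de2).
  split; intros [|]; assumption.
Qed.

(** * Reduction to the real two-interval problem *)

(** Negative [r] matters: the weighted integral of a real square has the common sign of [Delta_12]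
    and [Delta_34]. *)
Lemma Csqrt_sq (r : R) : (Csqrt (RtoC r) * Csqrt (RtoC r))%C = RtoC r.
Proof.
  unfold Csqrt; rewrite Cmod_R; simpl Re; simpl Im.
  destruct (Rle_dec 0 0); [|lra].
  destruct (Rle_lt_dec 0 r).
  - rewrite Rabs_right by lra.
    replace ((r - r) / 2) with 0 by field; replace ((r + r) / 2) with r by field.
    rewrite sqrt_0; apply injective_projections; simpl; [|ring].
    rewrite sqrt_sqrt by assumption; ring.
  - rewrite Rabs_left by lra.
    replace ((- r - r) / 2) with (- r) by field; replace ((- r + r) / 2) with 0 by field.
    rewrite sqrt_0; apply injective_projections; simpl; [|ring].
    rewrite !Rmult_1_l, sqrt_sqrt by lra; ring.
Qed.

Section Transfer.

Variables (P : SL_data) (qe : pw).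
Hypothesis hp1 : 0 < p1 P.
Hypothesis hp2 : 0 < p2 P.
Hypothesis hDelta : 0 < minor P 1 2 * minor P 3 4.
Hypothesis qe_cont : contp qe.
Hypothesis qe_eq : forall b x, sheet b x -> q P x = qe b x.

Definition pb (b : bool) : R := if b then p1 P else p2 P.
(* The common factor [minor P 3 4] makes both weights positive whatever the sign of the minors. *)
Definition kb (b : bool) : R := minor P 3 4 * if b then minor P 3 4 else minor P 1 2.

Lemma pb_pos (b : bool) : 0 < pb b.
Proof. destruct b; assumption. Qed.

Lemma kb_pos (b : bool) : 0 < kb b.
Proof.
  unfold kb; destruct b; [|lra].
  assert (minor P 3 4 <> 0) by (intros E; rewrite E in hDelta; lra).
  generalize (pow2_gt_0 _ H); lra.
Qed.

Lemma minor12_neq0 : minor P 1 2 <> 0.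
Proof. intros E; rewrite E in hDelta; lra. Qed.

Lemma minor34_neq0 : minor P 3 4 <> 0.
Proof. intros E; rewrite E in hDelta; lra. Qed.

Lemma cos_sin_sq (t : R) : cos t ^ 2 + sin t ^ 2 = 1.
Proof. generalize (sin2_cos2 t); unfold Rsqr; lra. Qed.

(* The Pluecker relation among the minors of a 2 x 4 matrix. *)
Lemma kb_det : kb false * (minor P 2 3 / minor P 1 2 * (- minor P 1 4 / minor P 1 2) -
  minor P 2 4 / minor P 1 2 * (- minor P 1 3 / minor P 1 2)) = kb true.
Proof.
  assert (E : minor P 2 4 * minor P 1 3 - minor P 2 3 * minor P 1 4 = minor P 1 2 * minor P 3 4)
    by (unfold minor; ring).
  transitivity (minor P 3 4 * (minor P 2 4 * minor P 1 3 - minor P 2 3 * minor P 1 4) / minor P 1 2);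
  [unfold kb|rewrite E; unfold kb]; field; apply minor12_neq0.
Qed.

Definition core : sl_problem :=
  {| lo := slo; hi := shi; pc := pb; qf := qe; kap := kb;
     ca := cos (alpha P); sa := sin (alpha P); cb := cos (beta P); sb := sin (beta P);
     m11 := minor P 2 3 / minor P 1 2; m12 := minor P 2 4 / minor P 1 2;
     m21 := - minor P 1 3 / minor P 1 2; m22 := - minor P 1 4 / minor P 1 2;
     lo_lt_hi := slo_lt_shi; pc_pos := pb_pos; qf_cont := qe_cont; kap_pos := kb_pos;
     csa := cos_sin_sq (alpha P); csb := cos_sin_sq (beta P); kap_det := kb_det |}.

(** Cramer's rule for the data at 0+, the determinant of their coefficients being [Delta_12]. The
    resulting transfer matrix is the one in the initial conditions of [phi_2]. *)
Lemma transmission_solved (v dv w dw : R) :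
  (forall i : nat, i = 1%nat \/ i = 2%nat ->
     beta_m P i 1 * dv + beta_m P i 0 * v + beta_p P i 1 * dw + beta_p P i 0 * w = 0) <->
  w = m11 core * v + m12 core * dv /\ dw = m21 core * v + m22 core * dv.
Proof.
  assert (D := minor12_neq0); simpl; split.
  - intros H; assert (E1 := H 1%nat (or_introl eq_refl)); assert (E2 := H 2%nat (or_intror eq_refl)).
    split; apply Rmult_eq_reg_l with (minor P 1 2); try exact D.
    + transitivity (minor P 2 3 * v + minor P 2 4 * dv); [|field; exact D].
      apply Rminus_diag_uniq; unfold minor, Tmat.
      match type of E1 with ?a = 0 => match type of E2 with ?b = 0 =>
        transitivity (a * beta_p P 2 1 - b * beta_p P 1 1); [ring|rewrite E1, E2; ring] end end.
    + transitivity (- minor P 1 3 * v + - minor P 1 4 * dv); [|field; exact D].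
      apply Rminus_diag_uniq; unfold minor, Tmat.
      match type of E1 with ?a = 0 => match type of E2 with ?b = 0 =>
        transitivity (b * beta_p P 1 0 - a * beta_p P 2 0); [ring|rewrite E1, E2; ring] end end.
  - intros [-> ->] i Hi; apply Rmult_eq_reg_l with (minor P 1 2); [|exact D].
    match goal with |- _ * ?e = _ => transitivity (minor P 1 2 * (beta_m P i 1 * dv + beta_m P i 0 * v)
      + beta_p P i 1 * (- minor P 1 3 * v + - minor P 1 4 * dv) + beta_p P i 0 * (minor P 2 3 * v + minor P 2 4 * dv)) end.
    + field; exact D.
    + unfold minor, Tmat; destruct Hi as [-> | ->]; ring.
Qed.

(** * Complex solutions as pairs of real functions on the line *)

Definition linkedC (v dv w dw : C) : Prop :=
  (fst w = m11 core * fst v + m12 core * fst dv /\ fst dw = m21 core * fst v + m22 core * fst dv) /\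
  (snd w = m11 core * snd v + m12 core * snd dv /\ snd dw = m21 core * snd v + m22 core * snd dv).

Lemma transmission_linkedC (v dv w dw : C) :
  (forall i : nat, i = 1%nat \/ i = 2%nat ->
     (beta_m P i 1 * dv + beta_m P i 0 * v + beta_p P i 1 * dw + beta_p P i 0 * w = 0)%C) ->
  linkedC v dv w dw.
Proof.
  intros H; split; apply transmission_solved; intros i Hi; specialize (H i Hi).
  - apply (f_equal fst) in H; simpl in H; lra.
  - apply (f_equal snd) in H; simpl in H; lra.
Qed.

Lemma phi2_linkedC (v dv : C) :
  linkedC v dv ((1 / minor P 1 2)%R * (minor P 2 3 * v + minor P 2 4 * dv))%C
    ((-1 / minor P 1 2)%R * (minor P 1 3 * v + minor P 1 4 * dv))%C.
Proof.
  assert (D := minor12_neq0).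
  split; split; simpl; field; exact D.
Qed.

(** Here [a] and [e] are the real and imaginary parts. The index on [u] accommodates both a single
    function on the whole domain, as a constant family, and the separate functions [phi_1],
    [phi_2]. *)
Definition rep (u du : bool -> R -> C) (a da e de : pw) : Prop :=
  (forall b x, is_derive (a b) x (da b x) /\ is_derive (e b) x (de b x)) /\
  (contp da /\ contp de) /\
  forall b x, sheet b x -> u b x = (a b x, e b x) /\ du b x = (da b x, de b x).

Lemma rep_contp (u du : bool -> R -> C) (a da e de : pw) : rep u du a da e de ->
  contp a /\ contp e.
Proof.
  intros [H _]; split; intros b x; destruct (H b x) as [H1 H2];
  [exact (is_derive_cont _ _ _ H1)|exact (is_derive_cont _ _ _ H2)].
Qed.

Lemma rep_limits (u du : bool -> R -> C) (a da e de : pw) (b : bool) (v dv : C) :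
  rep u du a da e de -> one_sided b (u b) v -> one_sided b (du b) dv ->
  v = (a b 0, e b 0) /\ dv = (da b 0, de b 0).
Proof.
  intros Hrep Hv Hdv; destruct (rep_contp _ _ _ _ _ _ Hrep) as [Ca Ce].
  destruct Hrep as [_ [[Cda Cde] E]].
  apply one_sided_comps in Hv; apply one_sided_comps in Hdv.
  split; apply injective_projections; simpl.
  - apply (side_lim_unique b (fun t => fst (u b t)) (a b)); [apply Hv|apply Ca|].
    intros x Hx; rewrite (proj1 (E b x Hx)); reflexivity.
  - apply (side_lim_unique b (fun t => snd (u b t)) (e b)); [apply Hv|apply Ce|].
    intros x Hx; rewrite (proj1 (E b x Hx)); reflexivity.
  - apply (side_lim_unique b (fun t => fst (du b t)) (da b)); [apply Hdv|apply Cda|].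
    intros x Hx; rewrite (proj2 (E b x Hx)); reflexivity.
  - apply (side_lim_unique b (fun t => snd (du b t)) (de b)); [apply Hdv|apply Cde|].
    intros x Hx; rewrite (proj2 (E b x Hx)); reflexivity.
Qed.

Lemma rep_linked (u du : bool -> R -> C) (a da e de : pw) (v dv w dw : C) :
  rep u du a da e de ->
  one_sided true (u true) v -> one_sided true (du true) dv ->
  one_sided false (u false) w -> one_sided false (du false) dw -> linkedC v dv w dw ->
  linked core a da /\ linked core e de.
Proof.
  intros Hrep H1 H2 H3 H4.
  destruct (rep_limits u du a da e de true v dv Hrep H1 H2) as [-> ->].
  destruct (rep_limits u du a da e de false w dw Hrep H3 H4) as [-> ->].
  intros H; exact H.
Qed.

Definition csolves (z : C) (b : bool) (y dy : R -> C) : Prop :=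
  forall x, sheet b x -> cdwithin (sheet b) y x (dy x) /\
    exists ddy : C, cdwithin (sheet b) dy x ddy /\ (- (p P x * ddy) + q P x * y x = z * y x)%C.

Lemma cdwithin_sub (D D' : R -> Prop) (y : R -> C) (x : R) (l : C) :
  (forall t, D' t -> D t) -> cdwithin D y x l -> cdwithin D' y x l.
Proof. intros H [H1 H2]; split; eapply dwithin_sub; eassumption. Qed.

Lemma solves_csolves (z : C) (b : bool) (D : R -> Prop) (y dy : R -> C) :
  (forall x, sheet b x -> D x) -> solves P z D y dy -> csolves z b y dy.
Proof.
  intros HD H x Hx; destruct (H x (HD x Hx)) as [H1 [ddy [H2 H3]]].
  split; [|exists ddy; split; [|exact H3]]; apply (cdwithin_sub D); try exact HD;
  apply is_derive_within_comps; assumption.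
Qed.

Lemma p_sheet (b : bool) (x : R) : sheet b x -> p P x = pb b.
Proof.
  intros Hx; assert (S := sheet_side b x Hx); unfold p, pb.
  destruct b, (Rlt_dec x 0); lra.
Qed.

(** Separating [A u = z u] with real coefficients couples the two parts through the imaginary part
    of [z]. *)
Lemma extend_solution (z : C) (u du : bool -> R -> C) (v dv w dw : C) :
  (forall b, csolves z b (u b) (du b)) ->
  one_sided true (u true) v -> one_sided true (du true) dv ->
  one_sided false (u false) w -> one_sided false (du false) dw -> linkedC v dv w dw ->
  exists a da e de, rep u du a da e de /\
    cauchy_sol core a da (lin (fst z) a (- snd z) e) /\
    cauchy_sol core e de (lin (fst z) e (snd z) a).
Proof.
  intros Hs H1 H2 H3 H4 HL.
  assert (HG : forall b, exists Gr Gi : R -> R, (forall x, continuous Gr x) /\ (forall x, continuous Gi x) /\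
    forall x, sheet b x -> u b x = (Gr x, Gi x)).
  { intros b.
    assert (Hl : exists l, one_sided b (u b) l) by (destruct b; [exists v|exists w]; assumption).
    destruct Hl as [l Hl]; apply one_sided_comps in Hl; destruct Hl as [Hl1 Hl2].
    destruct (extend_continuous b (fun t => fst (u b t)) (fst l)) as [Gr [C1 E1]]; [|exact Hl1|].
    { intros x Hx; eapply dwithin_contin; apply (Hs b x Hx). }
    destruct (extend_continuous b (fun t => snd (u b t)) (snd l)) as [Gi [C2 E2]]; [|exact Hl2|].
    { intros x Hx; eapply dwithin_contin; apply (Hs b x Hx). }
    exists Gr, Gi; split; [exact C1|split; [exact C2|]].
    intros x Hx; rewrite <- (E1 x Hx), <- (E2 x Hx); apply surjective_pairing. }
  destruct (HG true) as [Gr1 [Gi1 [C1 [C1' E1]]]], (HG false) as [Gr2 [Gi2 [C2 [C2' E2]]]].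
  set (Gr := fun b : bool => if b then Gr1 else Gr2).
  set (Gi := fun b : bool => if b then Gi1 else Gi2).
  assert (CGr : contp Gr) by (intros [|]; assumption).
  assert (CGi : contp Gi) by (intros [|]; assumption).
  assert (EG : forall b x, sheet b x -> u b x = (Gr b x, Gi b x)) by (intros [|]; assumption).
  (* The second derivative as given by the equation, with the continuous extensions of [q] and of
     the solution inserted; integrating it twice produces the extended solution. *)
  set (Hr := fun b x => (qe b x * Gr b x - (fst z * Gr b x - snd z * Gi b x)) / pb b).
  set (Hi := fun b x => (qe b x * Gi b x - (fst z * Gi b x + snd z * Gr b x)) / pb b).
  destruct (extend_pair u du (fun b x => (Hr b x, Hi b x)) Hr Hi) as [a [da [e [de [HD HE]]]]].
  - intros b x; unfold Hr; cont; first [apply qe_cont|apply CGr|apply CGi].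
  - intros b x; unfold Hi; cont; first [apply qe_cont|apply CGr|apply CGi].
  - intros b x Hx; destruct (Hs b x Hx) as [D1 [ddy [D2 D3]]].
    split; [exact D1|split; [|reflexivity]].
    replace (Hr b x, Hi b x) with ddy; [exact D2|].
    rewrite (EG b x Hx), (p_sheet b x Hx), (qe_eq b x Hx) in D3.
    assert (p0 := pb_pos b).
    apply injective_projections; unfold Hr, Hi; simpl.
    + apply (f_equal fst) in D3; simpl in D3.
      apply Rmult_eq_reg_l with (pb b); [|lra].
      transitivity (qe b x * Gr b x - (fst z * Gr b x - snd z * Gi b x)); [lra|field; lra].
    + apply (f_equal snd) in D3; simpl in D3.
      apply Rmult_eq_reg_l with (pb b); [|lra].
      transitivity (qe b x * Gi b x - (fst z * Gi b x + snd z * Gr b x)); [lra|field; lra].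
  - assert (Hrep : rep u du a da e de).
    { split; [intros b x; destruct (HD b x) as [D1 [_ [D3 _]]]; split; assumption|split; [|exact HE]].
      split; intros b x; destruct (HD b x) as [_ [D2 [_ D4]]];
      [exact (is_derive_cont _ _ _ D2)|exact (is_derive_cont _ _ _ D4)]. }
    destruct (rep_contp _ _ _ _ _ _ Hrep) as [Ca Ce].
    destruct (rep_linked u du a da e de v dv w dw Hrep H1 H2 H3 H4 HL) as [La Le].
    assert (Ea : forall b x, inS core b x -> Gr b x = a b x).
    { intros b; apply (agree_closed b); [apply CGr|apply Ca|].
      intros x Hx; generalize (EG b x Hx); rewrite (proj1 (HE b x Hx)); intros E; inversion E; reflexivity. }
    assert (Ee : forall b x, inS core b x -> Gi b x = e b x).
    { intros b; apply (agree_closed b); [apply CGi|apply Ce|].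
      intros x Hx; generalize (EG b x Hx); rewrite (proj1 (HE b x Hx)); intros E; inversion E; reflexivity. }
    exists a, da, e, de; split; [exact Hrep|split].
    + split; [exact Ca|split; [|exact La]].
      intros b x Hx; destruct (HD b x) as [D1 [D2 [D3 D4]]]; split; [exact D1|].
      apply (is_derive_eq _ _ _ _ D2).
      unfold Hr, lin; rewrite (Ea b x Hx), (Ee b x Hx); simpl; f_equal; ring.
    + split; [exact Ce|split; [|exact Le]].
      intros b x Hx; destruct (HD b x) as [D1 [D2 [D3 D4]]]; split; [exact D3|].
      apply (is_derive_eq _ _ _ _ D4).
      unfold Hi, lin; rewrite (Ea b x Hx), (Ee b x Hx); simpl; reflexivity.
Qed.

Lemma sheet_dom (b : bool) (x : R) : sheet b x -> dom x.
Proof. destruct b; [left|right]; assumption. Qed.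

Lemma dom_sheet (x : R) : dom x -> exists b, sheet b x.
Proof. intros [H|H]; [exists true|exists false]; exact H. Qed.

Lemma sheet_inS (b : bool) (x : R) : sheet b x -> inS core b x.
Proof. intros H; apply sheet_iff in H; apply H. Qed.

Lemma rep_boundary (y dy : R -> C) (a da e de : pw) :
  rep (fun _ => y) (fun _ => dy) a da e de -> boundary_conditions P y dy ->
  (left_bc core a da = 0 /\ right_bc core a da = 0) /\
  (left_bc core e de = 0 /\ right_bc core e de = 0).
Proof.
  intros [_ [_ E]] [B1 B2].
  destruct (E true _ (anchor_in true)) as [E1 E2]; destruct (E false _ (anchor_in false)) as [E3 E4].
  simpl in E1, E2, E3, E4; rewrite E1, E2 in B1; rewrite E3, E4 in B2.
  assert (F1 := f_equal fst B1); assert (F2 := f_equal snd B1).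
  assert (F3 := f_equal fst B2); assert (F4 := f_equal snd B2).
  unfold left_bc, right_bc; simpl in *; repeat split; lra.
Qed.

Lemma extend_domain_solution (z : C) (y dy : R -> C) :
  solves P z dom y dy -> boundary_conditions P y dy -> transmission_conditions P y dy ->
  exists a da e de, rep (fun _ => y) (fun _ => dy) a da e de /\
    sol core a da (lin (fst z) a (- snd z) e) /\ sol core e de (lin (fst z) e (snd z) a).
Proof.
  intros Hs Hb [v [dv [w [dw [H1 [H2 [H3 [H4 HT]]]]]]]].
  destruct (extend_solution z (fun _ => y) (fun _ => dy) v dv w dw) as [a [da [e [de [Hrep [Sa Se]]]]]];
  try assumption.
  - intros b; apply (solves_csolves z b dom); [apply sheet_dom|exact Hs].
  - apply transmission_linkedC, HT.
  - destruct (rep_boundary y dy a da e de Hrep Hb) as [Ba Be].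
    exists a, da, e, de; split; [exact Hrep|split; split; assumption].
Qed.

Lemma ip_pos_of_neq0 (u : pw) (b : bool) (x : R) : contp u -> inS core b x -> u b x <> 0 ->
  0 < ip core u u.
Proof.
  intros Cu Hx Hn; destruct (Rle_lt_or_eq_dec _ _ (ip_ge0 core u Cu)) as [h|h]; [exact h|exfalso].
  apply Hn, (ip_eq0 core u Cu (eq_sym h) b x Hx).
Qed.

(** Lagrange's identity for the two parts gives [Im z * (|a|^2 + |e|^2) = 0]. With [z] real, both
    parts solve the real problem and at least one is nonzero. *)
Lemma eigenvalue_core (z : C) : eigenvalue P z ->
  snd z = 0 /\ exists w dw, eigenfun core (fst z) w dw /\ 0 < ip core w w.
Proof.
  intros [y [dy [Hs [Hb [HT [x [Hx Hy]]]]]]].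
  destruct (extend_domain_solution z y dy Hs Hb HT) as [a [da [e [de [Hrep [Sa Se]]]]]].
  assert (Ca : contp a) by apply Sa; assert (Ce : contp e) by apply Se.
  assert (HL := lagrange core a da _ e de _ (contp_lin (fst z) (- snd z) a e Ca Ce) (contp_lin (fst z) (snd z) e a Ce Ca) Sa Se).
  rewrite ip_lin_l, ip_lin_r in HL by assumption.
  destruct (dom_sheet x Hx) as [b Hbx].
  assert (Hne : a b x <> 0 \/ e b x <> 0).
  { apply NNPP; intros N; apply Hy.
    destruct Hrep as [_ [_ E]]; rewrite (proj1 (E b x Hbx)).
    destruct (Req_dec (a b x) 0) as [->|N1]; [|exfalso; apply N; left; exact N1].
    destruct (Req_dec (e b x) 0) as [->|N2]; [reflexivity|exfalso; apply N; right; exact N2]. }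
  assert (A0 := ip_ge0 core a Ca); assert (E0 := ip_ge0 core e Ce).
  assert (Hpos : 0 < ip core a a \/ 0 < ip core e e).
  { destruct Hne as [N|N]; [left|right]; apply (ip_pos_of_neq0 _ b x); auto using sheet_inS. }
  assert (Hz : snd z = 0).
  { apply Rmult_eq_reg_r with (ip core a a + ip core e e); lra. }
  split; [exact Hz|]; rewrite Hz in Sa, Se.
  destruct Hpos as [h|h]; [exists a, da|exists e, de]; (split; [|exact h]);
  (eapply sol_ext; [|eassumption]); intros; unfold lin, zero_pw; ring.
Qed.

Lemma core_eigenvalue (z : R) (w dw : pw) : eigenfun core z w dw ->
  (exists b x, inS core b x /\ w b x <> 0) -> eigenvalue P (RtoC z).
Proof.
  intros Hw [b0 [x0 [Hx0 Hn]]].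
  assert (Cw : contp w) by apply Hw.
  set (y := fun x => if Rlt_dec x 0 then w true x else w false x).
  set (dy := fun x => if Rlt_dec x 0 then dw true x else dw false x).
  assert (Ey : forall (g : pw) b x, sheet b x -> g b x = (if Rlt_dec x 0 then g true x else g false x)).
  { intros g b x Hx; generalize (sheet_side b x Hx); destruct b, (Rlt_dec x 0); intros; try reflexivity; lra. }
  (* Within distance [|x|] of [x] the domain consists of a single interval, so the derivative of the
     glued function is that of one component. *)
  assert (Hloc : forall g : pw, forall b x l, sheet b x -> is_derive (g b) x l ->
    dwithin dom (fun x => if Rlt_dec x 0 then g true x else g false x) x l).
  { intros g b x l Hx Hd.
    assert (S := sheet_side b x Hx).
    apply (dwithin_local (sheet b) dom (g b) _ x l (Rabs x)).
    - apply Rabs_pos_lt; destruct b; lra.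
    - exact Hx.
    - intros t Ht Htx; apply dom_sheet in Ht; destruct Ht as [b' Ht].
      assert (S' := sheet_side b' t Ht); apply Rabs_lt_between in Htx.
      destruct b, b'; try exact Ht; exfalso;
      [rewrite Rabs_left in Htx by exact S|rewrite Rabs_right in Htx by lra]; lra.
    - intros t Ht; apply Ey, Ht.
    - apply is_derive_dwithin, Hd. }
  assert (Hlim : forall (g : pw), (forall b, continuous (g b) 0) ->
    left_lim (fun x => RtoC (if Rlt_dec x 0 then g true x else g false x)) (RtoC (g true 0)) /\
    right_lim (fun x => RtoC (if Rlt_dec x 0 then g true x else g false x)) (RtoC (g false 0))).
  { intros g Cg; split; apply filterlim_locally; intros eps.
    - destruct (proj1 (continuous_eps _ _) (Cg true) eps (cond_pos eps)) as [d [d0 Hd]].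
      exists (mkposreal d d0); intros t Ht Ht'; destruct (Rlt_dec t 0); [|lra].
      split; [apply Hd, Ht|apply ball_center].
    - destruct (proj1 (continuous_eps _ _) (Cg false) eps (cond_pos eps)) as [d [d0 Hd]].
      exists (mkposreal d d0); intros t Ht Ht'; destruct (Rlt_dec t 0); [lra|].
      split; [apply Hd, Ht|apply ball_center]. }
  destruct Hw as [[_ [Dw Lw]] [LB RB]].
  exists (fun x => RtoC (y x)), (fun x => RtoC (dy x)); split; [|split; [|split]].
  - intros x Hx; destruct (dom_sheet x Hx) as [b Hb].
    destruct (Dw b x (sheet_inS b x Hb)) as [D1 D2].
    split; [|exists (RtoC ((qe b x * w b x - lin z w 1 zero_pw b x) / pb b)); split].
    + apply dwithin_is_derive_within; [exact Hx|].
      apply (Hloc w b x); [exact Hb|unfold dy; rewrite <- (Ey dw b x Hb); exact D1].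
    + apply dwithin_is_derive_within; [exact Hx|].
      apply (Hloc dw b x); [exact Hb|exact D2].
    + rewrite (p_sheet b x Hb), (qe_eq b x Hb).
      unfold y; rewrite <- (Ey w b x Hb); unfold lin, zero_pw.
      apply injective_projections; simpl; field; generalize (pb_pos b); lra.
  - assert (E1 := Ey w true _ (anchor_in true)); assert (E2 := Ey dw true _ (anchor_in true)).
    assert (E3 := Ey w false _ (anchor_in false)); assert (E4 := Ey dw false _ (anchor_in false)).
    simpl in E1, E2, E3, E4; unfold boundary_conditions, y, dy; rewrite <- E1, <- E2, <- E3, <- E4.
    unfold left_bc, right_bc in LB, RB; simpl in LB, RB.
    split; apply injective_projections; simpl; lra.
  - assert (H0 : forall b, inS core b 0).
    { intros b; generalize PI_RGT_0; destruct b; unfold inS; simpl; lra. }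
    assert (Cdw : forall b, continuous (dw b) 0) by (intros b; exact (is_derive_cont _ _ _ (proj2 (Dw b 0 (H0 b))))).
    destruct (Hlim w (fun b => Cw b 0)) as [L1 L2], (Hlim dw Cdw) as [L3 L4].
    exists (RtoC (w true 0)), (RtoC (dw true 0)), (RtoC (w false 0)), (RtoC (dw false 0)).
    split; [exact L1|split; [exact L3|split; [exact L2|split; [exact L4|]]]].
    intros i Hi; generalize (proj2 (transmission_solved _ _ _ _) Lw i Hi); simpl; intros E.
    apply injective_projections; simpl; lra.
  (* The given nonzero value may sit at 0, outside the domain; by continuity a function vanishing on
     the half-open interval vanishes there too. *)
  - apply NNPP; intros N; apply Hn.
    rewrite (agree_closed b0 (w b0) (fun _ => 0)); [reflexivity|apply Cw|intros; apply cont_const| |exact Hx0].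
    intros x Hx; apply NNPP; intros N'; apply N.
    exists x; split; [apply (sheet_dom b0), Hx|].
    unfold y; rewrite <- (Ey w b0 x Hx); intros E; apply N', (f_equal fst E).
Qed.

Lemma core_trivial_kernel : ~ eigenvalue P 0%C -> trivial_kernel core.
Proof.
  intros h0 e de He b x Hx; apply NNPP; intros N; apply h0.
  apply (core_eigenvalue 0 e de He); exists b, x; split; assumption.
Qed.

(** Simplicity of the eigenvalues: the left boundary condition fixes the Cauchy data up to a factor,
    and the Cauchy problem is uniquely solvable. *)
Lemma eigenfun_proportional (z : R) (w dw a da : pw) : eigenfun core z w dw ->
  cauchy_sol core a da (lin z a 1 zero_pw) ->
  a true (slo true) = sin (alpha P) -> da true (slo true) = - cos (alpha P) ->
  exists c, forall b x, inS core b x -> w b x = c * a b x /\ dw b x = c * da b x.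
Proof.
  intros [Sw [Lw _]] Sa I1 I2.
  destruct (subtract_fundamental core w dw Lw) as [E1 E2].
  set (c := sa core * w true (lo core true) - ca core * dw true (lo core true)) in *.
  exists c; intros b x Hx.
  destruct (cauchy_unique core z w dw (lin c a 0 a) (lin c da 0 da) zero_pw contp_zero Sw) with (b := b) (x := x) as [U1 U2].
  - eapply cauchy_sol_ext; [|apply cauchy_sol_lin; exact Sa].
    intros; unfold lin, zero_pw; ring.
  - rewrite E1; unfold lin; simpl in *; rewrite I1; ring.
  - rewrite E2; unfold lin; simpl in *; rewrite I2; ring.
  - exact Hx.
  - rewrite U1, U2; unfold lin; split; ring.
Qed.

(** At a real eigenvalue the imaginary part of [phi] has zero initial data and vanishes. An
    eigenfunction exists by hypothesis and is a nonzero multiple of the real part, to which it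
    passes on the right boundary condition. *)
Lemma phi_core (z : C) (u1 du1 u2 du2 : R -> C) : eigenvalue P z ->
  is_phi1 P z u1 du1 -> is_phi2 P z u1 du1 u2 du2 ->
  exists a da, eigenfun core (fst z) a da /\ 0 < ip core a a /\
    a true (slo true) = sin (alpha P) /\ da true (slo true) = - cos (alpha P) /\
    forall b x, sheet b x -> glue u1 u2 x = RtoC (a b x).
Proof.
  intros Hz [S1 [I1 I2]] [S2 [v [dv [L1 [L2 [L3 L4]]]]]].
  destruct (eigenvalue_core z Hz) as [Hz0 [w [dw [Hw Nw]]]].
  assert (Hs : forall b : bool, csolves z b (if b then u1 else u2) (if b then du1 else du2)).
  { intros [|]; [apply (solves_csolves z true left_int)|apply (solves_csolves z false right_int)]; auto. }
  destruct (extend_solution z (fun b : bool => if b then u1 else u2) (fun b : bool => if b then du1 else du2)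
    v dv _ _ Hs L1 L2 L3 L4 (phi2_linkedC v dv)) as [a [da [e [de [Hrep [Sa Se]]]]]].
    destruct Hrep as [_ [_ E]].
    destruct (E true _ (anchor_in true)) as [E1 E2]; simpl in E1, E2.
    rewrite I1 in E1; rewrite I2 in E2; inversion E1; inversion E2.
    rewrite Hz0 in Sa, Se.
    assert (Sa' : cauchy_sol core a da (lin (fst z) a 1 zero_pw)).
    { eapply cauchy_sol_ext; [|exact Sa]; intros; unfold lin, zero_pw; ring. }
    assert (Ez : forall b x, inS core b x -> e b x = 0).
    { intros b x Hx.
      destruct (cauchy_unique core (fst z) e de (lin 0 a 0 a) (lin 0 da 0 da) zero_pw contp_zero) with (b := b) (x := x) as [U _].
      - eapply cauchy_sol_ext; [|exact Se]; intros; unfold lin, zero_pw; ring.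
      - eapply cauchy_sol_ext; [|apply cauchy_sol_lin; exact Sa']; intros; unfold lin, zero_pw; ring.
      - unfold lin; simpl; lra.
      - unfold lin; simpl; lra.
      - exact Hx.
      - rewrite U; unfold lin; ring. }
    destruct (eigenfun_proportional (fst z) w dw a da Hw Sa') as [c Hc]; [simpl; lra|simpl; lra|].
    assert (c0 : c <> 0).
    { intros ->; rewrite (ip_null_r core w w) in Nw; [lra|apply Hw|].
      intros b x Hx; rewrite (proj1 (Hc b x Hx)); ring. }
    assert (Ca : contp a) by apply Sa.
    exists a, da; split; [split; [exact Sa'|split]|split; [|split; [|split]]].
    + unfold left_bc; simpl; rewrite <- H0, <- H2; ring.
    + destruct Hw as [_ [_ RB]]; unfold right_bc in *.
      destruct (Hc false _ (hi_in core false)) as [F1 F2]; rewrite F1, F2 in RB.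
      apply Rmult_eq_reg_l with c; [lra|exact c0].
    + destruct (Rle_lt_or_eq_dec _ _ (ip_ge0 core a Ca)) as [h|h]; [exact h|exfalso].
      rewrite (ip_null_r core w w) in Nw; [lra|apply Hw|].
      intros b x Hx; rewrite (proj1 (Hc b x Hx)), (ip_eq0 core a Ca (eq_sym h) b x Hx); ring.
    + simpl; lra.
    + simpl; lra.
    + intros b x Hx; transitivity ((if b then u1 else u2) x).
      * unfold glue; generalize (sheet_side b x Hx); destruct b, (Rlt_dec x 0); intros; try reflexivity; lra.
      * rewrite (proj1 (E b x Hx)), (Ez b x (sheet_inS b x Hx)); reflexivity.
Qed.

(** The right-hand sides [g] and [h] are the two parts of [q f - p f'']; the limits of [f''] at 0
    make them continuous up to the interface. *)
Lemma extend_domain_function (f f' f'' : R -> C) :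
  (forall x : R, dom x -> is_derive_within dom f x (f' x)) ->
  (forall x : R, dom x -> is_derive_within dom f' x (f'' x)) ->
  continuous_on dom f'' ->
  (exists l, left_lim f'' l) -> (exists l, right_lim f'' l) ->
  boundary_conditions P f f' -> transmission_conditions P f f' ->
  exists a da e de g h, rep (fun _ => f) (fun _ => f') a da e de /\ contp g /\ contp h /\
    sol core a da g /\ sol core e de h.
Proof.
  intros D1 D2 Cf [lm Hlm] [lp Hlp] Hb [v [dv [w [dw [H1 [H2 [H3 [H4 HT]]]]]]]].
  assert (HG : forall b, exists Gr Gi : R -> R, (forall x, continuous Gr x) /\ (forall x, continuous Gi x) /\
    forall x, sheet b x -> f'' x = (Gr x, Gi x)).
  { intros b.
    assert (Hl : exists l, one_sided b f'' l) by (destruct b; [exists lm|exists lp]; assumption).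
    destruct Hl as [l Hl]; apply one_sided_comps in Hl; destruct Hl as [Hl1 Hl2].
    assert (Hc : forall x, sheet b x -> contin (sheet b) (fun t => fst (f'' t)) x /\ contin (sheet b) (fun t => snd (f'' t)) x).
    { intros x Hx; destruct (continuous_on_comps dom f'' x Cf (sheet_dom b x Hx)) as [A1 A2].
      split; apply (contin_sub dom); try assumption; apply sheet_dom. }
    destruct (extend_continuous b (fun t => fst (f'' t)) (fst l)) as [Gr [C1 E1]]; [apply Hc|exact Hl1|].
    destruct (extend_continuous b (fun t => snd (f'' t)) (snd l)) as [Gi [C2 E2]]; [apply Hc|exact Hl2|].
    exists Gr, Gi; split; [exact C1|split; [exact C2|]].
    intros x Hx; rewrite <- (E1 x Hx), <- (E2 x Hx); apply surjective_pairing. }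
  destruct (HG true) as [Gr1 [Gi1 [C1 [C1' E1]]]], (HG false) as [Gr2 [Gi2 [C2 [C2' E2]]]].
  set (Gr := fun b : bool => if b then Gr1 else Gr2).
  set (Gi := fun b : bool => if b then Gi1 else Gi2).
  assert (CGr : contp Gr) by (intros [|]; assumption).
  assert (CGi : contp Gi) by (intros [|]; assumption).
  assert (EG : forall b x, sheet b x -> f'' x = (Gr b x, Gi b x)) by (intros [|]; assumption).
  destruct (extend_pair (fun _ => f) (fun _ => f') (fun _ => f'') Gr Gi CGr CGi) as [a [da [e [de [HD HE]]]]].
  { intros b x Hx; assert (Dx := sheet_dom b x Hx); split; [|split; [|apply EG, Hx]];
    (apply (cdwithin_sub dom); [apply sheet_dom|]); apply is_derive_within_comps; [apply D1|apply D2]; exact Dx. }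
  assert (Hrep : rep (fun _ => f) (fun _ => f') a da e de).
  { split; [intros b x; destruct (HD b x) as [B1 [_ [B3 _]]]; split; assumption|split; [|exact HE]].
    split; intros b x; destruct (HD b x) as [_ [B2 [_ B4]]];
    [exact (is_derive_cont _ _ _ B2)|exact (is_derive_cont _ _ _ B4)]. }
  destruct (rep_contp _ _ _ _ _ _ Hrep) as [Ca Ce].
  destruct (rep_linked _ _ _ _ _ _ v dv w dw Hrep H1 H2 H3 H4 (transmission_linkedC _ _ _ _ HT)) as [La Le].
  destruct (rep_boundary f f' a da e de Hrep Hb) as [Ba Be].
  assert (Hcont : forall u G : pw, contp u -> contp G -> contp (fun b x => qe b x * u b x - pb b * G b x)).
  { intros u G Cu CG b x; apply cont_minus; apply cont_mult; [apply qe_cont|apply Cu|apply cont_const|apply CG]. }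
  exists a, da, e, de, (fun b x => qe b x * a b x - pb b * Gr b x), (fun b x => qe b x * e b x - pb b * Gi b x).
  split; [exact Hrep|split; [apply Hcont; assumption|split; [apply Hcont; assumption|split]]].
  - split; [split; [exact Ca|split; [|exact La]]|exact Ba].
    intros b x _; destruct (HD b x) as [B1 [B2 _]]; split; [exact B1|].
    apply (is_derive_eq _ _ _ _ B2); simpl; field; generalize (pb_pos b); lra.
  - split; [split; [exact Ce|split; [|exact Le]]|exact Be].
    intros b x _; destruct (HD b x) as [_ [_ [B3 B4]]]; split; [exact B3|].
    apply (is_derive_eq _ _ _ _ B4); simpl; field; generalize (pb_pos b); lra.
Qed.

(** * Weighted integrals and the terms of the series *)

Definition wsum (h : pw) : R :=
  minor P 3 4 / p1 P * RInt (h true) (- PI) 0 + minor P 1 2 / p2 P * RInt (h false) 0 PI.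

Lemma ip_wsum (u v : pw) : ip core u v = minor P 3 4 * wsum (fun b x => u b x * v b x).
Proof. unfold ip, wt, wsum; simpl; unfold kb, pb, Rdiv; ring. Qed.

Lemma wsum_lin (c d : R) (u v : pw) : contp u -> contp v ->
  wsum (lin c u d v) = c * wsum u + d * wsum v.
Proof.
  intros Cu Cv; unfold wsum, lin.
  rewrite !RInt_lin by (apply Cu || apply Cv); ring.
Qed.

Lemma RInt_pair (b : bool) (g : R -> C) (A B : R -> R) :
  (forall x, continuous A x) -> (forall x, continuous B x) ->
  (forall x, sheet b x -> g x = (A x, B x)) ->
  RInt (V := C_R_CompleteNormedModule) g (slo b) (shi b) =
    (RInt A (slo b) (shi b), RInt B (slo b) (shi b)).
Proof.
  intros CA CB E.
  transitivity (RInt (V := C_R_CompleteNormedModule) (fun x => (A x, B x)) (slo b) (shi b)).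
  - apply RInt_ext; intros x; assert (L := slo_lt_shi b).
    rewrite Rmin_left, Rmax_right by lra; intros Hx; apply E, sheet_iff.
    destruct b; simpl in *; lra.
  - apply is_RInt_unique.
    apply (is_RInt_fct_extend_pair (U := R_NormedModule) (V := R_NormedModule) (fun x => (A x, B x)));
    apply (RInt_correct (V := R_CompleteNormedModule)), ex_RInt_cont; assumption.
Qed.

Lemma weighted_int_pair (g : R -> C) (A B : pw) : contp A -> contp B ->
  (forall b x, sheet b x -> g x = (A b x, B b x)) -> weighted_int P g = (wsum A, wsum B).
Proof.
  intros CA CB E; unfold weighted_int.
  assert (E1 := RInt_pair true g (A true) (B true) (CA true) (CB true) (E true)).
  assert (E2 := RInt_pair false g (A false) (B false) (CA false) (CB false) (E false)).
  simpl slo in E1, E2; simpl shi in E1, E2; rewrite E1, E2; unfold wsum.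
  apply injective_projections; simpl; ring.
Qed.

(** The normalizing factor occurs twice, so only its square, the inverse of the weighted integral,
    survives: neither the branch of the square root nor a negative radicand matters. The factor
    [Delta_34] cancels in the quotient of inner products. *)
Lemma term_pair (f phi : R -> C) (fr fi a : pw) (b : bool) (x : R) :
  contp fr -> contp fi -> contp a -> 0 < ip core a a ->
  (forall b x, sheet b x -> f x = (fr b x, fi b x)) ->
  (forall b x, sheet b x -> phi x = RtoC (a b x)) -> sheet b x ->
  (weighted_int P (fun xi => f xi * normalized P phi xi) * normalized P phi x)%C =
    (ip core fr a / ip core a a * a b x, ip core fi a / ip core a a * a b x).
Proof.
  intros Cfr Cfi Ca N0 Ef Ephi Hx; unfold normalized.
  set (A := fun b x => a b x * a b x).
  assert (CA : contp A) by (intros b' x'; apply (contp_mult a a b' Ca Ca)).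
  assert (EN : weighted_int P (fun t => phi t ^ 2)%C = RtoC (wsum A)).
  { rewrite (weighted_int_pair _ A (lin 0 A 0 A)); [|exact CA|apply contp_lin; exact CA|].
    - rewrite wsum_lin by exact CA; apply injective_projections; simpl; ring.
    - intros b' x' Hx'; rewrite (Ephi b' x' Hx').
      apply injective_projections; unfold lin, A; simpl; ring. }
  rewrite EN.
  assert (M0 := minor34_neq0).
  assert (W0 : wsum A <> 0).
  { intros E; rewrite ip_wsum in N0; unfold A in E; rewrite E in N0; lra. }
  assert (Hk := Csqrt_sq (wsum A)).
  assert (Hk0 : Csqrt (RtoC (wsum A)) <> 0%C).
  { intros E; rewrite E in Hk; apply W0; apply (f_equal fst) in Hk; simpl in Hk; lra. }
  set (k := (/ Csqrt (RtoC (wsum A)))%C).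
  assert (Hkk : (k * k)%C = RtoC (/ wsum A)).
  { unfold k; rewrite RtoC_inv by exact W0; rewrite <- Hk at 3; field; exact Hk0. }
  clearbody k.
  set (Fr := fun b x => fr b x * a b x); set (Fi := fun b x => fi b x * a b x).
  assert (CFr : contp Fr) by (intros b' x'; apply (contp_mult fr a b' Cfr Ca)).
  assert (CFi : contp Fi) by (intros b' x'; apply (contp_mult fi a b' Cfi Ca)).
  rewrite (weighted_int_pair _ (lin (fst k) Fr (- snd k) Fi) (lin (snd k) Fr (fst k) Fi));
    [|apply contp_lin; assumption|apply contp_lin; assumption|].
  - rewrite !wsum_lin by assumption.
    transitivity (k * k * ((wsum Fr, wsum Fi) * RtoC (a b x)))%C.
    + rewrite (Ephi b x Hx); apply injective_projections; simpl; ring.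
    + rewrite Hkk, !ip_wsum; fold Fr Fi A.
      apply injective_projections; simpl; field; split; assumption.
  - intros b' x' Hx'; rewrite (Ef b' x' Hx'), (Ephi b' x' Hx').
    apply injective_projections; unfold lin, Fr, Fi; simpl; ring.
Qed.

End Transfer.

Theorem theorem4p1
  (P : SL_data)
  (hp1 : 0 < p1 P) (hp2 : 0 < p2 P)
  (hq : continuous_on left_int (q P) /\ continuous_on right_int (q P))
  (hq0m : exists l : R, filterlim (q P) (at_left 0) (locally l))
  (hq0p : exists l : R, filterlim (q P) (at_right 0) (locally l))
  (hDelta : 0 < minor P 1 2 * minor P 3 4)
  (h0 : ~ eigenvalue P 0%C)
  (phi1 dphi1 phi2 dphi2 : C -> R -> C)
  (hphi1 : forall z : C, is_phi1 P z (phi1 z) (dphi1 z))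
  (hphi2 : forall z : C, is_phi2 P z (phi1 z) (dphi1 z) (phi2 z) (dphi2 z))
  (lam : nat -> C)
  (hlam_inj : forall m n : nat, lam m = lam n -> m = n)
  (hlam : forall z : C, eigenvalue P z <-> exists n : nat, lam n = z)
  (f f' f'' : R -> C)
  (hf' : forall x : R, dom x -> is_derive_within dom f x (f' x))
  (hf'' : forall x : R, dom x -> is_derive_within dom f' x (f'' x))
  (hfcont : continuous_on dom f /\ continuous_on dom f' /\ continuous_on dom f'')
  (hf0m : exists l l' l'' : C,
     left_lim f l /\ left_lim f' l' /\ left_lim f'' l'')
  (hf0p : exists l l' l'' : C,
     right_lim f l /\ right_lim f' l' /\ right_lim f'' l'')
  (hfbc : boundary_conditions P f f')
  (hftc : transmission_conditions P f f') :
  let vphi := fun n : nat =>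
    normalized P (glue (phi1 (lam n)) (phi2 (lam n))) in
  let term := fun (n : nat) (x : R) =>
    (weighted_int P (fun xi => f xi * vphi n xi) * vphi n x)%C in
  abs_convergent_on dom term /\ unif_convergent_on dom term f.
Proof.
  intros vphi term.
  assert (Hq : exists qe : pw, contp qe /\ forall b x, sheet b x -> q P x = qe b x).
  { destruct hq as [hq1 hq2], hq0m as [lm Hlm], hq0p as [lp Hlp].
    destruct (extend_continuous true (q P) lm) as [q1 [C1 E1]].
    { intros x Hx; apply (continuous_on_real left_int); assumption. }
    { apply side_lim_real, Hlm. }
    destruct (extend_continuous false (q P) lp) as [q2 [C2 E2]].
    { intros x Hx; apply (continuous_on_real right_int); assumption. }
    { apply side_lim_real, Hlp. }
    exists (fun b : bool => if b then q1 else q2); split; intros [|]; assumption. }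
  destruct Hq as [qe [Cq Eq]].
  set (K := core P qe hp1 hp2 hDelta Cq).
  assert (ker : trivial_kernel K) by (apply core_trivial_kernel; assumption).
  (* The extended eigenfunction and its derivative are packed into one pair so that one choice for
     each [n] selects both. *)
  assert (Hphi : forall n, exists ad : pw * pw, eigenfun K (fst (lam n)) (fst ad) (snd ad) /\
    0 < ip K (fst ad) (fst ad) /\ fst ad true (slo true) = sin (alpha P) /\
    snd ad true (slo true) = - cos (alpha P) /\
    forall b x, sheet b x -> glue (phi1 (lam n)) (phi2 (lam n)) x = RtoC (fst ad b x)).
  { intros n.
    assert (Hev : eigenvalue P (lam n)) by (apply hlam; exists n; reflexivity).
    destruct (phi_core P qe hp1 hp2 hDelta Cq Eq (lam n) _ _ _ _ Hev (hphi1 (lam n)) (hphi2 (lam n))) as [a [da Ha]].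
    exists (a, da); exact Ha. }
  set (ad := fun n => proj1_sig (constructive_indefinite_description _ (Hphi n))).
  set (v := fun n => fst (ad n)); set (dv := fun n => snd (ad n)); set (l := fun n => fst (lam n)).
  assert (Had : forall n, eigenfun K (l n) (v n) (dv n) /\ 0 < ip K (v n) (v n) /\
    v n true (slo true) = sin (alpha P) /\ dv n true (slo true) = - cos (alpha P) /\
    forall b x, sheet b x -> glue (phi1 (lam n)) (phi2 (lam n)) x = RtoC (v n b x)).
  { intros n; exact (proj2_sig (constructive_indefinite_description _ (Hphi n))). }
  clearbody ad.
  assert (eig : forall n, eigenfun K (l n) (v n) (dv n)) by apply Had.
  assert (Hn : forall n, 0 < ip K (v n) (v n)) by apply Had.
  assert (Hreal : forall n, snd (lam n) = 0).
  { intros n; apply (eigenvalue_core P qe hp1 hp2 hDelta Cq Eq); apply hlam; exists n; reflexivity. }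
  assert (Hinj : forall m n, l m = l n -> m = n).
  { intros m n E; apply hlam_inj, injective_projections; [exact E|rewrite !Hreal; reflexivity]. }
  assert (Hcomp : forall z e de, eigenfun K z e de ->
    exists n c, forall b x, inS K b x -> e b x = c * v n b x).
  { intros z e de He.
    destruct (classic (exists b x, inS K b x /\ e b x <> 0)) as [Hne|Hne].
    - destruct (proj1 (hlam (RtoC z)) (core_eigenvalue P qe hp1 hp2 hDelta Cq Eq z e de He Hne)) as [n En].
      assert (Hz : l n = z) by (unfold l; rewrite En; reflexivity).
      destruct (Had n) as [Hen [_ [I1 [I2 _]]]]; rewrite Hz in Hen.
      destruct (eigenfun_proportional P qe hp1 hp2 hDelta Cq z e de (v n) (dv n) He (proj1 Hen) I1 I2) as [c Hc].
      exists n, c; intros b x Hx; apply (Hc b x Hx).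
    - exists 0%nat, 0; intros b x Hx; rewrite Rmult_0_l.
      apply NNPP; intros N; apply Hne; exists b, x; split; assumption. }
  destruct (extend_domain_function P qe hp1 hp2 hDelta Cq f f' f'' hf' hf'') as
    [fr [dfr [fi [dfi [gr [gi [Hrep [Cgr [Cgi [Sr Si]]]]]]]]]]; try assumption.
  { apply hfcont. }
  { destruct hf0m as [_ [_ [k [_ [_ Hk]]]]]; exists k; exact Hk. }
  { destruct hf0p as [_ [_ [k [_ [_ Hk]]]]]; exists k; exact Hk. }
  assert (Hf : forall b x, sheet b x -> f x = (fr b x, fi b x)) by (intros b x Hx; apply Hrep, Hx).
  assert (Hterm : forall n b x, sheet b x ->
    term n x = (coef K v fr n * v n b x, coef K v fi n * v n b x)).
  { intros n b x Hx; unfold term, vphi, coef.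
    apply (term_pair P qe hp1 hp2 hDelta Cq); try assumption;
      [apply Sr|apply Si|apply eig|apply Hn|apply Had]. }
  split.
  - intros x Hx; destruct (dom_sheet x Hx) as [b Hb].
    assert (Hin : inS K b x) by (apply sheet_iff in Hb; apply Hb).
    assert (X1 := expansion_abs K v dv l eig Hn Hinj ker fr dfr gr Cgr Sr b x Hin).
    assert (X2 := expansion_abs K v dv l eig Hn Hinj ker fi dfi gi Cgi Si b x Hin).
    apply (ex_series_le (K := R_AbsRing) (V := R_CompleteNormedModule) _
      (fun n => Rabs (coef K v fr n * v n b x) + Rabs (coef K v fi n * v n b x))).
    + intros n; change (Rabs (Cmod (term n x)) <= Rabs (coef K v fr n * v n b x) + Rabs (coef K v fi n * v n b x)).
      rewrite Rabs_right by (apply Rle_ge, Cmod_ge_0).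
      rewrite (Hterm n b x Hb); apply Cmod_le_sum.
    + apply (ex_series_plus (V := R_NormedModule) _ _ X1 X2).
  - intros eps He.
    (* Two bounds of [eps / 3], one for each part, leave room for the strict inequality. *)
    destruct (expansion_unif K v dv l eig Hn Hinj ker fr dfr gr Cgr Sr Hcomp (eps / 3)) as [N1 HN1]; [lra|].
    destruct (expansion_unif K v dv l eig Hn Hinj ker fi dfi gi Cgi Si Hcomp (eps / 3)) as [N2 HN2]; [lra|].
    exists (N1 + N2)%nat; intros n Hnn x Hx; destruct (dom_sheet x Hx) as [b Hb].
    assert (Hin : inS K b x) by (apply sheet_iff in Hb; apply Hb).
    specialize (HN1 n b x (Nat.le_trans _ _ _ (Nat.le_add_r _ _) Hnn) Hin).
    specialize (HN2 n b x (Nat.le_trans _ _ _ (Nat.le_add_l _ _) Hnn) Hin).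
    assert (Hsum : sum_n (fun k => term k x) n = (comb (coef K v fr) v n b x, comb (coef K v fi) v n b x)).
    { rewrite !comb_sum; clear -Hterm Hb; induction n.
      - rewrite sum_O, !rsum_O; apply Hterm, Hb.
      - rewrite sum_Sn, !rsum_S, IHn, (Hterm (S n) b x Hb); reflexivity. }
    rewrite Hsum, (Hf b x Hb).
    eapply Rle_lt_trans; [apply Cmod_le_sum|].
    simpl; unfold Rminus in HN1, HN2; lra.
Qed.
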